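(* Let $V$ be a vertex operator algebra, $g$ an automorphism of $V$ of finite order $k$, $W=\coprod_{n\in\mathbb{C}}W_{(n)}$ a $\mathbb{C}$-graded vector space, and $Y^g:V\otimes W\to W[[x^{1/k},x^{-1/k}]]$ a grading-preserving linear map satisfying the grading-restriction condition, the formal monodromy condition, the lower-truncation condition, the identity property, the $L^g(0)$-grading condition and the $L^g(-1)$-derivative condition. Then $Y^g$ satisfies the twisted Jacobi identity if and only if it satisfies the following property: for any $u,v\in V$, $w\in W$ and $w'\in W'=\coprod_{n\in\mathbb{C}}W_{(n)}^*$ there exists a multivalued analytic function of the form $$f(z_1,z_2)=\sum_{r,s=N_1}^{N_2}a_{rs}z_1^{r/k}z_2^{s/k}(z_1-z_2)^{-N}$$ with $N_1,N_2\in\mathbb{Z}$, $N\in\mathbb{Z}_+$, $a_{rs}\in\mathbb{C}$, such that for $p\in\mathbb{Z}/k\mathbb{Z}$ the series $$\langle w',Y^{g;p}(u,z_1)Y^{g;p}(v,z_2)w\rangle=\sum_{n\in\mathbb{C}}\langle w',Y^{g;p}(u,z_1)\pi_nY^{g;p}(v,z_2)w\rangle,$$ $$\langle w',Y^{g;p}(v,z_2)Y^{g;p}(u,z_1)w\rangle=\sum_{n\in\mathbb{C}}\langle w',Y^{g;p}(v,z_2)\pi_nY^{g;p}(u,z_1)w\rangle,$$ $$\langle w',Y^{g;p}(Y(u,z_1-z_2)v,z_2)w\rangle=\sum_{n\in\mathbb{C}}\langle w',Y^{g;p}(\pi_nY(u,z_1-z_2)v,z_2)w\rangle$$ are absolutely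 convergent in the regions $|z_1|>|z_2|>0$, $|z_2|>|z_1|>0$, $|z_2|>|z_1-z_2|>0$, respectively, to the branch $$\sum_{r,s=N_1}^{N_2}a_{rs}e^{(r/k)l_{\tilde p}(z_1)}e^{(s/k)l_{\tilde p}(z_2)}(z_1-z_2)^{-N}$$ of $f(z_1,z_2)$.
   Context: $(V,Y,\mathbf 1,\omega)$ is a ($\mathbb{Z}$-graded) vertex operator algebra. Let $\eta=e^{2\pi\sqrt{-1}/k}$ and $V^j=\{v\in V: gv=\eta^jv\}$ for $j\in\mathbb{Z}/k\mathbb{Z}$, so $V=\coprod_{j}V^j$. Write $Y^g(v,x)w=\sum_{n\in\frac1k\mathbb{Z}}Y_n^g(v)w\,x^{-n-1}$. Grading-preserving means: $x^{1/k}$ has degree $-1/k$, i.e. $Y^g_r(v)W_{(n)}\subset W_{(n+m-r-1)}$ for $v\in V_{(m)}$. $\pi_n$ denotes the projection onto the subspace of weight $n$ (of $W$, resp. $V$). Conditions: - Grading-restriction: for each $n\in\mathbb{C}$, $\dim W_{(n)}<\infty$ and $W_{(n+l/k)}=0$ for all sufficiently negative integers $l$. - Formal monodromy: for $j\in\mathbb{Z}/k\mathbb{Z}$ and $v\in V^j$, $Y^g(v,x)=\sum_{n\in j/k+\mathbb{Z}}Y_n^g(v)x^{-n-1}$. - Lower-truncation: for $v\in V$, $w\in W$, $Y_n^g(v)w=0$ for $n$ sufficiently large. - Identity property: $Y^g(\mathbf 1,x)=1$. - $L^g(0)$-grading condition: with $Y^g(\omega,x)=\sum_{n\in\mathbb{Z}}L^g(n)x^{-n-2}$,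 $L^g(0)w=mw$ for $w\in W_{(m)}$. - $L^g(-1)$-derivative condition: $\frac{d}{dx}Y^g(v,x)=Y^g(L(-1)v,x)$ for $v\in V$, where $Y(\omega,x)=\sum_{n\in\mathbb{Z}}L(n)x^{-n-2}$. - Twisted Jacobi identity: for $u,v\in V$, acting on $W$, $$x_0^{-1}\delta\Big(\frac{x_1-x_2}{x_0}\Big)Y^g(u,x_1)Y^g(v,x_2)-x_0^{-1}\delta\Big(\frac{x_2-x_1}{-x_0}\Big)Y^g(v,x_2)Y^g(u,x_1)=\frac1k\sum_{j\in\mathbb{Z}/k\mathbb{Z}}x_2^{-1}\delta\Big(\eta^j\frac{(x_1-x_0)^{1/k}}{x_2^{1/k}}\Big)Y^g(Y(g^ju,x_0)v,x_2),$$ where $\delta(x)=\sum_{n\in\mathbb{Z}}x^n$ and binomials are expanded in nonnegative powers of the second variable. Branches: for $z\in\mathbb{C}^\times$, $\log z=\log|z|+\sqrt{-1}\arg z$ with $0\le\arg z<2\pi$, and $l_p(z)=\log z+2p\pi\sqrt{-1}$ for $p\in\mathbb{Z}$. For $p\in\mathbb{Z}/k\mathbb{Z}$ let $\tilde p\in p$ with $0\le\tilde p<k$; then $Y^{g;p}(v,z)w=Y^g(v,x)w\big|_{x^n=e^{nl_{\tilde p}(z)}}\in\prod_{n\in\mathbb{C}}W_{(n)}$.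
   Formalization: In the region |z2|>|z1-z2|>0, absolute convergence is asserted everywhere, but convergence to the given branch of f only where |arg z1 - arg z2| < pi/2, since the printed value is false when the cut arg = 0 separates z1 and z2. *)

(* Defs.v *)
From HB Require Import structures.
From mathcomp Require Import all_boot all_order all_algebra finmap complex.
From mathcomp Require Import all_classical all_reals all_analysis.

Set Implicit Arguments.
Unset Strict Implicit.
Unset Printing Implicit Defensive.

Import Order.TTheory GRing.Theory Num.Theory.
Local Open Scope classical_set_scope.
Local Open Scope complex_scope.
Local Open Scope ring_scope.

(* The complex numbers are R[i] for R : realType.                             *)
(*                                                                            *)
(* All sums written \sum_(i \in A) over an infinite set A are the library's   *)
(* finitely supported sums, which are 0 if the support is infinite.  Wherever *)
(* they are used below the support is finite by the truncation and grading    *)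
(* conditions.  Genuinely infinite sums only occur through abs_summable and   *)
(* has_sum.                                                                   *)

Section Graded.
Variable R : realType.
Local Notation C := R[i].

(* An I-grading of M, given by the projections onto the homogeneous           *)
(* subspaces; the subspace of weight i is {v | gproj i v = v}.                *)
Record grading (I : choiceType) (M : lmodType C) := Grading {
  gproj : I -> {linear M -> M};
  gproj_orth : forall i j v,
    gproj i (gproj j v) = if i == j then gproj j v else 0;
  gproj_fin : forall v, finite_set [set i | gproj i v != 0];
  gproj_sum : forall v, \sum_(i \in [set: I]) gproj i v = v }.

Definition homog (I : choiceType) (M : lmodType C) (G : grading I M) (i : I)
    (v : M) : Prop :=
  gproj G i v = v.

Definition homog_findim (I : choiceType) (M : lmodType C) (G : grading I M)
    (i : I) : Prop :=
  exists (d : nat) (b : 'I_d -> M), (forall j, homog G i (b j)) /\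
    forall v, homog G i v -> exists c : 'I_d -> C, v = \sum_j c j *: b j.

(* Linear functionals belonging to \coprod_i (M_(i))^*, i.e. vanishing on     *)
(* M_(i) for all but finitely many i.                                         *)
Definition in_graded_dual (I : choiceType) (M : lmodType C) (G : grading I M)
    (f : {scalar M}) : Prop :=
  exists s : seq I, forall i v, i \notin s -> homog G i v -> f v = 0.

(* Pairing of the graded dual with \prod_i M_(i). *)
Definition pairing (I : choiceType) (M : lmodType C) (f : {scalar M})
    (F : I -> M) : C :=
  \sum_(i \in [set: I]) (f (F i) : C).

End Graded.

Section Complex.
Variable R : realType.
Local Notation C := R[i].

Definition cexp (z : C) : C :=
  (expR (complex.Re z))%:C * (cos (complex.Im z) +i* sin (complex.Im z)).

Definition carg (z : C) : R :=
  xget 0 [set t : R | 0 <= t < 2 * pi /\ z = `|z| * (cos t +i* sin t)].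

Definition clog (z : C) : C := ln (Normc.normc z) +i* carg z.

Definition lbranch (p : int) (z : C) : C :=
  clog z + (0 +i* (2 * p%:~R * pi)).

Definition eta (k : nat) : C := cexp (0 +i* (2 * pi / k%:R)).

Definition binc (a : C) (i : nat) : C :=
  (\prod_(t < i) (a - t%:R)) / (i`!)%:R.

Definition abs_summable (I : choiceType) (a : I -> C) : Prop :=
  summable [set: I] (fun i => (Normc.normc (a i))%:E).

Definition has_sum (I : choiceType) (a : I -> C) (s : C) : Prop :=
  forall e : C, 0 < e -> exists J0 : {fset I}, forall J : {fset I},
    (J0 `<=` J)%fset -> `|\sum_(i <- J) a i - s| < e.

End Complex.

(* Formal series in x0, x1, x2 with exponents in (1/k)Z: the coefficient      *)
(* function sends (e0, e1, e2) to the coefficient of                          *)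
(* x0^(e0/k) x1^(e1/k) x2^(e2/k).                                             *)
Section Formal.
Variable R : realType.
Local Notation C := R[i].

Definition expo := (int * int * int)%type.

(* The formal sum over t in T of the monomials c t * x^(ex t). *)
Definition fsum (T : choiceType) (M : zmodType) (c : T -> M) (ex : T -> expo) :
    expo -> M :=
  fun e => \sum_(t \in [set t | ex t = e]) c t.

Definition fmul (M : lmodType C) (A : expo -> C) (B : expo -> M) : expo -> M :=
  fun e => \sum_(d \in [set: expo]) A d *: B (e - d).

(* x0^-1 delta((x1 - x2) / x0)
     = \sum_(n, i) (-1)^i binom(n, i) x0^(-n-1) x1^(n-i) x2^i *)
Definition delta12 (k : nat) : expo -> C :=
  fsum (fun t : int * nat => (-1) ^+ t.2 * binc t.1%:~R t.2 : C)
       (fun t => (k%:Z * (- t.1 - 1), k%:Z * (t.1 - t.2%:Z), k%:Z * t.2%:Z)).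

(* x0^-1 delta((x2 - x1) / (- x0)) *)
Definition delta21 (k : nat) : expo -> C :=
  fsum (fun t : int * nat => (-1) ^ t.1 * ((-1) ^+ t.2 * binc t.1%:~R t.2) : C)
       (fun t => (k%:Z * (- t.1 - 1), k%:Z * t.2%:Z, k%:Z * (t.1 - t.2%:Z))).

(* x2^-1 delta(c (x1 - x0)^(1/k) / x2^(1/k))
     = \sum_(m, i) c^m (-1)^i binom(m/k, i) x1^(m/k-i) x0^i x2^(-m/k-1) *)
Definition delta_iter (k : nat) (c : C) : expo -> C :=
  fsum (fun t : int * nat =>
          c ^ t.1 * ((-1) ^+ t.2 * binc (t.1%:~R / k%:R) t.2) : C)
       (fun t => (k%:Z * t.2%:Z, t.1 - k%:Z * t.2%:Z, - t.1 - k%:Z)).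

(* A vertex operator map is given by Y n v w, the coefficient of x^(-n/k-1)   *)
(* in Y(v, x)w.                                                               *)

(* Y(u, x1) Y(v, x2) w *)
Definition prod12 (k : nat) (V W : lmodType C)
    (Y : int -> {bilinear V -> W -> W}) (u v : V) (w : W) : expo -> W :=
  fsum (fun t : int * int => Y t.1 u (Y t.2 v w))
       (fun t => (0, - t.1 - k%:Z, - t.2 - k%:Z)).

(* Y(v, x2) Y(u, x1) w *)
Definition prod21 (k : nat) (V W : lmodType C)
    (Y : int -> {bilinear V -> W -> W}) (u v : V) (w : W) : expo -> W :=
  fsum (fun t : int * int => Y t.2 v (Y t.1 u w))
       (fun t => (0, - t.1 - k%:Z, - t.2 - k%:Z)).

(* Y(YV(u, x0)v, x2) w, where YV(u, x) has integral exponents *)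
Definition iterate (k : nat) (V W : lmodType C)
    (YV : int -> {bilinear V -> V -> V})
    (Y : int -> {bilinear V -> W -> W}) (u v : V) (w : W) : expo -> W :=
  fsum (fun t : int * int => Y t.2 (YV t.1 u v) w)
       (fun t => (k%:Z * (- t.1 - 1), 0, - t.2 - k%:Z)).

End Formal.

Section VOA.
Variable R : realType.
Local Notation C := R[i].

Record voa := VOA {
  voa_space :> lmodType C;
  voa_gr : grading int voa_space;
  voa_Y : int -> {bilinear voa_space -> voa_space -> voa_space};
  voa_one : voa_space;
  voa_omega : voa_space;
  voa_findim : forall n, homog_findim voa_gr n;
  voa_bounded : exists N : int, forall n v, n < N -> homog voa_gr n v -> v = 0;
  voa_one_wt : homog voa_gr 0 voa_one;
  voa_omega_wt : homog voa_gr 2 voa_omega;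
  voa_truncation : forall u v, exists N : int, forall n,
    N <= n -> voa_Y n u v = 0;
  voa_identity : forall n v,
    voa_Y n voa_one v = if n == -1 then v else 0;
  voa_creation : forall v,
    (forall n, 0 <= n -> voa_Y n v voa_one = 0) /\ voa_Y (-1) v voa_one = v;
  voa_jacobi : forall u v w e,
    fmul (delta12 R 1) (prod12 1 voa_Y u v w) e
    - fmul (delta21 R 1) (prod21 1 voa_Y u v w) e
    = fmul (delta_iter 1 1) (iterate 1 voa_Y voa_Y u v w) e;
  (* L(n) = voa_Y (n + 1) omega *)
  voa_virasoro : exists c : C, forall (m n : int) v,
    voa_Y (m + 1) voa_omega (voa_Y (n + 1) voa_omega v)
    - voa_Y (n + 1) voa_omega (voa_Y (m + 1) voa_omega v)
    = (m - n)%:~R *: voa_Y (m + n + 1) voa_omega v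
      + (if m + n == 0 then (m ^+ 3 - m)%:~R / 12 * c else 0) *: v;
  voa_L0 : forall n v, homog voa_gr n v -> voa_Y 1 voa_omega v = n%:~R *: v;
  voa_Lm1 : forall n v w,
    (- n - 1)%:~R *: voa_Y n v w = voa_Y (n + 1) (voa_Y 0 voa_omega v) w }.

Definition voa_automorphism (V : voa) (g : {linear V -> V}) : Prop :=
  [/\ bijective g,
      forall n u v, g (voa_Y V n u v) = voa_Y V n (g u) (g v),
      g (voa_one V) = voa_one V
    & g (voa_omega V) = voa_omega V].

Definition has_finite_order (V : voa) (g : {linear V -> V}) (k : nat) : Prop :=
  [/\ (0 < k)%N,
      forall v, iter k g v = v
    & forall j, (0 < j < k)%N -> exists v, iter j g v <> v].

End VOA.

(* Yg l is the operator Y^g_{l/k}: Y^g(v, x)w = \sum_l (Yg l v w) x^(-l/k-1). *)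
Section Twisted.
Variables (R : realType) (V : voa R) (g : {linear V -> V}) (k : nat).
Local Notation C := R[i].
Variables (W : lmodType C) (gW : grading C W).
Variable Yg : int -> {bilinear V -> W -> W}.

Definition grading_preserving : Prop :=
  forall (m l : int) (n : C) v w, homog (voa_gr V) m v -> homog gW n w ->
    homog gW (n + m%:~R - l%:~R / k%:R - 1) (Yg l v w).

Definition grading_restriction : Prop :=
  forall n : C, homog_findim gW n /\
    exists N : int, forall l w, l < N ->
      homog gW (n + l%:~R / k%:R) w -> w = 0.

Definition formal_monodromy : Prop :=
  forall (j : int) v, g v = eta R k ^ j *: v ->
    forall l w, (l != j %[mod k%:Z])%Z -> Yg l v w = 0.

Definition lower_truncation : Prop :=
  forall v w, exists N : int, forall l, N <= l -> Yg l v w = 0.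

Definition identity_property : Prop :=
  forall l w, Yg l (voa_one V) w = if l == - k%:Z then w else 0.

(* L^g(0) = Y^g_1(omega) *)
Definition L0_grading : Prop :=
  forall m w, homog gW m w -> Yg k%:Z (voa_omega V) w = m *: w.

(* coefficients of x^(-l/k-2) *)
Definition Lm1_derivative : Prop :=
  forall l v w, (- (l%:~R / k%:R) - 1) *: Yg l v w
                = Yg (l + k%:Z) (voa_Y V 0 (voa_omega V) v) w.

Definition twisted_jacobi : Prop :=
  forall u v w e,
    fmul (delta12 R k) (prod12 k Yg u v w) e
    - fmul (delta21 R k) (prod21 k Yg u v w) e
    = k%:R^-1 *: \sum_(j < k) fmul (delta_iter k (eta R k ^+ j))
                               (iterate k (voa_Y V) Yg (iter j g u) v w) e.

(* Y^{g;p}(v, z)w in \prod_n W_(n), by its component of weight n *)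
Definition Ygp (p : int) (v : V) (z : C) (w : W) : C -> W := fun n =>
  \sum_(l \in [set: int])
    cexp ((- (l%:~R / k%:R) - 1) * lbranch p z) *: gproj gW n (Yg l v w).

(* pi_n Y(u, z)v; V_(n) is nonzero only for integral n *)
Definition Ycomp (u : V) (z : C) (v : V) (n : int) : V :=
  \sum_(m \in [set: int]) z ^ (- m - 1) *: gproj (voa_gr V) n (voa_Y V m u v).

(* The branch at (z1, z2), given by l_p(z1) and l_p(z2), of the multivalued   *)
(* function \sum_(N1 <= r, s <= N2) a r s z1^(r/k) z2^(s/k) (z1 - z2)^(-N).   *)
Definition fbranch (N1 N2 : int) (N : nat) (a : int -> int -> C) (p : int)
    (z1 z2 : C) : C :=
  \sum_(r \in [set r : int | N1 <= r <= N2])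
    \sum_(s \in [set s : int | N1 <= s <= N2])
      a r s * cexp (r%:~R / k%:R * lbranch p z1)
            * cexp (s%:~R / k%:R * lbranch p z2) * (z1 - z2) ^- N.

(* In the third region the series is single-valued and continuous across the  *)
(* cut arg z1 = 0 for fixed z2, whereas exp((r/k) l_p(z1)) is not.  So the    *)
(* series converges to the branch given by l_p(z1), l_p(z2) only where the    *)
(* cut does not separate z1 from z2.  As |z1 - z2| < |z2|, this is exactly    *)
(* the condition |arg z1 - arg z2| < pi/2 (otherwise the difference is within *)
(* pi/2 of 2 pi in absolute value).                                           *)
Definition duality : Prop :=
  forall (u v : V) (w : W) (w' : {scalar W}), in_graded_dual gW w' ->
  exists (N1 N2 : int) (N : nat) (a : int -> int -> C), (0 < N)%N /\
  forall p : 'I_k,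
  let p' := (p : nat)%:Z in
  [/\ forall z1 z2 : C, 0 < `|z2| < `|z1| ->
        let c (n : C) :=
          pairing w' (Ygp p' u z1 (Ygp p' v z2 w n)) in
        abs_summable c /\ has_sum c (fbranch N1 N2 N a p' z1 z2),
      forall z1 z2 : C, 0 < `|z1| < `|z2| ->
        let c (n : C) :=
          pairing w' (Ygp p' v z2 (Ygp p' u z1 w n)) in
        abs_summable c /\ has_sum c (fbranch N1 N2 N a p' z1 z2)
    & forall z1 z2 : C, 0 < `|z1 - z2| < `|z2| ->
        let c (n : int) :=
          pairing w' (Ygp p' (Ycomp u (z1 - z2) v n) z2 w) in
        abs_summable c /\
        (`|carg z1 - carg z2| < pi / 2 ->
         has_sum c (fbranch N1 N2 N a p' z1 z2))].

End Twisted.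

(* Main.v *)
(* If u lies in an eigenspace of g, if u, v, w are homogeneous and w' is
   supported in one weight, then the mode sum l1 + l2 is determined, and the
   three matrix coefficients become sequences p, q, r of one integer variable.
   The twisted Jacobi identity amounts to Borcherds' identities between p, q
   and r.  These hold if and only if p, q, r are the coefficients of the
   expansions in the three regions of one function
   \sum_s b_s z1^(-al+N-2-s) z2^(-be+s) (z1 - z2)^(-N): if r vanishes from N on,
   they say that (z1 - z2)^N p and (z1 - z2)^N q agree, which makes the sequence
   b finitely supported.  The expansions converge, to the stated branches, by
   the binomial series.  Conversely, at z1 = x^k and z2 = y^k with x, y > 0 and
   p = 0, the function f is a Laurent polynomial in x, y divided by
   (x^k - y^k)^N; homogeneity fixes the degree of that polynomial, and
   uniqueness of Laurent expansions identifies p, q and r with the expansions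
   of f.  Functionals supported in one weight separate the points of the
   finite-dimensional weight spaces. *)

From HB Require Import structures.
Require Import Defs.
From mathcomp Require Import all_boot all_order all_algebra finmap complex.
From mathcomp Require Import all_classical all_reals all_analysis.
From mathcomp Require Import zify ring lra.

Set Implicit Arguments.
Unset Strict Implicit.
Unset Printing Implicit Defensive.

Import Order.TTheory GRing.Theory Num.Theory.
Local Open Scope classical_set_scope.
Local Open Scope complex_scope.
Local Open Scope ring_scope.

(** * Borcherds' identity for formal sequences *)

Section Binomial.
Variable R : realType.
Local Notation C := R[i].
Implicit Types (x y : C).

Lemma binc0 x : binc x 0 = 1.
Proof. by rewrite /binc big_ord0 fact0 divr1. Qed.

Lemma bincS x t : binc x t.+1 *+ t.+1 = (x - t%:R) * binc x t.
Proof.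
have nz n : (n`!)%:R != 0 :> C by rewrite pnatr_eq0 -lt0n fact_gt0.
rewrite /binc big_ord_recr /= factS natrM -[LHS]mulr_natr.
have st : t.+1%:R != 0 :> C by rewrite pnatr_eq0.
by field; rewrite -[1 + _]/(1%:R + t%:R) -natrD add1n st nz.
Qed.

Lemma binc_Vandermonde x y t :
  \sum_(i < t.+1) binc x i * binc y (t - i) = binc (x + y) t.
Proof.
elim: t => [|t IH]; first by rewrite big_ord1 !binc0 mulr1.
have inj : injective (fun z : C => z *+ t.+1).
  by move=> a b /eqP; rewrite -subr_eq0 -mulrnBl mulrn_eq0 /= subr_eq0 => /eqP.
apply: inj; rewrite /= bincS -IH.
rewrite -sumrMnl.
transitivity (\sum_(i < t.+2) (binc x i *+ i) * binc y (t.+1 - i)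
  + \sum_(i < t.+2) binc x i * (binc y (t.+1 - i) *+ (t.+1 - i))).
  rewrite -big_split /=; apply: eq_bigr => i _.
  by rewrite mulrnAl mulrnAr -mulrnDr subnKC // -ltnS.
rewrite big_ord_recl mulr0n mul0r add0r.
rewrite [X in _ + X]big_ord_recr /= subnn mulr0n mulr0 addr0 -big_split /=.
rewrite mulr_sumr; apply: eq_bigr => i _.
rewrite /bump /= add1n bincS subSS subSn; last by rewrite -ltnS.
rewrite bincS natrB; last by rewrite -ltnS.
by ring.
Qed.

Lemma binc_nat (n t : nat) : binc (n%:R : C) t = ('C(n, t))%:R.
Proof.
have nz m : (m`!)%:R != 0 :> C by rewrite pnatr_eq0 -lt0n fact_gt0.
apply: (mulIf (nz t)); rewrite -natrM bin_ffact /binc divfK // .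
elim: t => [|t IH]; first by rewrite big_ord0 ffactn0.
rewrite big_ord_recr /= IH ffactnSr natrM.
case: (leqP t n) => h; first by rewrite natrB.
by rewrite ffact_small // !mul0r.
Qed.

Lemma binc_opp x t : (-1) ^+ t * binc x t = binc (t%:R - 1 - x) t.
Proof.
rewrite /binc mulrA; congr (_ / _).
rewrite -[X in (-1) ^+ X](card_ord t) -prodrN (reindex_inj rev_ord_inj) /=.
apply: eq_bigr => i _; rewrite natrB ?ltn_ord //.
by rewrite -[in i.+1%:R]addn1 natrD; ring.
Qed.

Definition bincz x (t : int) : C := if t is Posz n then binc x n else 0.
Definition sbincz x (t : int) : C :=
  if t is Posz n then (-1) ^+ n * binc x n else 0.

Lemma sbinczE x t : sbincz x t = (-1) ^ t * bincz x t.
Proof. by case: t => n //=; rewrite mulr0. Qed.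

Lemma bincz_nat_sym (n : nat) (t : int) :
  bincz n%:R t = bincz n%:R (n%:Z - t).
Proof.
wlog suff le : t / bincz (n%:R) t != 0 -> bincz n%:R t = bincz n%:R (n%:Z - t).
  have [e|ne] := eqVneq (bincz (n%:R) t) 0; last by rewrite le.
  have [->//|ne'] := eqVneq (bincz (n%:R) (n%:Z - t)) 0.
  by rewrite (le _ ne') subKr.
case: t => t; rewrite /= ?eqxx // binc_nat => nz.
have h : (t <= n)%N by rewrite leqNgt; apply: contra_neqN nz => /bin_small ->.
by rewrite subzn //= binc_nat bin_sub.
Qed.

(* Expansions in the three regions of [z1^A z2^T (z1 - z2)^M] differ by a
   formal delta function. *)
Lemma sbincz_residue (M T T' : int) : T + T' = M ->
  sbincz M%:~R T - (-1) ^ M * sbincz M%:~R T' = bincz (- T' - 1)%:~R (- M - 1).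
Proof.
case: M => [M|B] e.
  rewrite (_ : - Posz M - 1 = Negz M); last by rewrite NegzE; lia.
  rewrite /= !sbinczE -pmulrn bincz_nat_sym (_ : M%:Z - T = T'); last by lia.
  rewrite (_ : T = M%:Z - T'); last by lia.
  rewrite mulrA -expfzDr ?oppr_eq0 ?oner_eq0 //.
  rewrite (_ : (-1) ^ (M%:Z - T') = (-1) ^ (M%:Z + T') :> C) ?subrr //.
  rewrite !expfzDr ?oppr_eq0 ?oner_eq0 //; congr (_ * _).
  by rewrite -exprz_inv invrN invr1.
rewrite (_ : - Negz B - 1 = B%:Z); last by rewrite NegzE; lia.
have key (t : nat) : (-1) ^+ t * binc (Negz B)%:~R t = binc ((B + t)%:R : C) B.
  rewrite binc_opp (_ : _ - _ = (B + t)%:R); last first.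
    by rewrite NegzE mulrNz -pmulrn -addn1 !natrD; ring.
  by rewrite !binc_nat -[in LHS](bin_sub (leq_addl _ _)) addnK.
case: T e => T e /=.
  case: T' e => T' e /=; first by lia.
  rewrite mulr0 subr0 key.
  by rewrite (_ : (- Negz T' - 1)%:~R = (B + T)%:R :> C) // pmulrn; congr (_%:~R); lia.
case: T' e => T' e /=.
  rewrite sub0r key -mulNr.
  have -> : - (-1) ^ Negz B = (-1) ^+ B :> C.
    by rewrite NegzE -exprz_inv invrN invr1 -exprnP exprS mulN1r opprK.
  rewrite binc_opp; congr (binc _ _).
  by rewrite natrD intrD intrN -!pmulrn; ring.
rewrite mulr0 subr0; have -> : (- Negz T' - 1)%:~R = T'%:R :> C.
  by rewrite pmulrn; congr (_%:~R); lia.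
by rewrite binc_nat bin_small //; lia.
Qed.

End Binomial.

Section FiniteSupport.

Lemma fsum_seq (T : choiceType) (M : zmodType) (r : seq T) (f : T -> M) :
  uniq r -> (forall i, i \notin r -> f i = 0) ->
  \sum_(i \in [set: T]) f i = \sum_(i <- r) f i.
Proof.
move=> ur h; rewrite (bigfs _ ur) => [|i _]; last exact: h.
by apply: eq_fsbigl; apply/seteqP; split.
Qed.

Lemma fsum_nat (M : zmodType) K (f : nat -> M) :
  (forall i, (K <= i)%N -> f i = 0) ->
  \sum_(i \in [set: nat]) f i = \sum_(i < K) f i.
Proof.
move=> h; rewrite -(big_mkord xpredT f) (fsum_seq (iota_uniq 0 (K - 0))) //.
by move=> i; rewrite mem_iota add0n subn0 /= -leqNgt; apply: h.
Qed.

Lemma fsum1 (T : choiceType) (M : zmodType) (t : T) (f : T -> M) :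
  (forall i, i != t -> f i = 0) -> \sum_(i \in [set: T]) f i = f t.
Proof.
move=> h; rewrite (@fsum_seq _ _ [:: t]) ?big_seq1 // => i.
by rewrite inE; apply: h.
Qed.

Lemma fsumD (T : choiceType) (M : zmodType) (f g : T -> M) :
  finite_set [set i | f i != 0] -> finite_set [set i | g i != 0] ->
  \sum_(i \in [set: T]) (f i + g i) =
  \sum_(i \in [set: T]) f i + \sum_(i \in [set: T]) g i.
Proof.
move=> hf hg; pose r : seq T := fset_set ([set i | f i != 0] `|` [set i | g i != 0]).
have out i : i \notin r -> f i = 0 /\ g i = 0.
  rewrite /r in_fset_set ?finite_setU // => /negP; rewrite inE /=.
  by move=> /not_orP[/negP/negPn/eqP-> /negP/negPn/eqP->].
have ur : uniq r by exact: fset_uniq.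
rewrite !(fsum_seq ur) ?big_split // => i /out[] //.
by move=> -> ->; rewrite addr0.
Qed.

End FiniteSupport.

Section Borcherds.
Variable R : realType.
Local Notation C := R[i].
Implicit Types (c : nat -> C) (p q r : int -> C) (x y : C).

Definition vanish_from (M : int) p := forall i, M <= i -> p i = 0.

Definition tsum c p (n : int) : C :=
  \sum_(i \in [set: nat]) c i * p (n + i%:Z).

Definition sbinc x : nat -> C := fun i => (-1) ^+ i * binc x i.

(* [p], [q] and [r] stand for the two products and the iterate of a pair of
   fields, the first of which has modes in [al + Z]. *)
Definition borcherds (al : C) p q r := forall n j : int,
  tsum (sbinc n%:~R) p (- n - j) - (-1) ^ n * tsum (sbinc n%:~R) q j =
  tsum (binc (al + j%:~R)) r n.

Lemma tsumE c p M n K : vanish_from M p -> M <= n + K%:Z ->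
  tsum c p n = \sum_(i < K) c i * p (n + i%:Z).
Proof. by move=> h hK; apply: fsum_nat => i hi; rewrite h ?mulr0 //; lia. Qed.

Lemma tsum_ex p M n : vanish_from M p -> exists K, M <= n + K%:Z.
Proof. by move=> _; exists `|M - n|%N; lia. Qed.

Lemma tsumB c p q M n : vanish_from M p -> vanish_from M q ->
  tsum c (fun i => p i - q i) n = tsum c p n - tsum c q n.
Proof.
move=> hp hq; have [K hK] := tsum_ex n hp.
rewrite (tsumE _ hp hK) (tsumE _ hq hK) (@tsumE _ _ M _ K) //.
  by rewrite -sumrB; apply: eq_bigr => i _; rewrite mulrBr.
by move=> i hi; rewrite hp ?hq ?subr0.
Qed.

Lemma tsum_sum c (K : nat) (b : nat -> C) (p : nat -> int -> C) M n :
  (forall j, (j < K)%N -> vanish_from M (p j)) ->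
  tsum c (fun i => \sum_(j < K) b j * p j i) n =
  \sum_(j < K) b j * tsum c (p j) n.
Proof.
move=> hp; pose L := `|M - n|%N; have hL : M <= n + L%:Z by rewrite /L; lia.
rewrite (@tsumE _ _ M _ L) //; last first.
  by move=> i hi; rewrite big1 // => j _; rewrite hp ?mulr0.
under [RHS]eq_bigr => j _ do rewrite (tsumE _ (hp j (ltn_ord j)) hL) mulr_sumr.
rewrite exchange_big; apply: eq_bigr => i _; rewrite mulr_sumr.
by apply: eq_bigr => j _; rewrite mulrCA.
Qed.

Lemma tsum_inj c d M : vanish_from M d -> c 0%N = 1 ->
  (forall n, tsum c d n = 0) -> forall i, d i = 0.
Proof.
move=> hd c0 h.
suff H (k : nat) : vanish_from (M - k%:Z) d.
  by move=> i; apply: (H `|M - i|%N); lia.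
elim: k => [|k IH]; first by rewrite subr0.
move=> i hi; have [h1|h1] := leP (M - k%:Z) i; first exact: IH.
have := h i; rewrite (@tsumE _ _ _ _ 1 IH); last by lia.
by rewrite big_ord1 c0 mul1r addr0.
Qed.

Lemma vanish_sbincz x (T : int) : vanish_from (T + 1) (fun i => sbincz x (T - i)).
Proof. by move=> i hi; case E : (T - i) => [n|n] //; lia. Qed.

Lemma vanish_bincz x (T : int) : vanish_from (T + 1) (fun i => bincz x (T - i)).
Proof. by move=> i hi; case E : (T - i) => [n|n] //; lia. Qed.

Lemma tsum_bincz x y (T n : int) :
  tsum (binc x) (fun i => bincz y (T - i)) n = bincz (x + y) (T - n).
Proof.
case E : (T - n) => [u|u]; last first.
  by rewrite (tsumE (K := 0) _ (@vanish_bincz y T)) ?big_ord0 //; lia.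
rewrite (tsumE (K := u.+1) _ (@vanish_bincz y T)); last by lia.
rewrite /= -binc_Vandermonde; apply: eq_bigr => i _.
rewrite (_ : T - _ = (u - i)%N :> int) //; have := ltn_ord i; lia.
Qed.

Lemma tsum_sbincz x y (T n : int) :
  tsum (sbinc x) (fun i => sbincz y (T - i)) n = sbincz (x + y) (T - n).
Proof.
case E : (T - n) => [u|u]; last first.
  by rewrite (tsumE (K := 0) _ (@vanish_sbincz y T)) ?big_ord0 //; lia.
rewrite (tsumE (K := u.+1) _ (@vanish_sbincz y T)); last by lia.
rewrite /= -binc_Vandermonde mulr_sumr; apply: eq_bigr => i _.
rewrite (_ : T - _ = (u - i)%N :> int); last by have := ltn_ord i; lia.
rewrite /= /sbinc mulrACA -exprD subnKC //; by rewrite -ltnS.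
Qed.

Lemma sbincz0 (t : int) : sbincz (0 : C) t = (t == 0)%:R.
Proof.
case: t => [[|t]|t] //=; first by rewrite expr0 binc0 mul1r.
by rewrite (binc_nat _ 0) bin0n mulr0.
Qed.

(* Coefficients of [z1^(N-2-s) z2^s (z1 - z2)^-N] in the regions |z1| > |z2|
   and |z2| > |z1|, and of [z1^(-al+N-2-s) (z1 - z2)^-N] in powers of
   [z1 - z2] and [z2]. *)
Definition monoP (N : nat) (s i : int) : C := sbincz (- N%:R) (-1 - s - i).
Definition monoQ (N : nat) (s i : int) : C :=
  (-1) ^+ N * sbincz (- N%:R) (s + 1 - N%:Z - i).
Definition monoR (al : C) (N : nat) (s m : int) : C :=
  bincz (- al + N%:R - 2 - s%:~R) (N%:Z - 1 - m).

Definition expansion (mono : int -> int -> C) (s0 : int) (K : nat) (b : int -> C)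
    (i : int) : C :=
  \sum_(j < K) b (s0 + j%:Z) * mono (s0 + j%:Z) i.

Lemma vanish_monoP N s : vanish_from (- s) (monoP N s).
Proof. by move=> i hi; apply: vanish_sbincz; lia. Qed.

Lemma vanish_monoQ N s : vanish_from (s + 2 - N%:Z) (monoQ N s).
Proof. by move=> i hi; rewrite /monoQ vanish_sbincz ?mulr0 //; lia. Qed.

Lemma vanish_monoR al N s : vanish_from N%:Z (monoR al N s).
Proof. by move=> i hi; apply: vanish_bincz; lia. Qed.

Lemma vanish_expand mono s0 K b M :
  (forall j, (j < K)%N -> vanish_from M (mono (s0 + j%:Z))) ->
  vanish_from M (expansion mono s0 K b).
Proof. by move=> h i hi; apply: big1 => j _; rewrite h ?mulr0. Qed.

Lemma vanish_expandP N s0 K b : vanish_from (- s0) (expansion (monoP N) s0 K b).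
Proof. by apply: vanish_expand => j _ i hi; apply: vanish_monoP; lia. Qed.

Lemma vanish_expandQ N s0 K b :
  vanish_from (s0 + K%:Z + 2 - N%:Z) (expansion (monoQ N) s0 K b).
Proof. by apply: vanish_expand => j jK i hi; apply: vanish_monoQ; lia. Qed.

Lemma vanish_expandR al N s0 K b : vanish_from N%:Z (expansion (monoR al N) s0 K b).
Proof. by apply: vanish_expand => j _; apply: vanish_monoR. Qed.

Lemma tsum_expand c mono s0 K b M n :
  (forall j, (j < K)%N -> vanish_from M (mono (s0 + j%:Z))) ->
  tsum c (expansion mono s0 K b) n =
  \sum_(j < K) b (s0 + j%:Z) * tsum c (mono (s0 + j%:Z)) n.
Proof.
exact: (@tsum_sum c K (fun j => b (s0 + j%:Z)) (fun j => mono (s0 + j%:Z))).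
Qed.

Lemma tsum_expandP x N s0 K b n :
  tsum (sbinc x) (expansion (monoP N) s0 K b) n =
  \sum_(j < K) b (s0 + j%:Z) * sbincz (x - N%:R) (-1 - (s0 + j%:Z) - n).
Proof.
rewrite (@tsum_expand _ _ _ _ _ (- s0)).
  by apply: eq_bigr => j _; rewrite /monoP tsum_sbincz.
by move=> j _ i hi; apply: vanish_monoP; lia.
Qed.

Lemma tsumZ c (a : C) p n : tsum c (fun i => a * p i) n = a * tsum c p n.
Proof. by rewrite /tsum mulr_fsumr; apply: eq_fsbigr => i _; rewrite mulrCA. Qed.

Lemma tsum_expandQ x N s0 K b n :
  tsum (sbinc x) (expansion (monoQ N) s0 K b) n =
  (-1) ^+ N * \sum_(j < K) b (s0 + j%:Z) *
    sbincz (x - N%:R) (s0 + j%:Z + 1 - N%:Z - n).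
Proof.
rewrite (@tsum_expand _ _ _ _ _ (s0 + K%:Z + 2 - N%:Z)).
  rewrite mulr_sumr; apply: eq_bigr => j _.
  by rewrite /monoQ tsumZ tsum_sbincz mulrCA.
by move=> j jK i hi; apply: vanish_monoQ; lia.
Qed.

Lemma tsum_expandR x al N s0 K b n :
  tsum (binc x) (expansion (monoR al N) s0 K b) n =
  \sum_(j < K) b (s0 + j%:Z) *
    bincz (x + (- al + N%:R - 2 - (s0 + j%:Z)%:~R)) (N%:Z - 1 - n).
Proof.
rewrite (@tsum_expand _ _ _ _ _ N%:Z).
  by apply: eq_bigr => j _; rewrite /monoR tsum_bincz.
by move=> j jK; apply: vanish_monoR.
Qed.

Lemma expand_borcherds al N s0 K b :
  borcherds al (expansion (monoP N) s0 K b) (expansion (monoQ N) s0 K b)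
               (expansion (monoR al N) s0 K b).
Proof.
move=> n j; rewrite tsum_expandP tsum_expandQ tsum_expandR !mulr_sumr -sumrB.
apply: eq_bigr => i _; set s := s0 + _.
have -> : (-1) ^ n * ((-1) ^+ N * (b s * sbincz (n%:~R - N%:R) (s + 1 - N%:Z - j)))
  = b s * ((-1) ^ (n - N%:Z) * sbincz (n - N%:Z)%:~R (s + 1 - N%:Z - j)) :> C.
  rewrite intrB -pmulrn expfzDr ?oppr_eq0 ?oner_eq0 //.
  rewrite -[in RHS]exprz_inv invrN invr1 -exprnP; ring.
rewrite -mulrBr; congr (_ * _).
have -> : n%:~R - N%:R = (n - N%:Z)%:~R :> C by rewrite intrB -pmulrn.
rewrite sbincz_residue; last by lia.
congr (bincz _ _); last by lia.
by rewrite !(intrB, intrD, intrN) -?pmulrn; ring.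
Qed.

Definition supported (s0 : int) (K : nat) (b : int -> C) :=
  forall s, ~~ (s0 <= s < s0 + K%:Z) -> b s = 0.

Lemma supported_pick s0 K b (s : int) : supported s0 K b ->
  \sum_(j < K) b (s0 + j%:Z) * (s == s0 + j%:Z)%:R = b s.
Proof.
move=> h; have [h1|h1] := boolP (s0 <= s < s0 + K%:Z).
  have hk : (`|s - s0| < K)%N by lia.
  rewrite (bigD1 (Ordinal hk)) //= (_ : s0 + _ = s); last by lia.
  rewrite eqxx mulr1 big1 ?addr0 // => j /eqP ne.
  case: eqP => [e|]; last by rewrite mulr0.
  by case: ne; apply: val_inj => /=; lia.
rewrite (h _ h1) big1 // => j _.
by case: eqP => [e|]; [have := ltn_ord j; lia|rewrite mulr0].
Qed.

Lemma expandP_unique N s0 K b p M : vanish_from M p -> supported s0 K b ->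
  (forall s, tsum (sbinc N%:R) p (-1 - s) = b s) ->
  forall i, p i = expansion (monoP N) s0 K b i.
Proof.
move=> hp hb h i; apply/eqP; rewrite -subr_eq0; apply/eqP; move: i.
pose L := Num.max M (- s0).
have hp' : vanish_from L p by move=> i hi; apply: hp; lia.
have hq' : vanish_from L (expansion (monoP N) s0 K b).
  by move=> i hi; apply: vanish_expandP; lia.
apply: (@tsum_inj (sbinc N%:R) _ L).
- by move=> i hi; rewrite hp' ?hq' ?subr0.
- by rewrite /sbinc binc0 mulr1.
move=> n; rewrite (tsumB _ _ hp' hq') tsum_expandP subrr.
rewrite (_ : n = -1 - (-1 - n)); last by lia.
rewrite h -(supported_pick (-1 - n) hb) -sumrB big1 // => j _.
rewrite sbincz0 (_ : (_ - _ == 0) = (-1 - n == s0 + j%:Z)) ?subrr //; lia.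
Qed.

Lemma expandQ_unique N s0 K b q M : vanish_from M q -> supported s0 K b ->
  (forall s, (-1) ^+ N * tsum (sbinc N%:R) q (s + 1 - N%:Z) = b s) ->
  forall i, q i = expansion (monoQ N) s0 K b i.
Proof.
move=> hp hb h i; apply/eqP; rewrite -subr_eq0; apply/eqP; move: i.
pose L := Num.max M (s0 + K%:Z + 2 - N%:Z).
have hp' : vanish_from L q by move=> i hi; apply: hp; lia.
have hq' : vanish_from L (expansion (monoQ N) s0 K b).
  by move=> i hi; apply: vanish_expandQ; lia.
apply: (@tsum_inj (sbinc N%:R) _ L).
- by move=> i hi; rewrite hp' ?hq' ?subr0.
- by rewrite /sbinc binc0 mulr1.
move=> n; rewrite (tsumB _ _ hp' hq') tsum_expandQ subrr.
have -> : tsum (sbinc N%:R) q n = (-1) ^+ N * b (n - 1 + N%:Z).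
  rewrite -h mulrA -exprD addnn -mul2n exprM sqrrN !expr1n mul1r.
  by congr tsum; lia.
rewrite -mulrBr -(supported_pick (n - 1 + N%:Z) hb) -sumrB big1 ?mulr0 // => j _.
rewrite sbincz0 (_ : (_ - _ == 0) = (n - 1 + N%:Z == s0 + j%:Z)) ?subrr //; lia.
Qed.

Lemma borcherds_expand al p q r M :
  vanish_from M p -> vanish_from M q -> vanish_from M r -> borcherds al p q r ->
  exists N s0 K b, [/\ (0 < N)%N, p =1 expansion (monoP N) s0 K b,
    q =1 expansion (monoQ N) s0 K b & r =1 expansion (monoR al N) s0 K b].
Proof.
move=> hp hq hr H; pose N := `|M|.+1.
pose b s := tsum (sbinc N%:R) p (-1 - s).
have bq s : (-1) ^+ N * tsum (sbinc N%:R) q (s + 1 - N%:Z) = b s.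
  have := H N%:Z (s + 1 - N%:Z).
  rewrite (@tsumE _ r M _ 0 hr) ?big_ord0; last by rewrite /N; lia.
  move/eqP; rewrite subr_eq0 => /eqP <-; rewrite /b -pmulrn.
  by congr tsum; lia.
pose s0 := - M; pose K := (`|M| + `|M| + N)%N.
have hb : supported s0 K b.
  move=> s hs; have [h1|h1] := ltP s s0.
    by rewrite /b (@tsumE _ p M _ 0 hp) ?big_ord0 //; rewrite /s0 in h1; lia.
  rewrite -bq (@tsumE _ q M _ 0 hq) ?big_ord0 ?mulr0 //.
  by move: hs h1; rewrite /s0 /K /N; lia.
have pE := expandP_unique hp hb (fun s => erefl).
have qE := expandQ_unique hq hb bq.
exists N, s0, K, b; split => // i; apply/eqP; rewrite -subr_eq0; apply/eqP; move: i.
have hr1 : vanish_from N%:Z r by move=> i hi; apply: hr; rewrite /N in hi; lia.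
have hr2 := @vanish_expandR al N s0 K b.
apply: (@tsum_inj (binc al) _ N%:Z).
- by move=> i hi; rewrite hr1 ?hr2 ?subr0.
- by rewrite binc0.
move=> n; rewrite (tsumB _ _ hr1 hr2).
have := expand_borcherds al N s0 K b n 0; have := H n 0; rewrite !addr0 => <- <-.
by rewrite (funext pE) (funext qE) subrr.
Qed.

End Borcherds.

(** * Absolutely convergent sums *)

Section Modulus.
Variable R : realType.
Local Notation C := R[i].
Implicit Types (x y z : C).

(* The modulus as an element of [R]; [`|z|] lives in [R[i]]. *)
Definition nm z : R := Normc.normc z.

Lemma normCE z : `|z| = (nm z)%:C.
Proof. by []. Qed.

Lemma nm_ge0 z : 0 <= nm z.
Proof. by rewrite -lecR -normCE normr_ge0. Qed.

Lemma nmD x y : nm (x + y) <= nm x + nm y.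
Proof. by rewrite -lecR rmorphD -!normCE ler_normD. Qed.

Lemma nmM x y : nm (x * y) = nm x * nm y.
Proof. by rewrite /nm Normc.normcM. Qed.

Lemma nmN x : nm (- x) = nm x.
Proof. by apply: complexI; rewrite -!normCE normrN. Qed.

Lemma nm_distC x y : nm (x - y) = nm (y - x).
Proof. by rewrite -nmN opprB. Qed.

Lemma nm0 : nm 0 = 0.
Proof. by rewrite /nm Normc.normc0. Qed.

Lemma nm1 : nm 1 = 1.
Proof. by rewrite /nm Normc.normc1. Qed.

Lemma nm_eq0 x : (nm x == 0) = (x == 0).
Proof. by apply/eqP/eqP => [/Normc.eq0_normc|->]; rewrite ?nm0. Qed.

Lemma nmX x n : nm (x ^+ n) = nm x ^+ n.
Proof. by elim: n => [|n IH]; rewrite ?expr0 ?nm1 // !exprS nmM IH. Qed.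

Lemma nmV x : nm x^-1 = (nm x)^-1.
Proof. by rewrite /nm Normc.normcV. Qed.

Lemma nm_real (t : R) : nm t%:C = `|t|.
Proof. by rewrite /nm /= expr0n addr0 sqrtr_sqr. Qed.

Lemma nm_sum (I : Type) (r : seq I) (F : I -> C) :
  nm (\sum_(i <- r) F i) <= \sum_(i <- r) nm (F i).
Proof.
elim: r => [|i r IH]; first by rewrite !big_nil nm0.
by rewrite !big_cons (le_trans (nmD _ _)) // lerD2l.
Qed.

Lemma nm_dist x y : nm x - nm y <= nm (x - y).
Proof. by rewrite lerBlDr -{1}(subrK y x) nmD. Qed.

Lemma Re_le_nm x : `|complex.Re x| <= nm x.
Proof. by rewrite -lecR -normCE normc_ge_Re. Qed.

Lemma Im_le_nm x : `|complex.Im x| <= nm x.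
Proof.
case: x => a b; rewrite /nm /= -sqrtr_sqr ler_wsqrtr // lerDr sqr_ge0 //.
Qed.

Lemma nm_le_ReIm x : nm x <= `|complex.Re x| + `|complex.Im x|.
Proof.
case: x => a b /=; rewrite /nm -ler_sqr ?nnegrE ?sqrtr_ge0 ?addr_ge0 //=.
rewrite sqr_sqrtr ?addr_ge0 ?sqr_ge0 // sqrrD !real_normK ?num_real //.
by rewrite lerD2r lerDl mulrn_wge0 // mulr_ge0.
Qed.

End Modulus.

Section Summation.
Variable R : realType.
Local Notation C := R[i].

Lemma abs_summableP (I : choiceType) (a : I -> C) :
  abs_summable a <->
  exists B : R, forall J : {fset I}, \sum_(i <- J) nm (a i) <= B.
Proof.
have E (J : {fset I}) : (\sum_(i \in [set` J]) `|(nm (a i))%:E| =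
    (\sum_(i <- J) nm (a i))%:E)%E.
  rewrite -fsbig_seq ?fset_uniq // -sumEFin; apply: eq_bigr => i _.
  by rewrite gee0_abs // lee_fin nm_ge0.
split.
  rewrite /abs_summable summableE => h.
  exists (fine (\esum_(x in [set: I]) `|(nm (a x))%:E|)%E) => J.
  rewrite -lee_fin fineK // -E; apply: ereal_sup_ubound.
  by exists [set` J].
move=> [B hB]; rewrite /abs_summable /summable /esum.
apply: (@le_lt_trans _ _ B%:E); last exact: ltry.
apply: ge_ereal_sup => x [A [fA _] <-].
have -> : A = [set` fset_set A] by rewrite fset_setK.
by rewrite E lee_fin.
Qed.

Lemma has_sumP (I : choiceType) (a : I -> C) (s : C) :
  has_sum a s <-> forall e : R, 0 < e -> exists J0 : {fset I},
    forall J : {fset I}, (J0 `<=` J)%fset -> nm (\sum_(i <- J) a i - s) < e.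
Proof.
split=> h e e0.
  have [|J0 hJ] := h e%:C; first by rewrite ltcR.
  by exists J0 => J /hJ; rewrite normCE ltcR.
have /complex_realP[e' ee] : e \is Num.real by rewrite gtr0_real.
move: e0; rewrite ee ltcR => /h[J0 hJ].
by exists J0 => J /hJ; rewrite normCE ltcR.
Qed.

Definition sums (I : choiceType) (a : I -> C) (s : C) :=
  abs_summable a /\ has_sum a s.

Lemma has_sum_unique (I : choiceType) (a : I -> C) s t :
  has_sum a s -> has_sum a t -> s = t.
Proof.
move=> /has_sumP hs /has_sumP ht; apply/eqP; rewrite -subr_eq0 -nm_eq0.
rewrite eq_le nm_ge0 andbT leNgt; apply/negP => e0.
have e2 : 0 < nm (s - t) / 2 by rewrite divr_gt0.
have [J1 h1] := hs _ e2; have [J2 h2] := ht _ e2.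
have := h1 (J1 `|` J2)%fset (fsubsetUl _ _).
have := h2 (J1 `|` J2)%fset (fsubsetUr _ _).
set S := \sum_(i <- _) _ => k2 k1.
have := nmD (s - S) (S - t); rewrite addrA subrK nm_distC => k3.
by have := le_lt_trans k3 (ltrD k1 k2); rewrite -splitr ltxx.
Qed.

Lemma abs_summableD (I : choiceType) (a b : I -> C) :
  abs_summable a -> abs_summable b -> abs_summable (fun i => a i + b i).
Proof.
move=> /abs_summableP[A hA] /abs_summableP[B hB]; apply/abs_summableP.
exists (A + B) => J; apply: le_trans (lerD (hA J) (hB J)).
by rewrite -big_split ler_sum // => i _; apply: nmD.
Qed.

Lemma has_sumD (I : choiceType) (a b : I -> C) s t :
  has_sum a s -> has_sum b t -> has_sum (fun i => a i + b i) (s + t).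
Proof.
move=> /has_sumP ha /has_sumP hb; apply/has_sumP => e e0.
have e2 : 0 < e / 2 by rewrite divr_gt0.
have [J1 h1] := ha _ e2; have [J2 h2] := hb _ e2.
exists (J1 `|` J2)%fset => J; rewrite fsubUset => /andP[/h1 k1 /h2 k2].
rewrite big_split opprD addrACA; apply: le_lt_trans (nmD _ _) _.
by rewrite (splitr e) ltrD.
Qed.

Lemma abs_summableZ (I : choiceType) (c : C) (a : I -> C) :
  abs_summable a -> abs_summable (fun i => c * a i).
Proof.
move=> /abs_summableP[A hA]; apply/abs_summableP; exists (nm c * A) => J.
under eq_bigr do rewrite nmM.
by rewrite -mulr_sumr ler_wpM2l ?nm_ge0.
Qed.

Lemma has_sumZ (I : choiceType) (c : C) (a : I -> C) s :
  has_sum a s -> has_sum (fun i => c * a i) (c * s).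
Proof.
move=> /has_sumP ha; apply/has_sumP => e e0.
have c1 : 0 < nm c + 1 by rewrite ltr_wpDl ?nm_ge0.
have [J0 h] := ha _ (divr_gt0 e0 c1); exists J0 => J /h k.
rewrite -mulr_sumr -mulrBr nmM.
apply: (@le_lt_trans _ _ ((nm c + 1) * nm (\sum_(i <- J) a i - s))).
  by rewrite ler_wpM2r ?nm_ge0 // lerDl.
by rewrite mulrC -ltr_pdivlMr.
Qed.

Lemma sumsD (I : choiceType) (a b : I -> C) s t :
  sums a s -> sums b t -> sums (fun i => a i + b i) (s + t).
Proof.
by move=> [a1 a2] [b1 b2]; split; [apply: abs_summableD|apply: has_sumD].
Qed.

Lemma sumsZ (I : choiceType) (c : C) (a : I -> C) s :
  sums a s -> sums (fun i => c * a i) (c * s).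
Proof. by move=> [a1 a2]; split; [apply: abs_summableZ|apply: has_sumZ]. Qed.

Lemma sums0 (I : choiceType) : sums (fun _ : I => 0) 0.
Proof.
split; first by apply/abs_summableP; exists 0 => J; rewrite nm0 big1.
apply/has_sumP => e e0; exists fset0 => J _.
by rewrite big1 // subrr nm0.
Qed.

Lemma abs_summable_sum (I : choiceType) (K : nat) (a : 'I_K -> I -> C) :
  (forall j, abs_summable (a j)) -> abs_summable (fun i => \sum_(j < K) a j i).
Proof.
elim: K a => [|K IH] a h.
  by under eq_fun do rewrite big_ord0; have [] := sums0 I.
under eq_fun do rewrite big_ord_recl.
by apply: abs_summableD => //; apply: IH.
Qed.

Lemma has_sum_sum (I : choiceType) (K : nat) (a : 'I_K -> I -> C) (s : 'I_K -> C) :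
  (forall j, has_sum (a j) (s j)) ->
  has_sum (fun i => \sum_(j < K) a j i) (\sum_(j < K) s j).
Proof.
elim: K a s => [|K IH] a s h.
  by rewrite big_ord0; under eq_fun do rewrite big_ord0; have [] := sums0 I.
rewrite big_ord_recl; under eq_fun do rewrite big_ord_recl.
by apply: has_sumD => //; apply: IH.
Qed.

Lemma sums_sum (I : choiceType) (K : nat) (a : 'I_K -> I -> C) (s : 'I_K -> C) :
  (forall j, sums (a j) (s j)) ->
  sums (fun i => \sum_(j < K) a j i) (\sum_(j < K) s j).
Proof.
by move=> h; split; [apply: abs_summable_sum|apply: has_sum_sum] => j; have [] := h j.
Qed.

Lemma eq_sums (I : choiceType) (a b : I -> C) s t :
  a =1 b -> s = t -> sums a s -> sums b t.
Proof. by move=> /funext-> ->. Qed.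

Section Injection.
Variables (I J : choiceType) (phi : J -> I) (a : I -> C).
Hypothesis phi_inj : injective phi.
Hypothesis a_out : forall i, (forall j, phi j != i) -> a i = 0.

Lemma preim_ex (K : {fset I}) : exists L : {fset J},
  forall j, (j \in L) = (phi j \in K).
Proof.
exists (fset_set (phi @^-1` [set` K])) => j; rewrite in_fset_set; last first.
  by apply: finite_preimage => // x y _ _; apply: phi_inj.
by apply/idP/idP; rewrite inE.
Qed.

Lemma sum_preim (M : zmodType) (h : I -> M) (K : {fset I}) (L : {fset J}) :
  (forall i, (forall j, phi j != i) -> h i = 0) ->
  (forall j, (j \in L) = (phi j \in K)) ->
  \sum_(i <- K) h i = \sum_(j <- L) h (phi j).
Proof.
move=> h0 hL; rewrite -(big_map phi xpredT).
rewrite (bigID (fun i => i \in map phi L)) /= [X in _ + X]big1_seq ?addr0.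
  rewrite -big_filter; apply: perm_big; apply: uniq_perm.
  - by rewrite filter_uniq ?fset_uniq.
  - by rewrite map_inj_uniq ?fset_uniq.
  move=> i; rewrite mem_filter; apply: andb_idr => /mapP[j jL ->].
  by rewrite -hL.
move=> i /andP[ni iK]; apply: h0 => j; apply: contraNneq ni => ji.
by rewrite -ji map_f // hL ji.
Qed.

Lemma has_sum_inj s : has_sum (a \o phi) s <-> has_sum a s.
Proof.
split=> /has_sumP h; apply/has_sumP => e /h[J0 hJ].
  exists (phi @` J0)%fset => K sK; have [L hL] := preim_ex K.
  rewrite (sum_preim a_out hL); apply: hJ; apply/fsubsetP => j jJ.
  by rewrite hL; apply: (fsubsetP sK); apply: in_imfset.
have [L0 hL0] := preim_ex J0; exists L0 => L /fsubsetP sL.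
have := hJ (J0 `|` phi @` L)%fset (fsubsetUl _ _).
rewrite (@sum_preim _ a _ L a_out) // => j; rewrite in_fsetU -hL0.
rewrite (mem_imfset _ _ phi_inj) /=; case: (boolP (j \in L0)) => //= /sL.
by [].
Qed.

Lemma abs_summable_inj : abs_summable (a \o phi) <-> abs_summable a.
Proof.
have out i : (forall j, phi j != i) -> nm (a i) = 0.
  by move=> /a_out->; rewrite nm0.
split=> /abs_summableP[B hB]; apply/abs_summableP; exists B => K.
  by have [L hL] := preim_ex K; rewrite (sum_preim out hL).
have := hB (phi @` K)%fset; rewrite (@sum_preim _ _ _ K out) // => j.
by rewrite (mem_imfset _ _ phi_inj).
Qed.

Lemma sums_inj s : sums (a \o phi) s <-> sums a s.
Proof. by rewrite /sums has_sum_inj abs_summable_inj. Qed.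

End Injection.

Lemma sums_bij (I J : choiceType) (phi : J -> I) (a : I -> C) s :
  bijective phi -> sums (a \o phi) s <-> sums a s.
Proof.
move=> [psi h1 h2]; apply: sums_inj; first exact: can_inj h1.
by move=> i /(_ (psi i)); rewrite h2 eqxx.
Qed.

Lemma sum_fset_le (u : nat -> R) (J : {fset nat}) : (forall i, 0 <= u i) ->
  exists n, forall m, (n <= m)%N -> \sum_(i <- J) u i <= \sum_(i < m) u i.
Proof.
move=> u0; exists (\max_(i <- J) i).+1 => m hm.
rewrite -(big_mkord xpredT u) [leRHS](bigID (fun i => i \in J)) /=.
rewrite -[X in X + _]big_filter [X in _ <= X + _](perm_big (enum_fset J)) /=.
  by rewrite lerDl sumr_ge0.
apply: uniq_perm; rewrite ?filter_uniq ?iota_uniq ?fset_uniq // => i.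
rewrite mem_filter; apply: andb_idr => iJ; rewrite mem_index_iota /=.
by apply: leq_trans hm; rewrite ltnS; apply: leq_bigmax_seq.
Qed.

Lemma monotone_lim (u : nat -> R) B :
  (forall m n, (m <= n)%N -> u m <= u n) -> (forall n, u n <= B) ->
  exists U, (forall n, u n <= U) /\
    forall e, 0 < e -> exists N, forall n, (N <= n)%N -> U - e < u n.
Proof.
move=> mono ub; have hs : has_sup (range u).
  by split; [exists (u 0%N), 0%N|exists B => _ [n _ <-]].
exists (sup (range u)); split=> [n|e e0].
  by apply: ub_le_sup; [case: hs|exists n].
have [_ [N _ <-] hN] := sup_adherent e0 hs.
by exists N => n /mono; apply: lt_le_trans.
Qed.

Definition cvgs (u : nat -> C) (s : C) := forall e : R, 0 < e ->
  exists N, forall n, (N <= n)%N -> nm (u n - s) < e.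

Definition psum (T : zmodType) (a : nat -> T) n := \sum_(i < n) a i.

Lemma psumS (T : zmodType) (a : nat -> T) n : psum a n.+1 = psum a n + a n.
Proof. by rewrite /psum big_ord_recr. Qed.

Lemma psum_mono (u : nat -> R) m n : (forall i, 0 <= u i) -> (m <= n)%N ->
  psum u m <= psum u n.
Proof.
move=> u0 /subnK <-; elim: (n - m)%N => // k IH.
by rewrite addSn /psum big_ord_recr /= (le_trans IH) // lerDl.
Qed.

Lemma sums_natP (a : nat -> C) s : sums a s <->
  (exists B, forall n, psum (fun i => nm (a i)) n <= B) /\ cvgs (psum a) s.
Proof.
have fsE (T : zmodType) (u : nat -> T) n :
    psum u n = \sum_(i <- [fset x in iota 0 n]%fset) u i.
  rewrite /psum -(big_mkord xpredT u) /index_iota subn0.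
  apply: perm_big; apply: uniq_perm; rewrite ?iota_uniq ?fset_uniq // => i.
  by rewrite in_fset.
split=> [[/abs_summableP[B hB] /has_sumP hs]|[[B hB] hs]].
  split; first by exists B => n; rewrite fsE.
  move=> e /hs[J0 hJ]; exists (\max_(i <- J0) i).+1 => n hn; rewrite fsE.
  apply: hJ; apply/fsubsetP => i iJ; rewrite in_fset /= mem_iota /= add0n.
  by apply: leq_trans hn; rewrite ltnS; apply: leq_bigmax_seq.
have u0 i : 0 <= nm (a i) by exact: nm_ge0.
split.
  apply/abs_summableP; exists B => J; have [n hn] := sum_fset_le J u0.
  exact: le_trans (hn n (leqnn _)) (hB n).
have [U [Ub hU]] := monotone_lim (fun m n => @psum_mono _ m n u0) hB.
apply/has_sumP => e e0; have e2 : 0 < e / 2 by rewrite divr_gt0.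
have [N1 h1] := hs _ e2; have [N2 h2] := hU _ e2.
pose N := maxn N1 N2; exists [fset x in iota 0 N]%fset => J sJ.
have split_sum (T : zmodType) (u : nat -> T) :
    \sum_(i <- J) u i = psum u N + \sum_(i <- (J `\` [fset x in iota 0 N])%fset) u i.
  rewrite fsE (bigID (fun i => i \in [fset x in iota 0 N]%fset)) /=.
  rewrite -big_filter -[X in _ + X]big_filter; congr (_ + _).
    apply: perm_big; apply: uniq_perm; rewrite ?filter_uniq ?fset_uniq // => i.
    rewrite mem_filter; apply: andb_idr; exact: (fsubsetP sJ).
  apply: perm_big; apply: uniq_perm; rewrite ?filter_uniq ?fset_uniq // => i.
  by rewrite mem_filter in_fsetD.
rewrite split_sum addrAC; apply: le_lt_trans (nmD _ _) _; rewrite (splitr e).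
apply: ltrD; first by apply: h1; rewrite leq_maxl.
apply: le_lt_trans (nm_sum _ _) _.
have [n hn] := sum_fset_le J u0.
have := le_trans (hn n (leqnn _)) (Ub n); rewrite split_sum.
have := h2 N (leq_maxr _ _); lra.
Qed.

Lemma sums_fin (a : nat -> C) K : (forall i, (K <= i)%N -> a i = 0) ->
  sums a (\sum_(i < K) a i).
Proof.
move=> h; apply/sums_natP.
have E (T : zmodType) (u : nat -> T) n : (forall i, (K <= i)%N -> u i = 0) ->
    (K <= n)%N -> psum u n = psum u K.
  move=> u0 /subnK <-; elim: (n - K)%N => // k IH.
  by rewrite addSn /psum big_ord_recr /= -/(psum u _) IH u0 ?addr0 // leq_addl.
split; last first.
  by move=> e e0; exists K => n hn; rewrite E // subrr nm0.
exists (psum (fun i => nm (a i)) K) => n.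
have [hn|/ltnW hn] := leqP K n.
  by rewrite E // => i /h->; rewrite nm0.
by apply: psum_mono => // i; apply: nm_ge0.
Qed.

Lemma psum_triangle (T : zmodType) (F : nat -> nat -> T) n :
  \sum_(m < n) \sum_(i < m.+1) F i (m - i)%N =
  \sum_(i < n) \sum_(j < n - i) F i j.
Proof.
elim: n => [|n IH]; first by rewrite !big_ord0.
rewrite big_ord_recr /= IH.
have -> : \sum_(i < n) \sum_(j < n - i) F i j =
    \sum_(i < n.+1) \sum_(j < n - i) F i j.
  by rewrite [RHS]big_ord_recr /= subnn big_ord0 addr0.
rewrite -big_split; apply: eq_bigr => i _ /=.
by rewrite subSn ?big_ord_recr // -ltnS.
Qed.

Lemma sums_Cauchy (a b : nat -> C) s t : sums a s -> sums b t ->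
  sums (fun n => \sum_(i < n.+1) a i * b (n - i)%N) (s * t).
Proof.
move=> /sums_natP[[A hA] ca] /sums_natP[[B hB] cb]; apply/sums_natP.
pose al := psum (fun i => nm (a i)); pose be := psum (fun i => nm (b i)).
have al0 n : 0 <= al n by apply: sumr_ge0 => i _; apply: nm_ge0.
have be0 n : 0 <= be n by apply: sumr_ge0 => i _; apply: nm_ge0.
pose u n := al n * be n.
have umono m n : (m <= n)%N -> u m <= u n.
  by move=> h; apply: ler_pM => //; apply: psum_mono => // i; apply: nm_ge0.
have ub n : u n <= A * B by apply: ler_pM.
pose ga n := \sum_(i < n) \sum_(j < n - i) nm (a i) * nm (b j).
have row n i (T : zmodType) (v : nat -> T) : (i <= n)%N ->
    \sum_(j < n) v j = \sum_(j < n - i) v j + \sum_(j < n | (n - i <= j)%N) v j.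
  move=> le; rewrite (bigID (fun j : 'I_n => (j < n - i)%N)) /=; congr (_ + _).
    rewrite (big_ord_widen_cond n xpredT v (leq_subr i n)) /=.
    by apply: eq_bigl => j.
  by apply: eq_bigl => j; rewrite -leqNgt.
have uE n : u n = ga n + \sum_(i < n) \sum_(j < n | (n - i <= j)%N) nm (a i) * nm (b j).
  rewrite /u /al /be /psum mulr_suml -big_split; apply: eq_bigr => i _ /=.
  by rewrite mulr_sumr; apply: (row n i _ (fun j => nm (a i) * nm (b j))); apply/ltnW.
have pE n : psum a n * psum b n =
    psum (fun n => \sum_(i < n.+1) a i * b (n - i)%N) n +
    \sum_(i < n) \sum_(j < n | (n - i <= j)%N) a i * b j.
  rewrite {3}/psum (psum_triangle (fun i j => a i * b j)) /psum mulr_suml.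
  rewrite -big_split; apply: eq_bigr => i _ /=.
  by rewrite mulr_sumr; apply: (row n i _ (fun j => a i * b j)); apply/ltnW.
have half n : u n./2 <= ga n.
  apply: (@le_trans _ _ (\sum_(i < n./2) \sum_(j < n - i) nm (a i) * nm (b j))).
    rewrite /u /al /be /psum mulr_suml; apply: ler_sum => i _; rewrite mulr_sumr.
    apply: (@psum_mono (fun j => nm (a i) * nm (b j))).
      by move=> j; rewrite mulr_ge0 ?nm_ge0.
    by have := ltn_ord i; lia.
  apply: (@psum_mono (fun i => \sum_(j < n - i) nm (a i) * nm (b j))); last by lia.
  by move=> i; apply: sumr_ge0 => j _; rewrite mulr_ge0 ?nm_ge0.
split.
  exists (A * B) => n; apply: le_trans (ub n).
  apply: (@le_trans _ _ (ga n)).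
    rewrite /ga -(psum_triangle (fun i j => nm (a i) * nm (b j))).
    apply: ler_sum => m _; apply: le_trans (nm_sum _ _) _.
    by apply: ler_sum => i _; rewrite nmM.
  rewrite uE lerDl; apply: sumr_ge0 => i _; apply: sumr_ge0 => j _.
  by rewrite mulr_ge0 ?nm_ge0.
have [U [Ub hU]] := monotone_lim umono ub.
move=> e e0; have e2 : 0 < e / 2 by rewrite divr_gt0.
have [N1 h1] := hU _ e2.
pose c := nm t + A + 1.
have A0 : 0 <= A by apply: le_trans (hA 0%N); apply: al0.
have c0 : 0 < c by rewrite /c ltr_wpDl ?addr_ge0 ?nm_ge0.
have e4 : 0 < e / 2 / c by rewrite divr_gt0.
have [N2 h2] := ca _ e4; have [N3 h3] := cb _ e4.
exists (maxn N1.*2.+1 (maxn N2 N3)) => n; rewrite !geq_max => /and3P[n1 n2 n3].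
have -> : psum (fun n => \sum_(i < n.+1) a i * b (n - i)%N) n - s * t =
    (psum a n * psum b n - s * t)
    - \sum_(i < n) \sum_(j < n | (n - i <= j)%N) a i * b j.
  by rewrite pE; ring.
apply: le_lt_trans (nmD _ _) _; rewrite nmN (splitr e); apply: ltrD.
  have -> : psum a n * psum b n - s * t =
    psum a n * (psum b n - t) + (psum a n - s) * t by ring.
  apply: le_lt_trans (nmD _ _) _; rewrite !nmM.
  have k1 : nm (psum a n) <= A by apply: le_trans (nm_sum _ _) (hA n).
  apply: (@le_lt_trans _ _ ((nm t + A) * (e / 2 / c))).
    rewrite mulrDl addrC; apply: lerD.
      by rewrite mulrC ler_wpM2l ?nm_ge0 // ltW // h2.
    by apply: ler_pM; rewrite ?nm_ge0 // ltW // h3.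
  by rewrite mulrA ltr_pdivrMr // mulrC ltr_pM2l // ltrDl.
apply: (@le_lt_trans _ _ (u n - ga n)).
  rewrite uE addrC addKr; apply: le_trans (nm_sum _ _) _; apply: ler_sum => i _.
  rewrite -big_filter -[leRHS]big_filter.
  by apply: le_trans (nm_sum _ _) _; apply: ler_sum => j _; rewrite nmM.
have n1' : (N1 <= n./2)%N by lia.
have := h1 _ n1'; have := half n; have := Ub n; lra.
Qed.

Lemma real_series_lim (u : nat -> R) B : (forall n, psum (fun i => `|u i|) n <= B) ->
  exists s, forall e, 0 < e -> exists N, forall n, (N <= n)%N -> `|psum u n - s| < e.
Proof.
move=> hB.
have [U [Ub hU]] := monotone_lim (fun m n => psum_mono (fun i => normr_ge0 (u i))) hB.
have v0 i : 0 <= u i + `|u i| by have := ler_norm (- u i); rewrite normrN; lra.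
have vB n : psum (fun i => u i + `|u i|) n <= B + B.
  rewrite /psum big_split; apply: lerD; last exact: hB.
  by apply: le_trans (hB n); apply: ler_sum => i _; apply: ler_norm.
have [V [Vb hV]] := monotone_lim (fun m n => psum_mono v0) vB.
exists (V - U) => e e0; have e2 : 0 < e / 2 by rewrite divr_gt0.
have [N1 h1] := hU _ e2; have [N2 h2] := hV _ e2.
exists (maxn N1 N2) => n; rewrite geq_max => /andP[/h1 k1 /h2 k2].
have E : psum u n = psum (fun i => u i + `|u i|) n - psum (fun i => `|u i|) n.
  by rewrite /psum -sumrB; apply: eq_bigr => i _; rewrite addrK.
by move: (Ub n) (Vb n); rewrite ltr_norml E; lra.
Qed.

Lemma abs_summable_ex (a : nat -> C) B :
  (forall n, psum (fun i => nm (a i)) n <= B) -> exists s, sums a s.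
Proof.
move=> hB.
have [x hx] : exists x, forall e, 0 < e -> exists N, forall n, (N <= n)%N ->
    `|psum (fun i => complex.Re (a i)) n - x| < e.
  apply: (@real_series_lim _ B) => n; apply: le_trans (hB n).
  by apply: ler_sum => i _; apply: Re_le_nm.
have [y hy] : exists x, forall e, 0 < e -> exists N, forall n, (N <= n)%N ->
    `|psum (fun i => complex.Im (a i)) n - x| < e.
  apply: (@real_series_lim _ B) => n; apply: le_trans (hB n).
  by apply: ler_sum => i _; apply: Im_le_nm.
exists (x +i* y); apply/sums_natP; split; first by exists B.
move=> e e0; have e2 : 0 < e / 2 by rewrite divr_gt0.
have [N1 h1] := hx _ e2; have [N2 h2] := hy _ e2.
exists (maxn N1 N2) => n; rewrite geq_max => /andP[/h1 k1 /h2 k2].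
apply: le_lt_trans (nm_le_ReIm _) _; rewrite (splitr e).
have -> : psum a n = psum (fun i => complex.Re (a i)) n +i*
    psum (fun i => complex.Im (a i)) n.
  rewrite /psum; elim: {k1 k2} n => [|n IH]; first by rewrite !big_ord0.
  by rewrite !big_ord_recr /= IH; case: (a n).
by apply: ltrD.
Qed.

Definition bser (x q s : C) := sums (fun i => binc x i * q ^+ i) s.

Lemma bser_mul x y q s t : bser x q s -> bser y q t -> bser (x + y) q (s * t).
Proof.
move=> hs ht; apply: eq_sums (sums_Cauchy hs ht) => // n.
rewrite -binc_Vandermonde mulr_suml; apply: eq_bigr => i _.
by rewrite mulrACA -exprD subnKC // -ltnS.
Qed.

Lemma bser0 q : bser 0 q 1.
Proof.
apply: eq_sums (@sums_fin (fun i => binc (0 : C) i * q ^+ i) 1 _) => //.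
  by rewrite big_ord1 binc0 mulr1.
by case=> // i _; rewrite (binc_nat _ 0) bin0n mul0r.
Qed.

Lemma bser1 q : bser 1 q (1 + q).
Proof.
apply: eq_sums (@sums_fin (fun i => binc (1 : C) i * q ^+ i) 2 _) => //.
  by rewrite !big_ord_recr big_ord0 /= !(binc_nat _ 1) !mul1r add0r expr1.
by case=> [|[|i]] // _; rewrite (binc_nat _ 1) bin_small ?mul0r.
Qed.

Lemma bser_expn x q s n : bser x q s -> bser (x *+ n) q (s ^+ n).
Proof.
move=> h; elim: n => [|n IH]; first exact: bser0.
by rewrite mulrS exprS; apply: bser_mul.
Qed.

Lemma bser_unique x q s t : bser x q s -> bser x q t -> s = t.
Proof. by move=> [_ h1] [_ h2]; apply: has_sum_unique h1 h2. Qed.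

Lemma sum_geom_le (r : R) n : 0 <= r -> r < 1 -> psum (fun i => r ^+ i) n <= (1 - r)^-1.
Proof.
move=> r0 r1; have p : 0 < 1 - r by rewrite subr_gt0.
rewrite -(ler_pM2l p) divff ?gt_eqF // /psum -(big_mkord xpredT (fun i => r ^+ i)).
have -> : (1 - r) * \sum_(0 <= i < n) r ^+ i = 1 - r ^+ n.
  by rewrite big_mkord -opprB mulNr -subrX1 opprB.
by rewrite gerBl exprn_ge0.
Qed.

Lemma bser_inv q : nm q < 1 -> bser (-1) q (1 + q)^-1.
Proof.
move=> q1; have b1 i : binc (-1 : C) i = (-1) ^+ i.
  have := binc_opp (-1 : C) i; rewrite opprK subrK binc_nat binn => h.
  by rewrite -[RHS]mulr1 -[X in _ = _ * X]h mulrA -exprD addnn -mul2n exprM sqrrN !expr1n mul1r.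
have hB n : psum (fun i => nm (binc (-1) i * q ^+ i)) n <= (1 - nm q)^-1.
  apply: le_trans (sum_geom_le n (nm_ge0 q) q1); apply: ler_sum => i _.
  by rewrite nmM nmX b1 nmX nmN nm1 expr1n mul1r.
have [s hs] := abs_summable_ex hB.
have := bser_mul hs (bser1 q); rewrite addNr => h.
have e := bser_unique h (bser0 q).
have nz : 1 + q != 0 by apply: contra_eq_neq e => ->; rewrite mulr0 eq_sym oner_eq0.
by rewrite -(mulfK nz s) e mul1r in hs.
Qed.

(* For [0 <= a <= 1] the numbers [(-1)^i binom(a, i)] with [i > 0] are all
   nonpositive, so their absolute values telescope by Pascal's rule. *)
Lemma psum_binc_frac (a : R) n : 0 <= a <= 1 ->
  psum (fun i => nm (binc (a%:C) i.+1)) n <= 1.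
Proof.
move=> /andP[a0 a1].
pose c (x : R) i : R := (\prod_(t < i) (x - t%:R)) / (i`!)%:R.
have cE (x : R) i : binc x%:C i = (c x i)%:C.
  rewrite /binc /c rmorphM fmorphV /= rmorph_nat rmorph_prod; congr (_ / _).
  by apply: eq_bigr => t _; rewrite rmorphB rmorph_nat.
have sgn (x : R) i : x <= 0 -> 0 <= (-1) ^+ i * c x i.
  move=> x0; rewrite /c mulrA divr_ge0 //.
  rewrite -[X in (-1) ^+ X](card_ord i) -prodrN prodr_ge0 // => t _.
  by rewrite opprB subr_ge0; apply: le_trans x0 _.
have cS (x : R) i : c x i.+1 = x / i.+1%:R * c (x - 1) i.
  rewrite /c big_ord_recl factS natrM subr0 invfM.
  under eq_bigr => t _ do rewrite /bump /= natrD opprD addrA.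
  ring.
have pas (x : R) i : c x i.+1 = c (x - 1) i + c (x - 1) i.+1.
  apply: complexI; rewrite rmorphD /= -!cE.
  have -> : x%:C = 1 + (x - 1)%:C by rewrite rmorphB rmorph1 addrC subrK.
  rewrite -binc_Vandermonde big_ord_recl big_ord_recl big1.
    rewrite addr0 !subn0 /= !(binc_nat _ 1) !mul1r addrC; congr (_ + _).
    by rewrite /bump /= subn1.
  by move=> t _; rewrite (binc_nat _ 1) bin_small ?mul0r.
suff -> : psum (fun i => nm (binc a%:C i.+1)) n = 1 - (-1) ^+ n * c (a - 1) n.
  by rewrite gerBl sgn // subr_le0.
elim: n => [|n IH].
  by rewrite /psum big_ord0 expr0 /c big_ord0 divr1 mulr1 subrr.
rewrite psumS IH cE nm_real.
have pos : 0 <= (-1) ^+ n * c a n.+1.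
  by rewrite cS mulrCA mulr_ge0 ?divr_ge0 // sgn // subr_le0.
have -> : `|c a n.+1| = (-1) ^+ n * c a n.+1.
  by rewrite -[RHS]ger0_norm // normrMsign.
by rewrite pas exprS; ring.
Qed.

Lemma bser_frac (a : R) q : 0 <= a <= 1 -> nm q < 1 ->
  exists2 s, bser a%:C q s & nm (s - 1) <= nm q.
Proof.
move=> ha q1; have hb := fun n => psum_binc_frac n ha.
have tail n : psum (fun i => nm (binc a%:C i.+1 * q ^+ i.+1)) n <= nm q.
  apply: (@le_trans _ _ (psum (fun i => nm q * nm (binc a%:C i.+1)) n)).
    apply: ler_sum => i _; rewrite nmM nmX mulrC exprS -mulrA ler_wpM2l ?nm_ge0 //.
    by rewrite ler_piMl ?nm_ge0 // exprn_ile1 ?nm_ge0 // ltW.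
  by rewrite /psum -mulr_sumr ler_piMr ?nm_ge0 //; apply: hb.
have hB n : psum (fun i => nm (binc a%:C i * q ^+ i)) n <= 1 + nm q.
  case: n => [|n]; first by rewrite /psum big_ord0 addr_ge0 ?nm_ge0.
  rewrite /psum big_ord_recl binc0 mul1r expr0 nm1 lerD2l; exact: tail.
have [s hs] := abs_summable_ex hB; exists s => //.
rewrite leNgt; apply/negP => lt; have e0 : 0 < nm (s - 1) - nm q by rewrite subr_gt0.
have /sums_natP[_ /(_ _ e0)[N hN]] := hs.
have := hN N.+1 (leqnSn N); rewrite {1}/psum big_ord_recl binc0 mul1r expr0.
set T := \sum_(i < N) _ => h.
have hT : nm T <= nm q by apply: le_trans (nm_sum _ _) (tail N).
have e : s - 1 = (s - (1 + T)) + T by rewrite opprD addrA subrK.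
by have := nmD (s - (1 + T)) T; rewrite -e (nm_distC s (1 + T)); lra.
Qed.

End Summation.

(** * Roots and branches of powers *)

Section Exponential.
Variable R : realType.
Local Notation C := R[i].
Implicit Types (x y z : C).

Lemma cexpD x y : cexp (x + y) = cexp x * cexp y.
Proof.
case: x y => [a b] [c d]; rewrite /cexp /= expRD cosD sinD.
by apply/eqP; rewrite eq_complex /=; apply/andP; split; apply/eqP; ring.
Qed.

Lemma cexp_real (a : R) : cexp a%:C = (expR a)%:C.
Proof. by rewrite /cexp /= cos0 sin0 mulr1. Qed.

Lemma cexp0 : cexp (0 : C) = 1.
Proof. by rewrite -[0]/((0 : R)%:C) cexp_real expR0. Qed.

Lemma cexp_neq0 x : cexp x != 0.
Proof.
apply/eqP => h; have := cexpD x (- x).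
by rewrite subrr cexp0 h mul0r => /eqP; rewrite oner_eq0.
Qed.

Lemma cexpN x : cexp (- x) = (cexp x)^-1.
Proof.
apply: (mulfI (cexp_neq0 x)); rewrite -cexpD subrr cexp0 mulfV //.
exact: cexp_neq0.
Qed.

Lemma cexpB x y : cexp (x - y) = cexp x / cexp y.
Proof. by rewrite cexpD cexpN. Qed.

Lemma cexpMn n x : cexp (n%:R * x) = cexp x ^+ n.
Proof.
elim: n => [|n IH]; first by rewrite mul0r cexp0.
by rewrite -addn1 natrD mulrDl mul1r cexpD IH exprD expr1.
Qed.

Lemma cexpMz (m : int) x : cexp (m%:~R * x) = cexp x ^ m.
Proof.
case: m => m; first by rewrite -pmulrn cexpMn.
by rewrite NegzE mulrNz mulNr cexpN -pmulrn cexpMn.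
Qed.

Lemma nm_cexp (a b : R) : nm (cexp (a +i* b)) = expR a.
Proof.
rewrite /cexp nmM nm_real ger0_norm ?expR_ge0 // /nm /=.
by rewrite cos2Dsin2 sqrtr1 mulr1.
Qed.

Lemma Re_cexp (a b : R) : complex.Re (cexp (a +i* b)) = expR a * cos b.
Proof. by rewrite /cexp /= mul0r subr0. Qed.

Lemma Im_cexp (a b : R) : complex.Im (cexp (a +i* b)) = expR a * sin b.
Proof. by rewrite /cexp /= mul0r addr0. Qed.

Lemma cos_sin_surj (a b : R) : a ^+ 2 + b ^+ 2 = 1 ->
  exists2 t : R, 0 <= t < 2 * pi & cos t = a /\ sin t = b.
Proof.
move=> h; have hp := @pi_gt0 R.
have ha : -1 <= a <= 1.
  by rewrite -ler_norml -(ler_pXn2r (n := 2)) ?nnegrE // expr1n real_normK ?num_real //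
    -h lerDl sqr_ge0.
have a0 := acos_ge0 ha; have a1 := acos_lepi ha.
have ca : cos (acos a) = a by apply: acosK; rewrite in_itv.
have sa : sin (acos a) = `|b|.
  by rewrite sin_acos // -h [a ^+ 2 + _]addrC addrK sqrtr_sqr.
have [b0|b0] := leP 0 b.
  exists (acos a); last by rewrite ca sa ger0_norm.
  by rewrite a0 /=; lra.
exists (2 * pi - acos a); last first.
  have e : 2 * pi - acos a = - acos a + pi *+ 2 by rewrite mulr_natl addrC.
  by rewrite e cosD2pi sinD2pi cosN sinN ca sa ltr0_norm ?opprK.
have : acos a != 0.
  apply: contra_eq_neq sa => ->; rewrite sin0 ltr0_norm // eq_sym oppr_eq0.
  by rewrite lt_eqF.
by move: a0; rewrite le_eqVlt eq_sym => /orP[->//|a0 _]; apply/andP; split; lra.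
Qed.

Lemma cargP z : z != 0 -> 0 <= carg z < 2 * pi /\
  z = (nm z)%:C * (cos (carg z) +i* sin (carg z)).
Proof.
move=> z0; rewrite /carg; case: xgetP => [t -> [h1 h2]|]; first by split.
case: z z0 => a b z0 h; exfalso.
have r0 : nm (a +i* b) != 0 by rewrite nm_eq0.
set r := nm _ in r0.
have r2 : r ^+ 2 = a ^+ 2 + b ^+ 2.
  by rewrite /r /nm /= sqr_sqrtr // addr_ge0 ?sqr_ge0.
have [|t ht [c s]] := @cos_sin_surj (a / r) (b / r).
  by rewrite !expr_div_n -mulrDl -r2 divff // expf_neq0.
apply: (h t); split => //; rewrite normCE -/r c s.
by apply/eqP; rewrite eq_complex /= !mul0r subr0 addr0 ![r * _]mulrC !divfK ?eqxx.
Qed.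

Lemma cexp_lbranch (p : int) z : z != 0 -> cexp (lbranch p z) = z.
Proof.
move=> z0; rewrite /lbranch cexpD.
have -> : cexp (0 +i* (2 * p%:~R * pi)) = 1 :> C.
  have -> : 0 +i* (2 * p%:~R * pi) = p%:~R * (0 +i* (2 * pi)) :> C.
    have -> : p%:~R = (p%:~R : R)%:C :> C by rewrite rmorph_int.
    by apply/eqP; rewrite eq_complex /= !mul0r mulr0 subr0 addr0 eqxx /=; apply/eqP; ring.
  rewrite cexpMz /cexp /= expR0 mulr_natl cos2pi sin2pi mulr1; exact: exp1rz.
rewrite mulr1 /clog /cexp /= lnK ?posrE ?lt_def ?nm_ge0 ?nm_eq0 ?z0 //.
by have [_ <-] := cargP z0.
Qed.

Lemma lbranch0_real (x : R) : 0 < x -> lbranch 0 x%:C = (ln x)%:C.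
Proof.
move=> x0; have z0 : x%:C != 0 by rewrite eq_complex /= eqxx andbT gt_eqF.
have [/andP[h1 h2] h] := cargP z0; have hp := @pi_gt0 R.
have nx : nm x%:C = x by rewrite nm_real gtr0_norm.
suff c0 : carg x%:C = 0.
  by rewrite /lbranch /clog c0 -/(nm _) nx mulr0 mul0r addr0.
move: h; rewrite nx => /eqP; rewrite eq_complex /= !mul0r subr0 addr0.
move=> /andP[/eqP hc /eqP hs].
have c1 : cos (carg x%:C) = 1.
  by apply: (mulfI (lt0r_neq0 x0)); rewrite -hc mulr1.
have [le|lt] := leP (carg x%:C) pi.
  by apply: cos_inj; rewrite ?in_itv /= ?lexx ?h1 ?le ?ltW // c1 cos0.
have : 2 * pi - carg x%:C = 0.
  apply: cos_inj; first by rewrite in_itv /=; apply/andP; split; lra.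
    by rewrite in_itv /= lexx ltW.
  have -> : 2 * pi - carg x%:C = - carg x%:C + pi *+ 2 by rewrite mulr_natl addrC.
  by rewrite cosD2pi cosN c1 cos0.
by lra.
Qed.

Lemma cos_gt0_lt_pihalf (t : R) : `|t| <= pi -> 0 < cos t -> `|t| < pi / 2.
Proof.
move=> h; rewrite -cos_norm -cos_pihalf; have hp := @pi_gt0 R.
rewrite ltr_cos // ?in_itv /= ?h ?normr_ge0 //.
by apply/andP; split; lra.
Qed.

Lemma Re_gt0_cexp z : 0 < complex.Re z ->
  exists a b : R, z = cexp (a +i* b) /\ `|b| < pi / 2.
Proof.
move=> h; have z0 : z != 0 by apply: contraTneq h => ->; rewrite ltxx.
have hp := @pi_gt0 R.
have [/andP[t0 t1] zE] := cargP z0.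
have r0 : 0 < nm z by rewrite lt_def nm_eq0 z0 nm_ge0.
pose b := if carg z <= pi then carg z else carg z - 2 * pi.
have [cb sb] : cos b = cos (carg z) /\ sin b = sin (carg z).
  rewrite /b; case: ifP => // _; rewrite mulr_natl.
  by rewrite -(cosD2pi (_ - _)) -(sinD2pi (_ - _)) subrK.
exists (ln (nm z)), b; split.
  by rewrite /cexp /= cb sb lnK ?posrE.
apply: cos_gt0_lt_pihalf; last first.
  by move: h; rewrite cb {1}zE /= mul0r subr0 pmulr_rgt0.
by rewrite ler_norml /b; case: ifPn; rewrite -?ltNge => hb; apply/andP; split; lra.
Qed.

Lemma cexp_inj_strip (a b c d : R) : `|b| < pi / 2 -> `|d| < pi / 2 ->
  cexp (a +i* b) = cexp (c +i* d) -> a = c /\ b = d.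
Proof.
move=> hb hd h; have e : a = c by apply: expR_inj; rewrite -(nm_cexp a b) h nm_cexp.
split => //; move: h; rewrite e => /(congr1 (@complex.Im R)); rewrite !Im_cexp.
move=> /(mulfI (lt0r_neq0 (expR_gt0 c))) /sin_inj -> //; rewrite in_itv /=.
  by move: hb; rewrite ltr_norml => /andP[h1 h2]; rewrite !ltW.
by move: hd; rewrite ltr_norml => /andP[h1 h2]; rewrite !ltW.
Qed.

(* The sum [F] of the series with exponent [1/k] satisfies [F^k = 1 + q].  For
   [j <= k] the power [F^j] is the sum of the series with exponent [j/k <= 1],
   hence lies in the right half-plane; so the argument of [F^j] is [j] times
   that of [F] for all these [j], and [F] is the principal root. *)
Lemma bser_root (k : nat) q (a b : R) : (0 < k)%N -> nm q < 1 -> `|b| < pi / 2 ->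
  cexp (a +i* b) = 1 + q -> bser k%:R^-1 q (cexp ((a +i* b) / k%:R)).
Proof.
move=> k0 q1 hb e; have kR : (k%:R : R) != 0 by rewrite pnatr_eq0 -lt0n.
have kC : (k%:R : C) != 0 by rewrite pnatr_eq0 -lt0n.
have kV : k%:R^-1 = (k%:R^-1 : R)%:C :> C by rewrite fmorphV /= rmorph_nat.
have [|F hF F1] := @bser_frac R k%:R^-1 q _ q1.
  by rewrite invr_ge0 ler0n /= invf_le1 ?ltr0n // ler1n.
rewrite -kV in hF.
have ReF s : nm (s - 1) <= nm q -> 0 < complex.Re s.
  move=> h; have := Re_le_nm (s - 1); case: s h => x y h /=; rewrite ler_norml.
  by move=> /andP[]; move: h q1; rewrite /=; lra.
have ReFj (j : nat) : (j <= k)%N -> 0 < complex.Re (F ^+ j).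
  move=> jk; have [|s hs s1] := @bser_frac R (j%:R / k%:R) q _ q1.
    by rewrite divr_ge0 //= ler_pdivrMr ?ltr0n // mul1r ler_nat.
  suff -> : F ^+ j = s by apply: ReF.
  apply: bser_unique (bser_expn j hF) _.
  by rewrite -[_ *+ j]mulr_natl kV -(rmorph_nat (real_complex R)) -rmorphM.
have [c [d [FE hd]]] := Re_gt0_cexp (ReF _ F1).
have hp := @pi_gt0 R.
have FjE j : F ^+ j = cexp ((j%:R * c) +i* (j%:R * d)).
  rewrite FE -cexpMn -(rmorph_nat (real_complex R)); congr cexp.
  by apply/eqP; rewrite eq_complex /= !mul0r subr0 addr0 !eqxx.
have hj (j : nat) : (j <= k)%N -> `|j%:R * d| < pi / 2.
  elim: j => [_|j IH jk]; first by rewrite mul0r normr0 divr_gt0.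
  apply: cos_gt0_lt_pihalf.
    rewrite -addn1 natrD mulrDl mul1r (le_trans (ler_normD _ _)) //.
    by have := IH (ltnW jk); lra.
  by have := ReFj _ jk; rewrite FjE Re_cexp pmulr_rgt0 ?expR_gt0.
have Fk : F ^+ k = 1 + q.
  apply: bser_unique (bser1 q); have := bser_expn k hF.
  by rewrite -[_ *+ k]mulr_natr mulVf.
have [ea eb] : a = k%:R * c /\ b = k%:R * d.
  by apply: cexp_inj_strip => //; [apply: hj|rewrite e -Fk FjE].
suff -> : (a +i* b) / k%:R = c +i* d by rewrite -FE.
rewrite kV ea eb.
apply/eqP; rewrite eq_complex /= !mulr0 subr0 add0r.
by rewrite ![_ * _ / _]mulrAC divff // !mul1r !eqxx.
Qed.

Lemma bser_expz x q s (r : int) : nm q < 1 -> (exists2 m : nat, (0 < m)%N & x *+ m = 1) ->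
  bser x q s -> bser (r%:~R * x) q (s ^ r).
Proof.
move=> q1 [m m0 xm] h.
have sm : s ^+ m = 1 + q.
  by apply: bser_unique (bser1 q); rewrite -xm; apply: bser_expn.
have nz : 1 + q != 0.
  by apply: contraTneq q1 => /eqP; rewrite addrC addr_eq0 => /eqP->; rewrite nmN nm1 ltxx.
have s0 : s != 0 by apply: contraNneq nz => s0; rewrite -sm s0 expr0n gtn_eqF.
pose a := `|r|%N; pose b := (`|r| * m)%N.
have [n hn] : exists n : nat, r + `|r|%N%:Z * m%:Z = n%:Z.
  by exists (absz (r + `|r|%N%:Z * m%:Z)); nia.
have := bser_mul (bser_expn n h) (bser_expn `|r|%N (bser_inv q1)).
have -> : s ^+ n * (1 + q)^-1 ^+ `|r|%N = s ^ r.
  rewrite -sm exprVn -exprM exprnN [s ^+ n]exprnP -expfzDr // -hn PoszM.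
  by rewrite [m%:Z * _]mulrC addrK.
suff -> : x *+ n + -1 *+ `|r|%N = r%:~R * x by [].
rewrite -[x *+ n]mulr_natl.
have -> : n%:R = r%:~R + `|r|%:R * m%:R :> C.
  by rewrite -natrM !pmulrn -intrD PoszM -hn.
rewrite mulrDl -mulrA [m%:R * x]mulr_natl xm mulr1.
by rewrite -[-1 *+ _]mulr_natr mulN1r addrK.
Qed.

Lemma bser_branch (k : nat) (p r : int) z1 z2 : (0 < k)%N ->
  0 < nm (z1 - z2) < nm z2 -> `|carg z1 - carg z2| < pi / 2 ->
  bser (r%:~R / k%:R) ((z1 - z2) / z2)
    (cexp (r%:~R / k%:R * lbranch p z1) / cexp (r%:~R / k%:R * lbranch p z2)).
Proof.
move=> k0 /andP[d0 d1] harg; have n2 : 0 < nm z2 by apply: lt_trans d1.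
have z20 : z2 != 0 by rewrite -nm_eq0 gt_eqF.
have z10 : z1 != 0.
  by apply: contraTneq d1 => ->; rewrite sub0r nmN ltxx.
have n1 : 0 < nm z1 by rewrite lt_def nm_eq0 z10 nm_ge0.
have q1 : nm ((z1 - z2) / z2) < 1 by rewrite nmM nmV ltr_pdivrMr // mul1r.
have lE : lbranch p z1 - lbranch p z2 =
    (ln (nm z1) - ln (nm z2)) +i* (carg z1 - carg z2).
  rewrite /lbranch /clog opprD addrACA subrr addr0.
  by apply/eqP; rewrite eq_complex /= !eqxx.
have := bser_root k0 q1 harg (a := ln (nm z1) - ln (nm z2)).
rewrite -lE cexpB !cexp_lbranch // mulrBl divff // addrC subrK => /(_ erefl) h.
rewrite -cexpB -mulrBr mulrAC -mulrA cexpMz.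
have -> : z1 / z2 - 1 = (z1 - z2) / z2 by rewrite mulrBl divff.
rewrite mulrBl divff //.
apply: bser_expz => //; first by move: q1; rewrite mulrBl divff.
by exists k => //; rewrite -[LHS]mulr_natr mulVf // pnatr_eq0 -lt0n.
Qed.

Lemma eta_expk k : (0 < k)%N -> eta R k ^+ k = 1.
Proof.
move=> k0; rewrite /eta -cexpMn -(rmorph_nat (real_complex R)).
have -> : (k%:R)%:C * (0 +i* (2 * pi / k%:R)) = 0 +i* (2 * pi) :> C.
  apply/eqP; rewrite eq_complex /= !mul0r mulr0 subr0 addr0 eqxx /=.
  by rewrite mulrC divfK // pnatr_eq0 -lt0n.
by rewrite /cexp /= expR0 mulr_natl cos2pi sin2pi mulr1.
Qed.

Lemma eta_exp_neq1 k m : (0 < m < k)%N -> eta R k ^+ m != 1.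
Proof.
move=> /andP[m0 mk]; have k0 : (0 < k)%N by apply: leq_trans mk.
rewrite /eta -cexpMn -(rmorph_nat (real_complex R)); have hp := @pi_gt0 R.
pose t : R := 2 * pi * (m%:R / k%:R).
have -> : (m%:R)%:C * (0 +i* (2 * pi / k%:R)) = 0 +i* t :> C.
  apply/eqP; rewrite eq_complex /= !mul0r mulr0 subr0 addr0 eqxx /=.
  by rewrite /t; apply/eqP; ring.
have mk1 : (m%:R / k%:R : R) < 1 by rewrite ltr_pdivrMr ?ltr0n // mul1r ltr_nat.
have mk0 : 0 < (m%:R / k%:R : R) by rewrite divr_gt0 ?ltr0n.
have t0 : 0 < t by rewrite /t mulr_gt0 // mulr_gt0.
have t1 : t < 2 * pi by rewrite /t gtr_pMr // mulr_gt0.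
apply/eqP => /(congr1 (@complex.Re R)); rewrite Re_cexp expR0 mul1r /= => c1.
have [le|lt] := leP t pi.
  suff : t = 0 by lra.
  by apply: cos_inj; rewrite ?in_itv /= ?lexx ?le ?ltW // c1 cos0.
suff : 2 * pi - t = 0 by lra.
apply: cos_inj; first by rewrite in_itv /=; apply/andP; split; lra.
  by rewrite in_itv /= lexx ltW.
have -> : 2 * pi - t = - t + pi *+ 2 by rewrite mulr_natl addrC.
by rewrite cosD2pi cosN c1 cos0.
Qed.

Lemma eta_neq0 k : eta R k != 0.
Proof. exact: cexp_neq0. Qed.

Lemma eta_expz_mod k (m n : int) : (0 < k)%N -> (m = n %[mod k%:Z])%Z ->
  eta R k ^ m = eta R k ^ n.
Proof.
move=> k0 e; rewrite (divz_eq m k%:Z) (divz_eq n k%:Z) e.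
rewrite !expfzDr ?eta_neq0 //; congr (_ * _).
by rewrite ![_ * k%:Z]mulrC -!exprz_exp -!exprnP eta_expk // !exp1rz.
Qed.

Lemma sum_eta k (m : int) : (0 < k)%N ->
  \sum_(j < k) (eta R k ^+ j) ^ m = if (m %% k%:Z)%Z == 0 then k%:R else 0.
Proof.
move=> k0; set e := eta R k.
have E (j : nat) : (e ^+ j) ^ m = (e ^ m) ^+ j.
  by rewrite [e ^+ j]exprnP exprz_exp mulrC -exprz_exp -exprnP.
under eq_bigr => j _ do rewrite E.
have km0 : (k%:Z != 0) by rewrite -lt0n in k0 *; lia.
case: eqP => [h|h].
  have -> : e ^ m = 1.
    by rewrite (@eta_expz_mod k m 0) // h mod0z.
  by under eq_bigr => j _ do rewrite expr1n; rewrite sumr_const card_ord.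
apply/eqP; rewrite -(mulrI_eq0 _ (@mulfI _ (e ^ m - 1) _)); last first.
  rewrite subr_eq0; have [n hn] : exists n : nat, (m %% k%:Z)%Z = n%:Z.
    by exists `|(m %% k%:Z)%Z|%N; have := modz_ge0 m km0; lia.
  have -> : e ^ m = e ^ n by apply: eta_expz_mod => //; rewrite -hn modz_mod.
  apply: eta_exp_neq1; have := ltz_pmod m (_ : 0 < k%:Z); rewrite hn in h *.
  by move=> /(_ k0); lia.
rewrite -subrX1 exprnP exprz_exp mulrC -exprz_exp -exprnP eta_expk //.
by rewrite exp1rz subrr.
Qed.

End Exponential.

(** * Graded spaces and formal delta functions *)

Section Gradings.
Variable R : realType.
Local Notation C := R[i].
Variables (I : choiceType) (M : lmodType C) (G : grading I M).
Implicit Types (x y : M).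

Lemma homog_gproj i x : homog G i (gproj G i x).
Proof. by rewrite /homog gproj_orth eqxx. Qed.

Lemma gproj_homog i j x : homog G i x -> gproj G j x = if j == i then x else 0.
Proof. by rewrite /homog => h; rewrite -{1}h gproj_orth h. Qed.

Lemma homog0 i : homog G i 0.
Proof. by rewrite /homog linear0. Qed.

Lemma homogD i x y : homog G i x -> homog G i y -> homog G i (x + y).
Proof. by rewrite /homog linearD => -> ->. Qed.

Lemma homogZ i c x : homog G i x -> homog G i (c *: x).
Proof. by rewrite /homog linearZ /= => ->. Qed.

Lemma homog_sum i (T : Type) (s : seq T) (F : T -> M) :
  (forall t, homog G i (F t)) -> homog G i (\sum_(t <- s) F t).
Proof.
move=> h; elim: s => [|t s IH]; first by rewrite big_nil; apply: homog0.
by rewrite big_cons; apply: homogD.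
Qed.

Lemma grading_dec x : exists2 r : seq I,
  (forall i, i \notin r -> gproj G i x = 0) & x = \sum_(i <- r) gproj G i x.
Proof.
exists (fset_set [set i | gproj G i x != 0]).
  move=> i; rewrite in_fset_set; last exact: gproj_fin.
  by move=> /negP; rewrite inE /= => /negP/negPn/eqP.
rewrite -[LHS](gproj_sum G) (@fsum_seq _ _ (fset_set [set i | gproj G i x != 0])) //.
move=> i; rewrite in_fset_set; last exact: gproj_fin.
by move=> /negP; rewrite inE /= => /negP/negPn/eqP.
Qed.

Lemma grading_ind (P : M -> Prop) : P 0 -> (forall x y, P x -> P y -> P (x + y)) ->
  (forall i x, homog G i x -> P x) -> forall x, P x.
Proof.
move=> P0 PD Ph x; have [r _ ->] := grading_dec x.
elim: r => [|i r IH]; first by rewrite big_nil.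
by rewrite big_cons; apply: PD => //; apply: Ph (homog_gproj i x).
Qed.

End Gradings.

Section FormalCoefficients.
Variable R : realType.
Local Notation C := R[i].

Section Fsum.
Variables (T : choiceType) (M : lmodType C) (ex : T -> expo).
Hypothesis ex_inj : injective ex.

Lemma fsumE (c : T -> M) t : fsum c ex (ex t) = c t.
Proof.
rewrite /fsum (_ : [set t' | _] = [set t]) ?fsbig_set1 //.
by apply/seteqP; split=> [x /ex_inj|x /= ->].
Qed.

Lemma fsum_out (c : T -> M) e : (forall t, ex t <> e) -> fsum c ex e = 0.
Proof. by move=> h; rewrite /fsum fsbig1 // => t /h. Qed.

End Fsum.

Lemma fmul_fsum (T : choiceType) (M : lmodType C) (ex : T -> expo) (c : T -> C)
    (B : expo -> M) e : injective ex ->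
  fmul (fsum c ex) B e = \sum_(t \in [set: T]) c t *: B (e - ex t).
Proof.
move=> ex_inj; rewrite /fmul -(@fsbig_widen _ _ _ _ (range ex)) //; last first.
  move=> d [_ /= h]; rewrite (fsum_out (M := C^o)) ?scale0r // => t td.
  by apply: h; exists t.
rewrite (@reindex_fsbig _ _ _ _ _ ex [set: T]).
  by apply: eq_fsbigr => t _; rewrite (fsumE (M := C^o)).
by apply: inj_bij => x y _ _; apply: ex_inj.
Qed.

Variables (k : nat) (V W : lmodType C) (Y : int -> {bilinear V -> W -> W}).
Variable YV : int -> {bilinear V -> V -> V}.
Hypothesis k_gt0 : (0 < k)%N.

Lemma kmul_inj (x y : int) : k%:Z * x = k%:Z * y -> x = y.
Proof. by apply: mulfI; lia. Qed.

Lemma prod12E u v w (x0 x1 x2 : int) : prod12 k Y u v w (x0, x1, x2) =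
  if x0 == 0 then Y (- x1 - k%:Z) u (Y (- x2 - k%:Z) v w) else 0.
Proof.
case: eqP => [->|ne]; last by apply: fsum_out => t [/esym].
pose ex (t : int * int) : expo := (0, - t.1 - k%:Z, - t.2 - k%:Z).
have -> : (0, x1, x2) = ex (- x1 - k%:Z, - x2 - k%:Z).
  by congr (_, _, _); rewrite /=; lia.
rewrite /prod12 -/ex fsumE // => -[a b] [c d] [/= h1 h2]; congr (_, _); lia.
Qed.

Lemma prod21E u v w (x0 x1 x2 : int) : prod21 k Y u v w (x0, x1, x2) =
  if x0 == 0 then Y (- x2 - k%:Z) v (Y (- x1 - k%:Z) u w) else 0.
Proof.
case: eqP => [->|ne]; last by apply: fsum_out => t [/esym].
pose ex (t : int * int) : expo := (0, - t.1 - k%:Z, - t.2 - k%:Z).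
have -> : (0, x1, x2) = ex (- x1 - k%:Z, - x2 - k%:Z).
  by congr (_, _, _); rewrite /=; lia.
rewrite /prod21 -/ex fsumE // => -[a b] [c d] [/= h1 h2]; congr (_, _); lia.
Qed.

Lemma iterate_inj : injective
  (fun t : int * int => ((k%:Z * (- t.1 - 1), 0, - t.2 - k%:Z) : expo)).
Proof.
by move=> [a b] [c d] [/= /kmul_inj h1 h2]; congr (_, _); lia.
Qed.

Lemma iterateE u v w (t1 x1 x2 : int) :
  iterate k YV Y u v w (k%:Z * (- t1 - 1), x1, x2) =
  if x1 == 0 then Y (- x2 - k%:Z) (YV t1 u v) w else 0.
Proof.
case: eqP => [->|ne]; last by apply: fsum_out => t [_ /esym].
have -> : (k%:Z * (- t1 - 1), 0, x2) =
    (fun t : int * int => ((k%:Z * (- t.1 - 1), 0, - t.2 - k%:Z) : expo))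
      (t1, - x2 - k%:Z).
  by congr (_, _, _); rewrite /=; lia.
exact: fsumE iterate_inj _ _.
Qed.

Lemma expoB (a b c a' b' c' : int) :
  ((a, b, c) - (a', b', c') : expo) = (a - a', b - b', c - c').
Proof. by []. Qed.

Lemma fsum_graph (M : zmodType) (mu : nat -> int) (F : int * nat -> M) :
  (forall m i, m != mu i -> F (m, i) = 0) ->
  \sum_(t \in [set: int * nat]) F t = \sum_(i \in [set: nat]) F (mu i, i).
Proof.
move=> h; rewrite -(@fsbig_widen _ _ _ _ (range (fun i => (mu i, i)))) //.
  rewrite (@reindex_fsbig _ _ _ _ _ (fun i => (mu i, i)) [set: nat]) //.
  by apply: inj_bij => x y _ _ [].
move=> [m i] [_ /= hm]; apply: h; apply/eqP => e; apply: hm.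
by exists i => //; rewrite e.
Qed.

Lemma delta12_inj : injective (fun t : int * nat =>
  ((k%:Z * (- t.1 - 1), k%:Z * (t.1 - t.2%:Z), k%:Z * t.2%:Z) : expo)).
Proof.
by move=> [a b] [c d] [/= /kmul_inj h1 /kmul_inj h2 _]; congr (_, _); lia.
Qed.

Lemma delta21_inj : injective (fun t : int * nat =>
  ((k%:Z * (- t.1 - 1), k%:Z * t.2%:Z, k%:Z * (t.1 - t.2%:Z)) : expo)).
Proof.
by move=> [a b] [c d] [/= /kmul_inj h1 _ /kmul_inj h2]; congr (_, _); lia.
Qed.

Lemma delta_iter_inj : injective (fun t : int * nat =>
  ((k%:Z * t.2%:Z, t.1 - k%:Z * t.2%:Z, - t.1 - k%:Z) : expo)).
Proof.
move=> [a b] [c d] [/= /eqP]; rewrite eqn_pmul2l // => /eqP-> _ h.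
by congr (_, _); lia.
Qed.

Lemma delta12_coef u v w (n l1 l2 : int) :
  fmul (delta12 R k) (prod12 k Y u v w)
    (k%:Z * (- n - 1), - l1 - k%:Z, - l2 - k%:Z) =
  \sum_(i \in [set: nat]) sbinc n%:~R i *:
    Y (l1 + k%:Z * (n - i%:Z)) u (Y (l2 + k%:Z * i%:Z) v w).
Proof.
rewrite (fmul_fsum _ _ _ delta12_inj).
rewrite (fsum_graph (mu := fun=> n)).
  apply: eq_fsbigr => i _; rewrite expoB prod12E /= subrr eqxx.
  by congr (_ *: Y _ u (Y _ v w)); lia.
move=> m i; rewrite expoB prod12E /= => ne.
case: eqP => [|_]; last by rewrite scaler0.
by move/eqP; rewrite subr_eq0 => /eqP/kmul_inj; lia.
Qed.

Lemma delta21_coef u v w (n l1 l2 : int) :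
  fmul (delta21 R k) (prod21 k Y u v w)
    (k%:Z * (- n - 1), - l1 - k%:Z, - l2 - k%:Z) =
  \sum_(i \in [set: nat]) ((-1) ^ n * sbinc n%:~R i) *:
    Y (l2 + k%:Z * (n - i%:Z)) v (Y (l1 + k%:Z * i%:Z) u w).
Proof.
rewrite (fmul_fsum _ _ _ delta21_inj).
rewrite (fsum_graph (mu := fun=> n)).
  apply: eq_fsbigr => i _; rewrite expoB prod21E /= subrr eqxx.
  by congr (_ *: Y _ v (Y _ u w)); lia.
move=> m i; rewrite expoB prod21E /= => ne.
case: eqP => [|_]; last by rewrite scaler0.
by move/eqP; rewrite subr_eq0 => /eqP/kmul_inj; lia.
Qed.

Lemma delta_iter_coef (c : C) u v w (n l1 l2 : int) : c != 0 -> c ^+ k = 1 ->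
  fmul (delta_iter k c) (iterate k YV Y u v w)
    (k%:Z * (- n - 1), - l1 - k%:Z, - l2 - k%:Z) =
  \sum_(i \in [set: nat]) (c ^ (- l1) * binc (l1%:~R / k%:R) i) *:
    Y (l1 + l2 - k%:Z * i%:Z) (YV (n + i%:Z) u v) w.
Proof.
move=> c0 ck; have kC : k%:R != 0 :> C by rewrite pnatr_eq0 -lt0n.
rewrite (fmul_fsum _ _ _ delta_iter_inj).
have E m i : iterate k YV Y u v w ((k%:Z * (- n - 1), - l1 - k%:Z, - l2 - k%:Z)
    - (k%:Z * (m, i).2%:Z, (m, i).1 - k%:Z * (m, i).2%:Z, - (m, i).1 - k%:Z)) =
  if m == k%:Z * i%:Z - k%:Z - l1 then Y (l2 - m - k%:Z) (YV (n + i%:Z) u v) w else 0.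
  rewrite expoB /=.
  have -> : k%:Z * (- n - 1) - k%:Z * i%:Z = k%:Z * (- (n + i%:Z) - 1) by ring.
  rewrite iterateE; congr (if _ then Y _ _ _ else _); lia.
rewrite (fsum_graph (mu := fun i => k%:Z * i%:Z - k%:Z - l1)); last first.
  by move=> m i ne; rewrite E (negbTE ne) scaler0.
apply: eq_fsbigr => i _; rewrite E eqxx.
congr (_ *: Y _ _ w); last by lia.
rewrite /=; congr (_ * _).
  have -> : k%:Z * i%:Z - k%:Z - l1 = k%:Z * (i%:Z - 1) - l1 by ring.
  by rewrite expfzDr // -exprz_exp -exprnP ck exp1rz mul1r.
rewrite binc_opp; congr binc.
by rewrite !(intrB, intrM) -!pmulrn; field.
Qed.

Lemma delta_ndvd (e0 : int) u v w x1 x2 (c : C) : (forall n, e0 != k%:Z * n) ->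
  [/\ fmul (delta12 R k) (prod12 k Y u v w) (e0, x1, x2) = 0,
      fmul (delta21 R k) (prod21 k Y u v w) (e0, x1, x2) = 0 &
      fmul (delta_iter k c) (iterate k YV Y u v w) (e0, x1, x2) = 0].
Proof.
move=> h; split.
- rewrite (fmul_fsum _ _ _ delta12_inj).
  rewrite fsbig1 // => -[m i] _; rewrite expoB prod12E /=.
  by rewrite subr_eq0 (negbTE (h _)) scaler0.
- rewrite (fmul_fsum _ _ _ delta21_inj).
  rewrite fsbig1 // => -[m i] _; rewrite expoB prod21E /=.
  by rewrite subr_eq0 (negbTE (h _)) scaler0.
rewrite (fmul_fsum _ _ _ delta_iter_inj).
rewrite fsbig1 // => -[m i] _; rewrite expoB /=.
rewrite [iterate _ _ _ _ _ _ _](fsum_out (M := W)) ?scaler0 // => -[a b] [/= e _ _].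
have /eqP[] := h (i%:Z - a - 1).
by rewrite -[e0](subrK (k%:Z * i%:Z)) -e; ring.
Qed.

End FormalCoefficients.

Section VertexAlgebra.
Variable R : realType.
Local Notation C := R[i].
Variable V : voa R.
Local Notation YV := (voa_Y V).
Local Notation om := (voa_omega V).
Local Notation G := (voa_gr V).

Lemma L0_homog (n : int) (x : V) : YV 1 om x = n%:~R *: x -> homog G n x.
Proof.
move=> h; have [r r0 xE] := grading_dec G x.
have L0 j y : gproj G j (YV 1 om y) = j%:~R *: gproj G j y.
  move: y; apply: (grading_ind (G := G)).
  - by rewrite !linear0r linear0 scaler0.
  - move=> y z hy hz.
    by rewrite linearDr [LHS]linearD hy hz [gproj G j (y + z)]linearD scalerDr.
  move=> i y hy; rewrite (voa_L0 hy) linearZ /= (gproj_homog _ hy).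
  by case: eqP => [->|]; rewrite ?scaler0.
have key j : j != n -> gproj G j x = 0.
  move=> jn; have /eqP := L0 j x.
  rewrite h linearZ /= -subr_eq0 -scalerBl -intrB scaler_eq0 intr_eq0 subr_eq0.
  by rewrite eq_sym (negbTE jn) => /eqP.
rewrite /homog [in RHS]xE {1}xE linear_sum; apply: eq_bigr => j _.
by rewrite gproj_orth eq_sym; case: eqP => // /eqP/key.
Qed.

Lemma voa_borcherds (u v w : V) (n l1 l2 : int) :
  \sum_(i \in [set: nat]) sbinc n%:~R i *:
    YV (l1 + 1%:Z * (n - i%:Z)) u (YV (l2 + 1%:Z * i%:Z) v w) -
  \sum_(i \in [set: nat]) ((-1) ^ n * sbinc n%:~R i) *:
    YV (l2 + 1%:Z * (n - i%:Z)) v (YV (l1 + 1%:Z * i%:Z) u w) =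
  \sum_(i \in [set: nat]) (1 ^ (- l1) * binc (l1%:~R / 1%:R) i) *:
    YV (l1 + l2 - 1%:Z * i%:Z) (YV (n + i%:Z) u v) w.
Proof.
rewrite -(@delta12_coef R 1 V V YV isT) -(@delta21_coef R 1 V V YV isT u v w).
by rewrite voa_jacobi (@delta_iter_coef R 1 V V YV YV isT) ?oner_neq0 ?expr1n.
Qed.

Lemma Y_homog (a b m : int) (u v : V) : homog G a u -> homog G b v ->
  homog G (a + b - m - 1) (YV m u v).
Proof.
move=> hu hv; apply: L0_homog; have := voa_borcherds om u v 0 1 m.
rewrite (fsum_nat (K := 1)); last first.
  by move=> [|i] // _; rewrite /sbinc (binc_nat _ 0) bin0n mulr0 scale0r.
rewrite (fsum_nat (K := 1)); last first.
  by move=> [|i] // _; rewrite /sbinc (binc_nat _ 0) bin0n !mulr0 scale0r.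
rewrite (fsum_nat (K := 2)); last first.
  by move=> [|[|i]] // _; rewrite divr1 (binc_nat _ 1) bin_small // mulr0 scale0r.
rewrite !big_ord_recr !big_ord0 /= !add0r /sbinc !binc0 expr0 exp1rz divr1 !mul1r.
rewrite (binc_nat _ 1) bin1 -[Posz 0]/(0 : int) -[Posz 1]/(1 : int) oppr0 !scale1r.
rewrite !subr0 => /eqP.
rewrite subr_eq => /eqP ->; rewrite (voa_L0 hu) (voa_L0 hv) linearZr linearZl.
rewrite (_ : 1 + m = m + 1) 1?addrC // -voa_Lm1 (_ : m + 1 - 1 = m) ?addrK //=.
by rewrite -!scalerDl !(intrB, intrD, intrN); congr (_ *: _); ring.
Qed.

Section Automorphism.
Variables (g : {linear V -> V}) (k : nat).
Hypothesis autg : voa_automorphism g.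
Hypothesis ordg : has_finite_order g k.

Lemma aut_homog n x : homog G n x -> homog G n (g x).
Proof.
case: autg => _ gY _ gom hx; apply: L0_homog.
by rewrite -{1}gom -gY (voa_L0 hx) linearZ.
Qed.

Lemma iter_aut_homog i n x : homog G n x -> homog G n (iter i g x).
Proof. by move=> h; elim: i => //= i; apply: aut_homog. Qed.

Definition eigenproj (j : nat) (x : V) : V :=
  k%:R^-1 *: \sum_(i < k) (eta R k ^+ j) ^ (- i%:Z) *: iter i g x.

Lemma eigenprojE j x : g (eigenproj j x) = eta R k ^ j%:Z *: eigenproj j x.
Proof.
case: ordg => k0 gk _; rewrite /eigenproj linearZ /= [RHS]scalerA mulrC -scalerA.
congr (_ *: _); rewrite linear_sum scaler_sumr.
pose F i : V := (eta R k ^+ j) ^ (1 - i%:Z) *: iter i g x.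
transitivity (\sum_(i < k) F i.+1).
  apply: eq_bigr => i _; rewrite linearZ /= /F; congr (_ ^ _ *: _); lia.
transitivity (\sum_(i < k) F i); last first.
  apply: eq_bigr => i _; rewrite scalerA /F expfzDr ?expf_neq0 ?eta_neq0 //.
case: k k0 gk @F => // k' _ gk F; rewrite big_ord_recr [RHS]big_ord_recl /= addrC.
congr (_ + _); rewrite /F gk /= subr0; congr (_ *: _).
have ek : (eta R k'.+1 ^+ j) ^ k'.+1%:Z = 1.
  by rewrite -exprnP -exprM mulnC exprM eta_expk // expr1n.
by rewrite expfzDr ?expf_neq0 ?eta_neq0 // -invr_expz ek invr1 mulr1.
Qed.

Lemma eigenproj_sum x : \sum_(j < k) eigenproj j x = x.
Proof.
case: ordg => k0 _ _; have kC : k%:R != 0 :> C by rewrite pnatr_eq0 -lt0n.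
rewrite -scaler_sumr exchange_big /=.
under eq_bigr => i _ do rewrite -scaler_suml sum_eta //.
rewrite (bigD1 (Ordinal k0)) //= oppr0 mod0z eqxx big1 ?addr0.
  by rewrite scalerA mulVf // scale1r.
move=> i ne; have i0 : (0 < i)%N.
  by rewrite lt0n; apply: contraNneq ne => i0; apply/eqP/val_inj.
case: eqP; rewrite ?scale0r // => /dvdz_mod0P; rewrite dvdzE abszN /=.
by move=> /(dvdn_leq i0); rewrite leqNgt ltn_ord.
Qed.

Lemma voa_ind (P : V -> Prop) : P 0 -> (forall x y, P x -> P y -> P (x + y)) ->
  (forall n (j : int) x, homog G n x -> g x = eta R k ^ j *: x -> P x) ->
  forall x, P x.
Proof.
move=> P0 PD Ph; apply: (grading_ind (G := G)) => // n x hx.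
rewrite -(eigenproj_sum x); apply: (big_ind P) => // j _.
apply: (Ph n j%:Z); last exact: eigenprojE.
by apply/homogZ/homog_sum => i; apply/homogZ/iter_aut_homog.
Qed.

End Automorphism.

End VertexAlgebra.

(** * The twisted Jacobi identity in components *)

Section Separation.
Variable R : realType.
Local Notation C := R[i].
Variables (I : choiceType) (M : lmodType C) (G : grading I M).

Definition spanning i d (b : 'I_d -> M) := (forall j, homog G i (b j)) /\
  forall v, homog G i v -> exists c : 'I_d -> C, v = \sum_j c j *: b j.

Lemma minimal_spanning i : homog_findim G i -> exists d (b : 'I_d -> M),
  spanning i b /\ forall c : 'I_d -> C, \sum_j c j *: b j = 0 -> forall j, c j = 0.
Proof.
move=> [d0 [b0 s0]].
have ex : exists d, `[< exists b : 'I_d -> M, spanning i b >].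
  by exists d0; apply/asboolP; exists b0.
case: (ex_minnP ex) => d /asboolP[b [hb sb]] mind; exists d, b; split => // c c0 j.
apply/eqP/negP => /negP cj; case: d b hb sb mind c c0 j cj => [|d] b hb sb mind c c0 j cj.
  by case: j cj.
have := mind d; rewrite ltnn => H; apply: notF; apply: H; apply/asboolP.
exists (fun t => b (lift j t)); split=> [t|v /sb[e ->]]; first exact: hb.
exists (fun t => e (lift j t) - e j * (c (lift j t) / c j)).
move: c0; rewrite (bigD1_ord j) //= => /eqP; rewrite addr_eq0 => /eqP c0.
have bj : b j = - (\sum_(t < d) (c (lift j t) / c j) *: b (lift j t)).
  apply: (scalerI cj); rewrite c0 scalerN scaler_sumr; congr (- _).
  by apply: eq_bigr => t _; rewrite scalerA mulrC divfK.
rewrite (bigD1_ord j) //= bj scalerN scaler_sumr addrC -sumrB.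
by apply: eq_bigr => t _; rewrite scalerBl scalerA.
Qed.

Lemma separation i x : homog_findim G i -> homog G i x -> x != 0 ->
  exists f : {scalar M}, (forall y, f (gproj G i y) = f y) /\ f x != 0.
Proof.
move=> /minimal_spanning[d [b [[hb sb] indep]]] hx x0.
have uniq_coord (c e : 'I_d -> C) :
    \sum_j c j *: b j = \sum_j e j *: b j -> c =1 e.
  move=> h j; apply/eqP; rewrite -subr_eq0; apply/eqP.
  apply: (indep (fun j => c j - e j)).
  by under eq_bigr => t _ do rewrite scalerBl; rewrite sumrB h subrr.
have coordP y := cid (sb _ (homog_gproj G i y)).
pose phi j (y : M) : C := sval (coordP y) j.
have phiE y : gproj G i y = \sum_j phi j y *: b j by exact: svalP (coordP y).
have lin j : linear_for *%R (phi j).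
  move=> a y z; apply: (uniq_coord (phi^~ (a *: y + z)) (fun j => a * phi j y + phi j z)).
  rewrite -phiE linearP /= !phiE scaler_sumr -big_split; apply: eq_bigr => t _.
  by rewrite scalerDl scalerA.
have idem j y : phi j (gproj G i y) = phi j y.
  apply: (uniq_coord (phi^~ (gproj G i y)) (phi^~ y)).
  by rewrite -!phiE gproj_orth eqxx.
have [j jx] : exists j, phi j x != 0.
  apply/existsP; apply: contraNT x0 => /existsPn h; rewrite -hx phiE big1 // => j _.
  by have := h j; rewrite negbK => /eqP->; rewrite scale0r.
pose f : {scalar M} := HB.pack (phi j) (GRing.isLinear.Build C M C *%R (phi j) (lin j)).
by exists f; split; [apply: idem|apply: jx].
Qed.

End Separation.

Section TwistedBorcherds.
Variables (R : realType) (V : voa R) (g : {linear V -> V}) (k : nat).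
Local Notation C := R[i].
Variables (W : lmodType C) (gW : grading C W).
Variable Yg : int -> {bilinear V -> W -> W}.
Local Notation YV := (voa_Y V).
Hypothesis autg : voa_automorphism g.
Hypothesis ordg : has_finite_order g k.
Hypothesis grading_pres : grading_preserving k gW Yg.
Hypothesis grading_restr : grading_restriction k gW.
Hypothesis monodromy : formal_monodromy g k Yg.
Hypothesis truncation : lower_truncation Yg.

Lemma k_gt0 : (0 < k)%N. Proof. by case: ordg. Qed.
Local Hint Resolve k_gt0 : core.

Lemma subDACA (M : zmodType) (a b c a' b' c' : M) :
  a + a' - (b + b') - (c + c') = (a - b - c) + (a' - b' - c').
Proof. by rewrite (opprD b) (addrACA a) (opprD c) (addrACA (a - b)). Qed.

Definition term12 u v w (n l1 l2 : int) (i : nat) : W :=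
  sbinc n%:~R i *: Yg (l1 + k%:Z * (n - i%:Z)) u (Yg (l2 + k%:Z * i%:Z) v w).
Definition term21 u v w (n l1 l2 : int) (i : nat) : W :=
  ((-1) ^ n * sbinc n%:~R i) *:
    Yg (l2 + k%:Z * (n - i%:Z)) v (Yg (l1 + k%:Z * i%:Z) u w).
Definition term_iter u v w (n l1 l2 : int) (i : nat) : W :=
  binc (l1%:~R / k%:R) i *: Yg (l1 + l2 - k%:Z * i%:Z) (YV (n + i%:Z) u v) w.

Definition evz (f : nat -> W) := exists K, forall i, (K <= i)%N -> f i = 0.

Lemma evz_finite f : evz f -> finite_set [set i | f i != 0].
Proof.
move=> [K h]; apply: (sub_finite_set _ (finite_II K)) => i /= /eqP hi.
by rewrite ltnNge; apply/negP => /h.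
Qed.

Lemma evz_term12 u v w n l1 l2 : evz (term12 u v w n l1 l2).
Proof.
have [N hN] := truncation v w; exists `|N - l2|%N => i hi.
have k0 := k_gt0; rewrite /term12 hN ?linear0r ?scaler0 //; nia.
Qed.

Lemma evz_term21 u v w n l1 l2 : evz (term21 u v w n l1 l2).
Proof.
have [N hN] := truncation u w; exists `|N - l1|%N => i hi.
have k0 := k_gt0; rewrite /term21 hN ?linear0r ?scaler0 //; nia.
Qed.

Lemma evz_term_iter u v w n l1 l2 : evz (term_iter u v w n l1 l2).
Proof.
have [N hN] := voa_truncation u v; exists `|N - n|%N => i hi.
by rewrite /term_iter hN ?linear0r ?linear0l ?scaler0 //; lia.
Qed.

Lemma fsum_scale c (f : nat -> W) : evz f ->
  \sum_(i \in [set: nat]) (c *: f i) = c *: \sum_(i \in [set: nat]) f i.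
Proof.
move=> [K h]; rewrite !(fsum_nat (K := K)) ?scaler_sumr //.
by move=> i /h->; rewrite scaler0.
Qed.

Lemma linear_fsum (f : {scalar W}) (F : nat -> W) : evz F ->
  f (\sum_(i \in [set: nat]) F i) = \sum_(i \in [set: nat]) (f (F i) : C).
Proof.
move=> [K h]; rewrite !(fsum_nat (K := K)) ?linear_sum //.
by move=> i /h->; rewrite linear0.
Qed.

Definition sum12 u v w n l1 l2 : W :=
  \sum_(i \in [set: nat]) term12 u v w n l1 l2 i.
Definition sum21 u v w n l1 l2 : W :=
  \sum_(i \in [set: nat]) term21 u v w n l1 l2 i.
Definition sum_iter u v w n l1 l2 : W :=
  \sum_(i \in [set: nat]) term_iter u v w n l1 l2 i.

(* The difference of the two sides of the twisted Jacobi identity at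
   [x0^(-n-1) x1^(-l1/k-1) x2^(-l2/k-1)]. *)
Definition tborch u v w n l1 l2 : W :=
  sum12 u v w n l1 l2 - sum21 u v w n l1 l2
  - k%:R^-1 *: \sum_(j < k) (eta R k ^+ j) ^ (- l1) *:
      sum_iter (iter j g u) v w n l1 l2.

Lemma jacobi_tborch : twisted_jacobi g k Yg <->
  forall u v w n l1 l2, tborch u v w n l1 l2 = 0.
Proof.
have eta0 j : eta R k ^+ j != 0 by rewrite expf_neq0 ?eta_neq0.
have etak j : (eta R k ^+ j) ^+ k = 1.
  by rewrite -exprM mulnC exprM eta_expk // expr1n.
have E u v w n l1 l2 : \sum_(j < k) fmul (delta_iter k (eta R k ^+ j))
      (iterate k YV Yg (iter j g u) v w)
      (k%:Z * (- n - 1), - l1 - k%:Z, - l2 - k%:Z) =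
    \sum_(j < k) (eta R k ^+ j) ^ (- l1) *:
      sum_iter (iter j g u) v w n l1 l2.
  apply: eq_bigr => j _; rewrite delta_iter_coef // /sum_iter -fsum_scale.
    by apply: eq_fsbigr => i _; rewrite /term_iter scalerA.
  exact: evz_term_iter.
split=> [H u v w n l1 l2|H u v w [[e0 x1] x2]].
  have := H u v w (k%:Z * (- n - 1), - l1 - k%:Z, - l2 - k%:Z).
  by rewrite delta12_coef // delta21_coef // E /tborch => ->; rewrite subrr.
have [[n en]|ne] := pselect (exists n, e0 = k%:Z * n); last first.
  have h n : e0 != k%:Z * n by apply/eqP => en; apply: ne; exists n.
  have [-> -> _] := delta_ndvd Yg YV k_gt0 u v w x1 x2 0 h.
  rewrite subr0 big1 ?scaler0 // => j _.
  by have [_ _ ->] := delta_ndvd Yg YV k_gt0 (iter j g u) v w x1 x2 (eta R k ^+ j) h.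
have -> : (e0, x1, x2) = (k%:Z * (- (- n - 1) - 1), - (- x1 - k%:Z) - k%:Z,
    - (- x2 - k%:Z) - k%:Z) :> expo by rewrite en; congr (_, _, _); ring.
rewrite delta12_coef // delta21_coef // E; apply/eqP; rewrite -subr_eq0; apply/eqP.
exact: H.
Qed.

Lemma sum12Du u u' v w n l1 l2 :
  sum12 (u + u') v w n l1 l2 = sum12 u v w n l1 l2 + sum12 u' v w n l1 l2.
Proof.
rewrite /sum12 -fsumD; try exact/evz_finite/evz_term12.
by apply: eq_fsbigr => i _; rewrite /term12 linearDl scalerDr.
Qed.

Lemma sum21Du u u' v w n l1 l2 :
  sum21 (u + u') v w n l1 l2 = sum21 u v w n l1 l2 + sum21 u' v w n l1 l2.
Proof.
rewrite /sum21 -fsumD; try exact/evz_finite/evz_term21.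
by apply: eq_fsbigr => i _; rewrite /term21 linearDl linearDr scalerDr.
Qed.

Lemma sum_iterDu u u' v w n l1 l2 :
  sum_iter (u + u') v w n l1 l2 = sum_iter u v w n l1 l2 + sum_iter u' v w n l1 l2.
Proof.
rewrite /sum_iter -fsumD; try exact/evz_finite/evz_term_iter.
by apply: eq_fsbigr => i _; rewrite /term_iter !linearDl scalerDr.
Qed.

Lemma sum12Dv u v v' w n l1 l2 :
  sum12 u (v + v') w n l1 l2 = sum12 u v w n l1 l2 + sum12 u v' w n l1 l2.
Proof.
rewrite /sum12 -fsumD; try exact/evz_finite/evz_term12.
by apply: eq_fsbigr => i _; rewrite /term12 linearDl linearDr scalerDr.
Qed.

Lemma sum21Dv u v v' w n l1 l2 :
  sum21 u (v + v') w n l1 l2 = sum21 u v w n l1 l2 + sum21 u v' w n l1 l2.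
Proof.
rewrite /sum21 -fsumD; try exact/evz_finite/evz_term21.
by apply: eq_fsbigr => i _; rewrite /term21 linearDl scalerDr.
Qed.

Lemma sum_iterDv u v v' w n l1 l2 :
  sum_iter u (v + v') w n l1 l2 = sum_iter u v w n l1 l2 + sum_iter u v' w n l1 l2.
Proof.
rewrite /sum_iter -fsumD; try exact/evz_finite/evz_term_iter.
by apply: eq_fsbigr => i _; rewrite /term_iter linearDr linearDl scalerDr.
Qed.

Lemma sum12Dw u v w w' n l1 l2 :
  sum12 u v (w + w') n l1 l2 = sum12 u v w n l1 l2 + sum12 u v w' n l1 l2.
Proof.
rewrite /sum12 -fsumD; try exact/evz_finite/evz_term12.
by apply: eq_fsbigr => i _; rewrite /term12 !linearDr scalerDr.
Qed.

Lemma sum21Dw u v w w' n l1 l2 :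
  sum21 u v (w + w') n l1 l2 = sum21 u v w n l1 l2 + sum21 u v w' n l1 l2.
Proof.
rewrite /sum21 -fsumD; try exact/evz_finite/evz_term21.
by apply: eq_fsbigr => i _; rewrite /term21 !linearDr scalerDr.
Qed.

Lemma sum_iterDw u v w w' n l1 l2 :
  sum_iter u v (w + w') n l1 l2 = sum_iter u v w n l1 l2 + sum_iter u v w' n l1 l2.
Proof.
rewrite /sum_iter -fsumD; try exact/evz_finite/evz_term_iter.
by apply: eq_fsbigr => i _; rewrite /term_iter linearDr scalerDr.
Qed.

Lemma tborchDu u u' v w n l1 l2 :
  tborch (u + u') v w n l1 l2 = tborch u v w n l1 l2 + tborch u' v w n l1 l2.
Proof.
have iterD j : iter j g (u + u') = iter j g u + iter j g u'.
  by elim: j => //= j ->; rewrite linearD.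
rewrite /tborch sum12Du sum21Du.
under eq_bigr => j _ do rewrite iterD sum_iterDu scalerDr.
by rewrite big_split /= scalerDr; apply: subDACA.
Qed.

Lemma tborchDv u v v' w n l1 l2 :
  tborch u (v + v') w n l1 l2 = tborch u v w n l1 l2 + tborch u v' w n l1 l2.
Proof.
rewrite /tborch sum12Dv sum21Dv.
under eq_bigr => j _ do rewrite sum_iterDv scalerDr.
by rewrite big_split /= scalerDr; apply: subDACA.
Qed.

Lemma tborchDw u v w w' n l1 l2 :
  tborch u v (w + w') n l1 l2 = tborch u v w n l1 l2 + tborch u v w' n l1 l2.
Proof.
rewrite /tborch sum12Dw sum21Dw.
under eq_bigr => j _ do rewrite sum_iterDw scalerDr.
by rewrite big_split /= scalerDr; apply: subDACA.
Qed.

Lemma sum_iterZ c u v w n l1 l2 :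
  sum_iter (c *: u) v w n l1 l2 = c *: sum_iter u v w n l1 l2.
Proof.
rewrite /sum_iter -fsum_scale; last exact: evz_term_iter.
apply: eq_fsbigr => i _; rewrite /term_iter !linearZl_LR /=.
by rewrite !scalerA mulrC.
Qed.

Lemma Yg_mod a u l w : g u = eta R k ^ a *: u -> ~~ (k%:Z %| l - a)%Z -> Yg l u w = 0.
Proof. by move=> ga h; apply: (monodromy ga); rewrite eqz_mod_dvd. Qed.

Lemma tborch_eigen a u v w n l1 l2 : g u = eta R k ^ a *: u ->
  tborch u v w n l1 l2 = if (k%:Z %| l1 - a)%Z then
    sum12 u v w n l1 l2 - sum21 u v w n l1 l2 - sum_iter u v w n l1 l2 else 0.
Proof.
move=> ga; have kC : k%:R != 0 :> C by rewrite pnatr_eq0 -lt0n k_gt0.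
have eta0 j : eta R k ^+ j != 0 by rewrite expf_neq0 ?eta_neq0.
have iterE j : iter j g u = (eta R k ^+ j) ^ a *: u.
  rewrite exprnP exprz_exp [j%:Z * a]mulrC -exprz_exp -exprnP.
  elim: j => [|j IH]; first by rewrite expr0 scale1r.
  by rewrite iterS IH linearZ /= ga scalerA exprSr.
rewrite /tborch; under eq_bigr => j _ do
  rewrite iterE sum_iterZ scalerA -expfzDr // .
rewrite -scaler_suml sum_eta ?k_gt0 //.
have -> : ((- l1 + a) %% k%:Z)%Z == 0 = (k%:Z %| l1 - a)%Z.
  rewrite -[l1 - a]opprK opprB [RHS]dvdzE abszN -dvdzE [- l1 + a]addrC.
  by apply/eqP/idP => /dvdz_mod0P.
case: ifPn => [_|nd]; first by rewrite scalerA mulVf ?scale1r.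
rewrite scale0r scaler0 subr0 /sum12 /sum21 !fsbig1 ?subrr // => i _.
  rewrite /term21 (Yg_mod _ ga) ?linear0r ?scaler0 //.
  by apply: contraNN nd => /dvdzP[q h]; apply/dvdzP; exists (q - i%:Z); lia.
rewrite /term12 (Yg_mod _ ga) ?scaler0 //.
by apply: contraNN nd => /dvdzP[q h]; apply/dvdzP; exists (q - (n - i%:Z)); lia.
Qed.

(* If [u] is in [V^a], only its modes in [a + kZ] act nontrivially; [L] is the
   total mode, which the weights of [u], [v], [w] and [f] determine. *)
Definition pP (f : {scalar W}) (L a : int) u v w (i : int) : C :=
  f (Yg (a - k%:Z * i) u (Yg (L - a + k%:Z * i) v w)).
Definition pQ (f : {scalar W}) (L a : int) u v w (i : int) : C :=
  f (Yg (L - a - k%:Z * i) v (Yg (a + k%:Z * i) u w)).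
Definition pR (f : {scalar W}) (L : int) u v w (m : int) : C :=
  f (Yg (L - k%:Z * m) (YV m u v) w).

Lemma vanish_pP f L a u v w : exists M, vanish_from M (pP f L a u v w).
Proof.
have [N hN] := truncation v w; exists (absz (N - L + a))%:Z => i hi.
have k0 := k_gt0; rewrite /pP hN ?linear0r ?linear0 //; nia.
Qed.

Lemma vanish_pQ f L a u v w : exists M, vanish_from M (pQ f L a u v w).
Proof.
have [N hN] := truncation u w; exists (absz (N - a))%:Z => i hi.
have k0 := k_gt0; rewrite /pQ hN ?linear0r ?linear0 //; nia.
Qed.

Lemma vanish_pR f L u v w : exists M, vanish_from M (pR f L u v w).
Proof.
have [N hN] := voa_truncation u v; exists N => i hi.
by rewrite /pR hN ?linear0l ?linear0.
Qed.

Lemma pairing_borcherds (f : {scalar W}) (a : int) u v w (n j l2 : int)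
    (L := a + k%:Z * j + l2 + k%:Z * n) :
  f (sum12 u v w n (a + k%:Z * j) l2 - sum21 u v w n (a + k%:Z * j) l2
     - sum_iter u v w n (a + k%:Z * j) l2) =
  tsum (sbinc n%:~R) (pP f L a u v w) (- n - j)
  - (-1) ^ n * tsum (sbinc n%:~R) (pQ f L a u v w) j
  - tsum (binc (a%:~R / k%:R + j%:~R)) (pR f L u v w) n.
Proof.
have kC : k%:R != 0 :> C by rewrite pnatr_eq0 -lt0n k_gt0.
rewrite !linearB /= /sum12 /sum21 /sum_iter.
rewrite (linear_fsum _ (evz_term12 _ _ _ _ _ _)).
rewrite (linear_fsum _ (evz_term21 _ _ _ _ _ _)).
rewrite (linear_fsum _ (evz_term_iter _ _ _ _ _ _)).
rewrite [(-1) ^ n * _]mulr_fsumr.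
congr (_ - _ - _); apply: eq_fsbigr => i _.
- rewrite /term12 linearZ /=; congr (_ * f (Yg _ u (Yg _ v w))); rewrite /L; ring.
- rewrite /term21 linearZ /= -mulrA; congr (_ * (_ * f (Yg _ v (Yg _ u w)))); rewrite /L; ring.
rewrite /term_iter linearZ /=; congr (_ * f (Yg _ _ w)); last by rewrite /L; ring.
by congr binc; rewrite intrD intrM -pmulrn; field.
Qed.

Lemma jacobi_borcherds (f : {scalar W}) (L a : int) u v w : twisted_jacobi g k Yg ->
  g u = eta R k ^ a *: u ->
  borcherds (a%:~R / k%:R) (pP f L a u v w) (pQ f L a u v w) (pR f L u v w).
Proof.
move=> /jacobi_tborch H ga n j; apply/eqP; rewrite -subr_eq0; apply/eqP.
have := H u v w n (a + k%:Z * j) (L - (a + k%:Z * j) - k%:Z * n).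
rewrite (tborch_eigen _ _ _ _ _ ga) addrC addKr dvdz_mulr ?dvdzz // => /(congr1 f).
rewrite linear0 pairing_borcherds.
by rewrite (_ : a + k%:Z * j + _ + _ = L) //; ring.
Qed.

(* The weight of [Yg l u (Yg (L - l) v w)]. *)
Definition wt (mu mv : int) (h : C) (L : int) : C :=
  h + mu%:~R + mv%:~R - L%:~R / k%:R - 2.

Lemma homog_Yg m l h v w n : homog (voa_gr V) m v -> homog gW h w ->
  n = h + m%:~R - l%:~R / k%:R - 1 -> homog gW n (Yg l v w).
Proof. by move=> hv hw ->; apply: grading_pres. Qed.

Lemma borcherds_jacobi :
  (forall (a mu mv : int) (h : C) u v w, homog (voa_gr V) mu u ->
     g u = eta R k ^ a *: u -> homog (voa_gr V) mv v -> homog gW h w ->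
     forall L (f : {scalar W}),
       (forall y, f (gproj gW (wt mu mv h L) y) = f y) ->
       borcherds (a%:~R / k%:R) (pP f L a u v w) (pQ f L a u v w) (pR f L u v w)) ->
  twisted_jacobi g k Yg.
Proof.
move=> H; apply/jacobi_tborch => u v w n l1 l2.
have add0 (x : W) : x = x + x -> x = 0.
  by move/eqP; rewrite -subr_eq0 opprD addrA subrr sub0r oppr_eq0 => /eqP.
have T0w u' v' : tborch u' v' 0 n l1 l2 = 0.
  by apply: add0; rewrite -tborchDw addr0.
have T0v u' w' : tborch u' 0 w' n l1 l2 = 0.
  by apply: add0; rewrite -tborchDv addr0.
have T0u v' w' : tborch 0 v' w' n l1 l2 = 0.
  by apply: add0; rewrite -tborchDu addr0.
move: u; apply: (voa_ind autg ordg) => //.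
  by move=> x y hx hy; rewrite tborchDu hx hy addr0.
move=> mu a u hu ga; move: v; apply: (grading_ind (G := voa_gr V)) => //.
  by move=> x y hx hy; rewrite tborchDv hx hy addr0.
move=> mv v hv; move: w; apply: (grading_ind (G := gW)) => //.
  by move=> x y hx hy; rewrite tborchDw hx hy addr0.
move=> h w hw; rewrite (tborch_eigen _ _ _ _ _ ga).
case: ifP => // /dvdzP[j ej].
have -> : l1 = a + k%:Z * j by lia.
pose L := a + k%:Z * j + l2 + k%:Z * n; set x := _ - _ - _.
have kC : k%:R != 0 :> C by rewrite pnatr_eq0 -lt0n k_gt0.
have hx : homog gW (wt mu mv h L) x.
  have hfs (F : nat -> W) : (forall i, homog gW (wt mu mv h L) (F i)) ->
      homog gW (wt mu mv h L) (\sum_(i \in [set: nat]) F i).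
    by move=> hF; apply: homog_sum.
  rewrite /x; apply: homogD; first apply: homogD.
  - apply: hfs => i; apply: homogZ; apply: (homog_Yg hu (homog_Yg hv hw erefl)).
    by rewrite /wt /L !(intrD, intrM, intrB) -!pmulrn; field.
  - rewrite -scaleN1r; apply: homogZ; apply: hfs => i; apply: homogZ.
    apply: (homog_Yg hv (homog_Yg hu hw erefl)).
    by rewrite /wt /L !(intrD, intrM, intrB) -!pmulrn; field.
  rewrite -scaleN1r; apply: homogZ; apply: hfs => i; apply: homogZ.
  apply: (homog_Yg (Y_homog _ hu hv) hw).
  by rewrite /wt /L !(intrD, intrM, intrB) -!pmulrn; field.
apply/eqP/negP => /negP x0.
have [f [hf]] := separation (proj1 (grading_restr _)) hx x0.
rewrite /x pairing_borcherds -/L subr_eq0 => /eqP; apply.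
exact: (H a mu mv h u v w hu ga hv hw L f hf).
Qed.

End TwistedBorcherds.

(** * The three matrix coefficients *)

Section Families.
Variables (R : realType) (V : voa R) (g : {linear V -> V}) (k : nat).
Local Notation C := R[i].
Variables (W : lmodType C) (gW : grading C W).
Variable Yg : int -> {bilinear V -> W -> W}.
Local Notation YV := (voa_Y V).
Local Notation GV := (voa_gr V).
Local Notation Ygp := (Ygp k gW Yg).
Hypothesis ordg : has_finite_order g k.
Hypothesis grading_pres : grading_preserving k gW Yg.
Hypothesis monodromy : formal_monodromy g k Yg.

Definition bpow (p : int) (z x : C) : C := cexp (x * lbranch p z).

Definition fam12 p u v w (f : {scalar W}) z1 z2 (n : C) : C :=
  pairing f (Ygp p u z1 (Ygp p v z2 w n)).
Definition fam_iter p u v w (f : {scalar W}) z1 z2 (n : int) : C :=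
  pairing f (Ygp p (Ycomp u (z1 - z2) v n) z2 w).

Let k0 : (0 < k)%N := k_gt0 ordg.

Lemma kC : k%:R != 0 :> C. Proof. by rewrite pnatr_eq0 -lt0n. Qed.

Lemma wt_inj (h : C) (l l' : int) :
  h - l%:~R / k%:R = h - l'%:~R / k%:R -> l = l'.
Proof.
by move/addrI/oppr_inj/(mulIf (invr_neq0 kC))/eqP; rewrite eqr_int => /eqP.
Qed.

Lemma homog_Ygp p v z w n : homog gW n (Ygp p v z w n).
Proof. by apply: homog_sum => l; apply: homogZ; apply: homog_gproj. Qed.

Lemma Ygp_homog p m h v z w l n : homog GV m v -> homog gW h w ->
  n = h + m%:~R - l%:~R / k%:R - 1 ->
  Ygp p v z w n = bpow p z (- (l%:~R / k%:R) - 1) *: Yg l v w.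
Proof.
move=> hv hw ->; rewrite /Defs.Ygp (fsum1 (t := l)).
  by rewrite (gproj_homog _ (grading_pres l hv hw)) eqxx.
move=> l' ne; rewrite (gproj_homog _ (grading_pres l' hv hw)).
case: eqP => [e|_]; last by rewrite scaler0.
by case/eqP: ne; apply: (@wt_inj (h + m%:~R)) => //; move/addIr: e.
Qed.

Lemma Ygp_homog0 p m h v z w n : homog GV m v -> homog gW h w ->
  (forall l : int, n <> h + m%:~R - l%:~R / k%:R - 1) -> Ygp p v z w n = 0.
Proof.
move=> hv hw ne; apply: fsbig1 => l _.
rewrite (gproj_homog _ (grading_pres l hv hw)).
by case: eqP => [/ne//|]; rewrite scaler0.
Qed.

Lemma pairing_homog (f : {scalar W}) mu F : (forall y, f (gproj gW mu y) = f y) ->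
  (forall n, homog gW n (F n)) -> pairing f F = f (F mu).
Proof.
move=> hf hF; apply: fsum1 => n ne.
by rewrite -hf (gproj_homog _ (hF n)) eq_sym (negbTE ne) linear0.
Qed.

Lemma Ycomp_homog u v z mu mv (m : int) : homog GV mu u -> homog GV mv v ->
  Ycomp u z v (mu + mv - m - 1) = z ^ (- m - 1) *: YV m u v.
Proof.
move=> hu hv; rewrite /Ycomp (fsum1 (t := m)).
  by rewrite (gproj_homog _ (Y_homog _ hu hv)) eqxx.
move=> l ne; rewrite (gproj_homog _ (Y_homog _ hu hv)).
by case: eqP => [e|_]; [case/eqP: ne; lia|rewrite scaler0].
Qed.

Section Homogeneous.
Variables (mu mv : int) (h : C) (u v : V) (w : W) (wgt : C) (f : {scalar W}).
Hypothesis hu : homog GV mu u.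
Hypothesis hv : homog GV mv v.
Hypothesis hw : homog gW h w.
Hypothesis hf : forall y, f (gproj gW wgt y) = f y.

Lemma fam12E p z1 z2 (L : int) : wgt = wt k mu mv h L -> forall l : int,
  fam12 p u v w f z1 z2 (h + mv%:~R - l%:~R / k%:R - 1) =
  f (Yg (L - l) u (Yg l v w)) *
    (bpow p z1 (- ((L - l)%:~R / k%:R) - 1) * bpow p z2 (- (l%:~R / k%:R) - 1)).
Proof.
move=> eL l; rewrite /fam12 (pairing_homog hf); last by move=> n; apply: homog_Ygp.
have hvw := grading_pres l hv hw.
rewrite (Ygp_homog _ _ hv hw erefl) (Ygp_homog (l := L - l) _ _ hu (homogZ _ hvw)).
  by rewrite linearZr_LR /= !linearZ /=; ring.
by rewrite eL /wt intrB; field; exact: kC.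
Qed.

Lemma fam12_out p z1 z2 n :
  (forall l : int, n <> h + mv%:~R - l%:~R / k%:R - 1) -> fam12 p u v w f z1 z2 n = 0.
Proof.
move=> hn; rewrite /fam12 (pairing_homog hf); last by move=> ?; apply: homog_Ygp.
rewrite (Ygp_homog0 _ _ hv hw hn) /Defs.Ygp fsbig1 ?linear0 // => l _.
by rewrite linear0r linear0 scaler0.
Qed.

Lemma fam12_sums p z1 z2 (L : int) S : wgt = wt k mu mv h L ->
  sums (fam12 p u v w f z1 z2) S <->
  sums (fun l : int => f (Yg (L - l) u (Yg l v w)) *
    (bpow p z1 (- ((L - l)%:~R / k%:R) - 1) * bpow p z2 (- (l%:~R / k%:R) - 1))) S.
Proof.
move=> eL; pose phi (l : int) : C := h + mv%:~R - l%:~R / k%:R - 1.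
have phi_inj : injective phi.
  by move=> l l' /addIr e; apply: (@wt_inj (h + mv%:~R)).
have -> : (fun l : int => f (Yg (L - l) u (Yg l v w)) *
    (bpow p z1 (- ((L - l)%:~R / k%:R) - 1) * bpow p z2 (- (l%:~R / k%:R) - 1))) =
    fam12 p u v w f z1 z2 \o phi.
  by apply/funext => l; rewrite /= (fam12E _ _ _ eL).
apply: iff_sym; apply: sums_inj => //.
by move=> n hn; apply: fam12_out => l e; have := hn l; rewrite /phi -e eqxx.
Qed.

Lemma fam12_noL p z1 z2 n : (forall L : int, wgt <> wt k mu mv h L) ->
  fam12 p u v w f z1 z2 n = 0.
Proof.
move=> noL.
have [[l ->]|ne] := pselect (exists l : int, n = h + mv%:~R - l%:~R / k%:R - 1); last first.
  by apply: fam12_out => l e; apply: ne; exists l.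
rewrite /fam12 (pairing_homog hf); last by move=> ?; apply: homog_Ygp.
rewrite (Ygp_homog _ _ hv hw erefl) (Ygp_homog0 _ _ hu (homogZ _ (grading_pres l hv hw))).
  by rewrite linear0.
move=> l' e; apply: (noL (l + l')); rewrite e /wt intrD; field; exact: kC.
Qed.

Lemma fam_iterE p z1 z2 (L : int) : wgt = wt k mu mv h L -> forall m : int,
  fam_iter p u v w f z1 z2 (mu + mv - m - 1) =
  pR k Yg f L u v w m *
    ((z1 - z2) ^ (- m - 1) * bpow p z2 (- (L%:~R / k%:R) + m%:~R - 1)).
Proof.
move=> eL m; rewrite /fam_iter (pairing_homog hf); last by move=> n; apply: homog_Ygp.
rewrite (Ycomp_homog _ _ hu hv).
rewrite (Ygp_homog (l := L - k%:Z * m) _ _ (homogZ _ (Y_homog _ hu hv)) hw).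
  rewrite linearZl_LR /= scalerA [f _]linearZ /= /pR.
  have -> : - ((L - k%:Z * m)%:~R / k%:R) - 1 = - (L%:~R / k%:R) + m%:~R - 1 :> C.
    by rewrite intrB intrM -pmulrn; field; exact: kC.
  by ring.
by rewrite eL /wt !(intrB, intrD, intrM) -!pmulrn; field; exact: kC.
Qed.

Lemma fam_iter_sums p z1 z2 (L : int) : wgt = wt k mu mv h L ->
  let F := fun m : int => pR k Yg f L u v w m *
    ((z1 - z2) ^ (- m - 1) * bpow p z2 (- (L%:~R / k%:R) + m%:~R - 1)) in
  (abs_summable (fam_iter p u v w f z1 z2) <-> abs_summable F) /\
  forall S, has_sum (fam_iter p u v w f z1 z2) S <-> has_sum F S.
Proof.
move=> eL F; pose phi (m : int) : int := mu + mv - m - 1.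
have phi_inj : injective phi by move=> m m'; rewrite /phi; lia.
have out n : (forall m, phi m != n) -> fam_iter p u v w f z1 z2 n = 0.
  by move=> /(_ (mu + mv - n - 1))/eqP; rewrite /phi; lia.
have -> : F = fam_iter p u v w f z1 z2 \o phi.
  by apply/funext => m; rewrite /= (fam_iterE _ _ _ eL).
by split=> [|S]; [rewrite (abs_summable_inj phi_inj out)|rewrite (has_sum_inj phi_inj out)].
Qed.

Lemma fam_iter_noL p z1 z2 n : (forall L : int, wgt <> wt k mu mv h L) ->
  fam_iter p u v w f z1 z2 n = 0.
Proof.
move=> noL; rewrite /fam_iter (pairing_homog hf); last by move=> ?; apply: homog_Ygp.
have -> : n = mu + mv - (mu + mv - n - 1) - 1 by lia.
rewrite (Ycomp_homog _ _ hu hv).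
rewrite (Ygp_homog0 _ _ (homogZ _ (Y_homog _ hu hv)) hw) ?linear0 // => l e.
set m := mu + mv - n - 1 in e.
apply: (noL (l + k%:Z * m)); rewrite e /wt !(intrB, intrD, intrM) -!pmulrn.
by field; exact: kC.
Qed.

End Homogeneous.

Section Eigen.
Variables (mu mv : int) (h : C) (a L : int) (u v : V) (w : W) (f : {scalar W}).
Hypothesis hu : homog GV mu u.
Hypothesis ga : g u = eta R k ^ a *: u.
Hypothesis hv : homog GV mv v.
Hypothesis hw : homog gW h w.
Hypothesis hf : forall y, f (gproj gW (wt k mu mv h L) y) = f y.
Local Notation al := (a%:~R / k%:R : C).
Local Notation be := ((L - a)%:~R / k%:R : C).

Lemma fam12_P p z1 z2 S : sums (fam12 p u v w f z1 z2) S <->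
  sums (fun i : int => pP k Yg f L a u v w i *
    (bpow p z1 (- al + i%:~R - 1) * bpow p z2 (- be - i%:~R - 1))) S.
Proof.
rewrite (fam12_sums hu hv hw hf _ _ _ _ erefl).
pose phi (i : int) : int := L - a + k%:Z * i.
have kz : k%:Z != 0 by lia.
have phi_inj : injective phi by move=> i j; rewrite /phi => /addrI/(mulfI kz).
rewrite -(@sums_inj _ _ _ phi _ phi_inj).
  rewrite (_ : _ \o phi = fun i : int => pP k Yg f L a u v w i *
    (bpow p z1 (- al + i%:~R - 1) * bpow p z2 (- be - i%:~R - 1))) //.
  apply/funext => i; rewrite /= /phi /pP; congr (f (Yg _ u _) * (bpow p z1 _ * bpow p z2 _)).
  - by ring.
  - by rewrite !(intrB, intrD, intrM) -!pmulrn; field; exact: kC.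
  by rewrite !(intrB, intrD, intrM) -!pmulrn; field; exact: kC.
move=> l hl; rewrite (Yg_mod monodromy _ ga) ?linear0 ?mul0r //.
apply/negP => /dvdzP[q e]; have := hl (- q); rewrite /phi => /eqP; apply; lia.
Qed.

Lemma wtC : wt k mv mu h L = wt k mu mv h L.
Proof. by rewrite /wt [h + mv%:~R + _]addrAC. Qed.

Lemma fam12_Q p z1 z2 S : sums (fam12 p v u w f z2 z1) S <->
  sums (fun i : int => pQ k Yg f L a u v w i *
    (bpow p z1 (- al - i%:~R - 1) * bpow p z2 (- be + i%:~R - 1))) S.
Proof.
rewrite (fam12_sums hv hu hw hf _ _ _ _ (esym wtC)).
pose phi (i : int) : int := a + k%:Z * i.
have kz : k%:Z != 0 by lia.
have phi_inj : injective phi by move=> i j; rewrite /phi => /addrI/(mulfI kz).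
rewrite -(@sums_inj _ _ _ phi _ phi_inj).
  rewrite (_ : _ \o phi = fun i : int => pQ k Yg f L a u v w i *
    (bpow p z1 (- al - i%:~R - 1) * bpow p z2 (- be + i%:~R - 1))) //.
  apply/funext => i; rewrite /= /phi /pQ [bpow p z1 _ * _]mulrC.
  congr (f (Yg _ v _) * (bpow p z2 _ * bpow p z1 _)).
  - by ring.
  - by rewrite !(intrB, intrD, intrM) -!pmulrn; field; exact: kC.
  by rewrite !(intrB, intrD, intrM) -!pmulrn; field; exact: kC.
move=> l hl; rewrite (Yg_mod monodromy _ ga) ?linear0r ?linear0 ?mul0r //.
apply/negP => /dvdzP[q e]; have := hl q; rewrite /phi => /eqP; apply; lia.
Qed.

End Eigen.

End Families.

Section Branches.
Variable R : realType.
Local Notation C := R[i].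
Implicit Types (x y z : C) (p : int).

Lemma bpowD p z x y : bpow p z (x + y) = bpow p z x * bpow p z y.
Proof. by rewrite /bpow mulrDl cexpD. Qed.

Lemma bpow_int p z (m : int) : z != 0 -> bpow p z m%:~R = z ^ m.
Proof. by move=> z0; rewrite /bpow cexpMz cexp_lbranch. Qed.

Lemma bpowDz p z x (m : int) : z != 0 -> bpow p z (x + m%:~R) = bpow p z x * z ^ m.
Proof. by move=> z0; rewrite bpowD bpow_int. Qed.

Lemma bpow_neq0 p z x : bpow p z x != 0.
Proof. exact: cexp_neq0. Qed.

Lemma nm_gt0 z : (0 < nm z) = (z != 0).
Proof. by rewrite lt_def nm_eq0 nm_ge0 andbT. Qed.

Lemma bser_opp_nat N (q : C) : nm q < 1 -> bser (- N%:R) q ((1 + q)^-1 ^+ N).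
Proof.
by move=> q1; have := bser_expn N (bser_inv q1); rewrite mulNrn.
Qed.

Section Monomials.
Variables (p : int) (z1 z2 al be : C) (N : nat) (s : int).

Definition valf : C :=
  bpow p z1 (- al + N%:R - 2 - s%:~R) * bpow p z2 (- be + s%:~R) * (z1 - z2) ^- N.

Lemma sums_monoP : 0 < nm z2 < nm z1 ->
  sums (fun i : int => monoP R N s i *
    (bpow p z1 (- al + i%:~R - 1) * bpow p z2 (- be - i%:~R - 1))) valf.
Proof.
move=> /andP[n2 n21]; have n1 := lt_trans n2 n21.
have z10 : z1 != 0 by rewrite -nm_gt0.
have z20 : z2 != 0 by rewrite -nm_gt0.
have z12 : z1 - z2 != 0.
  by apply: contraTneq n21 => /eqP; rewrite subr_eq0 => /eqP->; rewrite ltxx.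
pose phi (t : nat) : int := -1 - s - t%:Z.
have phi_inj : injective phi by move=> t t'; rewrite /phi; lia.
apply/(@sums_inj _ _ _ phi _ phi_inj).
  move=> i hi; rewrite /monoP; case et : (-1 - s - i) => [t|t] /=; last by rewrite mul0r.
  by have /eqP := hi t; rewrite /phi; lia.
pose K := bpow p z1 (- al + (- 2 - s)%:~R) * bpow p z2 (- be + s%:~R).
have q1 : nm (- (z2 / z1)) < 1 by rewrite nmN nmM nmV ltr_pdivrMr // mul1r.
have := sumsZ K (bser_opp_nat N q1); apply: eq_sums => [t|].
  rewrite /= /monoP /phi (_ : -1 - s - (-1 - s - t%:Z) = t); last by lia.
  have -> : - al + (-1 - s - t%:Z)%:~R - 1 = - al + (- 2 - s)%:~R + (- t%:Z)%:~R :> C.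
    by rewrite !(intrB, intrD, intrN) -!pmulrn; ring.
  have -> : - be - (-1 - s - t%:Z)%:~R - 1 = - be + s%:~R + t%:Z%:~R :> C.
    by rewrite !(intrB, intrD, intrN) -!pmulrn; ring.
  rewrite ![bpow _ _ (_ + _ + _)]bpowDz // /K -exprnN exprNn exprMn exprVn -exprnP.
  by rewrite /=; ring.
have -> : 1 + - (z2 / z1) = (z1 - z2) / z1 by rewrite mulrBl divff.
rewrite invf_div expr_div_n /valf /K.
have -> : - al + N%:R - 2 - s%:~R = - al + (- 2 - s)%:~R + N%:Z%:~R :> C.
  by rewrite !(intrB, intrD, intrN) -!pmulrn; ring.
by rewrite [bpow _ z1 (_ + _ + _)]bpowDz // -exprnP; ring.
Qed.

Lemma sums_monoQ : 0 < nm z1 < nm z2 ->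
  sums (fun i : int => monoQ R N s i *
    (bpow p z1 (- al - i%:~R - 1) * bpow p z2 (- be + i%:~R - 1))) valf.
Proof.
move=> /andP[n1 n12]; have n2 := lt_trans n1 n12.
have z10 : z1 != 0 by rewrite -nm_gt0.
have z20 : z2 != 0 by rewrite -nm_gt0.
have z12 : z1 - z2 != 0.
  by apply: contraTneq n12 => /eqP; rewrite subr_eq0 => /eqP->; rewrite ltxx.
pose phi (t : nat) : int := s + 1 - N%:Z - t%:Z.
have phi_inj : injective phi by move=> t t'; rewrite /phi; lia.
apply/(@sums_inj _ _ _ phi _ phi_inj).
  move=> i hi; rewrite /monoQ.
  case et : (s + 1 - N%:Z - i) => [t|t] /=; last by rewrite mulr0 mul0r.
  by have /eqP := hi t; rewrite /phi; lia.
pose K := (-1) ^+ N * bpow p z1 (- al + N%:R - 2 - s%:~R) *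
  bpow p z2 (- be + (s - N%:Z)%:~R).
have q1 : nm (- (z1 / z2)) < 1 by rewrite nmN nmM nmV ltr_pdivrMr // mul1r.
have := sumsZ K (bser_opp_nat N q1); apply: eq_sums => [t|].
  rewrite /= /monoQ /phi (_ : s + 1 - N%:Z - (s + 1 - N%:Z - t%:Z) = t); last by lia.
  have -> : - al - (s + 1 - N%:Z - t%:Z)%:~R - 1 = - al + N%:R - 2 - s%:~R + t%:Z%:~R :> C.
    by rewrite !(intrB, intrD, intrN) -!pmulrn; ring.
  have -> : - be + (s + 1 - N%:Z - t%:Z)%:~R - 1 = - be + (s - N%:Z)%:~R + (- t%:Z)%:~R :> C.
    by rewrite !(intrB, intrD, intrN) -!pmulrn; ring.
  rewrite [bpow _ z1 (_ + t%:Z%:~R)]bpowDz // [bpow _ z2 (_ + (- t%:Z)%:~R)]bpowDz //.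
  by rewrite /K -exprnN [(- _) ^+ t]exprNn exprMn exprVn -exprnP /=; ring.
have -> : 1 + - (z1 / z2) = - (z1 - z2) / z2 by rewrite opprB mulrBl divff.
rewrite invf_div expr_div_n /valf /K.
have -> : - be + s%:~R = - be + (s - N%:Z)%:~R + N%:Z%:~R :> C.
  by rewrite !(intrB, intrD, intrN) -!pmulrn; ring.
rewrite [bpow _ z2 (_ + N%:Z%:~R)]bpowDz // -exprnP [(- (z1 - z2)) ^+ N]exprNn.
rewrite invfM invr_sign.
have e : (-1) ^+ N * (-1) ^+ N = 1 :> C by rewrite -expr2 sqrr_sign.
by rewrite -[RHS]mul1r -[X in _ = X * _]e; move: ((-1) ^+ N) => m1; ring.
Qed.

Lemma abs_summable_bser (k : nat) (r : int) (q : C) : (0 < k)%N -> nm q < 1 ->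
  exists S, bser (r%:~R / k%:R) q S.
Proof.
move=> kp q1; have [|F hF _] := @bser_frac R k%:R^-1 q _ q1.
  by rewrite invr_ge0 ler0n /= invf_le1 ?ltr0n // ler1n.
have kV : k%:R^-1 = (k%:R^-1 : R)%:C :> C by rewrite fmorphV /= rmorph_nat.
rewrite -kV in hF; exists (F ^ r); apply: bser_expz => //.
by exists k => //; rewrite -[LHS]mulr_natr mulVf // pnatr_eq0 -lt0n.
Qed.

Lemma sums_monoR (k : nat) (r : int) : (0 < k)%N ->
  - al + N%:R - 2 - s%:~R = r%:~R / k%:R ->
  0 < nm (z1 - z2) < nm z2 ->
  let F := fun m : int => monoR al N s m *
    ((z1 - z2) ^ (- m - 1) * bpow p z2 (- (al + be) + m%:~R - 1)) in
  abs_summable F /\ (`|carg z1 - carg z2| < pi / 2 -> has_sum F valf).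
Proof.
move=> kp er /andP[n0 n02] F; have n2 := lt_trans n0 n02.
have z00 : z1 - z2 != 0 by rewrite -nm_gt0.
have z20 : z2 != 0 by rewrite -nm_gt0.
pose phi (t : nat) : int := N%:Z - 1 - t%:Z.
have phi_inj : injective phi by move=> t t'; rewrite /phi; lia.
have out i : (forall t, phi t != i) -> F i = 0.
  move=> hi; rewrite /F /monoR.
  case et : (N%:Z - 1 - i) => [t|t] /=; last by rewrite mul0r.
  by have /eqP := hi t; rewrite /phi; lia.
pose q := (z1 - z2) / z2.
have q1 : nm q < 1 by rewrite nmM nmV ltr_pdivrMr // mul1r.
pose K := (z1 - z2) ^- N * bpow p z2 (- (al + be) + (N%:Z - 2)%:~R).
have FE t : (F \o phi) t = K * (binc (r%:~R / k%:R) t * q ^+ t).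
  rewrite /= /F /monoR /phi (_ : N%:Z - 1 - (N%:Z - 1 - t%:Z) = t); last by lia.
  rewrite /= er (_ : - (N%:Z - 1 - t%:Z) - 1 = - N%:Z + t%:Z); last by lia.
  have -> : - (al + be) + (N%:Z - 1 - t%:Z)%:~R - 1 =
      - (al + be) + (N%:Z - 2)%:~R + (- t%:Z)%:~R :> C.
    by rewrite !(intrB, intrD, intrN) -!pmulrn; ring.
  rewrite [bpow _ z2 (_ + (- t%:Z)%:~R)]bpowDz // expfzDr // -!exprnN -exprnP.
  by rewrite /K /q expr_div_n; ring.
have sumsF S : bser (r%:~R / k%:R) q S -> sums F (K * S).
  by move=> h; apply/(sums_inj phi_inj out); rewrite (funext FE); apply: sumsZ.
split; first by have [S /sumsF[]] := abs_summable_bser r kp q1.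
move=> harg; have := bser_branch p r kp _ harg; rewrite n0 n02 => /(_ isT)/sumsF[_].
rewrite -!/(bpow _ _ _) -er; congr has_sum.
rewrite /K /valf.
have -> : - (al + be) + (N%:Z - 2)%:~R = (- al + N%:R - 2 - s%:~R) + (- be + s%:~R) :> C.
  by rewrite !(intrB, intrD, intrN) -!pmulrn; ring.
by rewrite [bpow p z2 (_ + (- be + _))]bpowD; field; rewrite ?bpow_neq0 ?expf_neq0.
Qed.

End Monomials.

Section Lists.
Variable k : nat.
Hypothesis k0 : (0 < k)%N.

Let kC : k%:R != 0 :> C. Proof. by rewrite pnatr_eq0 -lt0n. Qed.

(* A finite list of triples [(r, s, c)] encodes the multivalued function
   [\sum c z1^(r/k) z2^(s/k) (z1 - z2)^-N]. *)
Definition lnum (T : seq (int * int * C)) p z1 z2 : C :=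
  \sum_(t <- T) t.2 * bpow p z1 (t.1.1%:~R / k%:R) * bpow p z2 (t.1.2%:~R / k%:R).
Definition lfun (N : nat) T p z1 z2 : C := lnum T p z1 z2 * (z1 - z2) ^- N.

Definition zrange (N1 N2 : int) : seq int :=
  [seq N1 + i%:Z | i <- iota 0 (if N1 <= N2 then `|N2 - N1|.+1 else 0)].

Lemma mem_zrange N1 N2 i : (i \in zrange N1 N2) = (N1 <= i <= N2).
Proof.
apply/mapP/idP => [[t]|h].
  by rewrite mem_iota add0n /= => h ->; move: h; case: ifP => //; lia.
exists (absz (i - N1)); last by lia.
by rewrite mem_iota add0n /=; case: ifP; lia.
Qed.

Lemma zrange_uniq N1 N2 : uniq (zrange N1 N2).
Proof. by rewrite map_inj_uniq ?iota_uniq // => i j; lia. Qed.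

Lemma fsum_zrange (N1 N2 : int) (F : int -> C) :
  \sum_(r \in [set r : int | N1 <= r <= N2]) F r = \sum_(r <- zrange N1 N2) F r.
Proof.
rewrite [RHS]fsbig_seq ?zrange_uniq //; apply: eq_fsbigl.
by apply/seteqP; split=> x /=; rewrite mem_zrange.
Qed.

Lemma fbranch_lfun N1 N2 N a : exists T, forall p z1 z2,
  fbranch k N1 N2 N a p z1 z2 = lfun N T p z1 z2.
Proof.
exists [seq (r, s, a r s) | r <- zrange N1 N2, s <- zrange N1 N2] => p z1 z2.
rewrite /fbranch /lfun /lnum fsum_zrange big_allpairs_dep /= mulr_suml.
apply: eq_bigr => r _; rewrite fsum_zrange mulr_suml; apply: eq_bigr => s _.
by [].
Qed.

Lemma lfun_fbranch N T : exists N1 N2 a, forall p z1 z2,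
  fbranch k N1 N2 N a p z1 z2 = lfun N T p z1 z2.
Proof.
have [B hB] : exists B : nat, forall t, t \in T -> (`|t.1.1| <= B)%N /\ (`|t.1.2| <= B)%N.
  elim: (T) => [|t T' [B hB]]; first by exists 0%N.
  exists (maxn B (maxn `|t.1.1| `|t.1.2|)) => t'; rewrite inE => /orP[/eqP->|/hB[e1 e2]].
    by rewrite !leq_max !leqnn !orbT.
  by rewrite !leq_max e1 e2.
exists (- B%:Z), B%:Z, (fun r s => \sum_(t <- T | t.1 == (r, s)) t.2) => p z1 z2.
rewrite /fbranch /lfun /lnum fsum_zrange mulr_suml.
under eq_bigr => r _ do rewrite fsum_zrange.
pose G (t : int * int * C) : C :=
  t.2 * bpow p z1 (t.1.1%:~R / k%:R) * bpow p z2 (t.1.2%:~R / k%:R) * (z1 - z2) ^- N.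
transitivity (\sum_(r <- zrange (- B%:Z) B) \sum_(s <- zrange (- B%:Z) B)
    \sum_(t <- T) if t.1 == (r, s) then G t else 0).
  apply: eq_bigr => r _; apply: eq_bigr => s _.
  rewrite -!mulrA mulr_suml big_mkcond /=; apply: eq_bigr => -[[r' s'] c] _ /=.
  by case: eqP => [[-> ->]|]; rewrite ?mul0r // /G /= /bpow !mulrA.
under eq_bigr => r _ do rewrite exchange_big /=.
rewrite exchange_big /= !big_seq; apply: eq_bigr => -[[r s] c] /hB /= [hr hs].
have mr : r \in zrange (- B%:Z) B by rewrite mem_zrange; lia.
have ms : s \in zrange (- B%:Z) B by rewrite mem_zrange; lia.
rewrite (bigD1_seq r) ?zrange_uniq //= (bigD1_seq s) ?zrange_uniq //= eqxx.
rewrite big1 ?addr0 => [|s' ne]; last by rewrite xpair_eqE eqxx eq_sym (negbTE ne).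
rewrite big1 ?addr0 // => r' ne; rewrite big1 // => s' _.
by rewrite xpair_eqE eq_sym (negbTE ne).
Qed.

Lemma lfun_cat N T T' p z1 z2 :
  lfun N (T ++ T') p z1 z2 = lfun N T p z1 z2 + lfun N T' p z1 z2.
Proof. by rewrite /lfun /lnum big_cat mulrDl. Qed.

Lemma lfun_raise N T n : exists T', forall p z1 z2, z1 != 0 -> z2 != 0 -> z1 != z2 ->
  lfun (N + n) T' p z1 z2 = lfun N T p z1 z2.
Proof.
elim: n => [|n [T1 h1]]; first by exists T => *; rewrite addn0.
exists ([seq (t.1.1 + k%:Z, t.1.2, t.2) | t <- T1] ++
        [seq (t.1.1, t.1.2 + k%:Z, - t.2) | t <- T1]) => p z1 z2 z10 z20 z12.
rewrite -h1 // lfun_cat /lfun /lnum !big_map -mulrDl addnS exprSr invfM.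
have d : z1 - z2 != 0 by rewrite subr_eq0.
rewrite mulrCA mulrA.
have sh z (r : int) : z != 0 ->
    bpow p z ((r + k%:Z)%:~R / k%:R) = bpow p z (r%:~R / k%:R) * z.
  move=> z0; rewrite intrD mulrDl -pmulrn divff //.
  by rewrite -[X in _ + X]/((1 : int)%:~R) bpowDz // expr1z.
rewrite -big_split /=.
have -> : \sum_(i <- T1) (i.2 * bpow p z1 ((i.1.1 + k%:Z)%:~R / k%:R) *
        bpow p z2 (i.1.2%:~R / k%:R) +
      - i.2 * bpow p z1 (i.1.1%:~R / k%:R) * bpow p z2 ((i.1.2 + k%:Z)%:~R / k%:R)) =
    (\sum_(t <- T1) t.2 * bpow p z1 (t.1.1%:~R / k%:R) * bpow p z2 (t.1.2%:~R / k%:R))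
      * (z1 - z2).
  by rewrite mulr_suml; apply: eq_bigr => t _; rewrite !sh //; ring.
by rewrite mulrA mulfK // mulrC.
Qed.

End Lists.

End Branches.

(** * From the Jacobi identity to duality *)

Section Duality.
Variables (R : realType) (V : voa R) (g : {linear V -> V}) (k : nat).
Local Notation C := R[i].
Variables (W : lmodType C) (gW : grading C W).
Variable Yg : int -> {bilinear V -> W -> W}.
Local Notation YV := (voa_Y V).
Local Notation GV := (voa_gr V).
Local Notation Ygp := (Ygp k gW Yg).
Local Notation fam12 := (fam12 k gW Yg).
Local Notation fam_iter := (fam_iter k gW Yg).
Hypothesis autg : voa_automorphism g.
Hypothesis ordg : has_finite_order g k.
Hypothesis grading_pres : grading_preserving k gW Yg.
Hypothesis grading_restr : grading_restriction k gW.
Hypothesis monodromy : formal_monodromy g k Yg.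
Hypothesis truncation : lower_truncation Yg.

Let k0 : (0 < k)%N := k_gt0 ordg.

Definition dual_with (N : nat) (T : seq (int * int * C)) u v w f := forall p : 'I_k,
  let p' := (p : nat)%:Z in
  [/\ forall z1 z2 : C, 0 < nm z2 < nm z1 ->
        sums (fam12 p' u v w f z1 z2) (lfun k N T p' z1 z2),
      forall z1 z2 : C, 0 < nm z1 < nm z2 ->
        sums (fam12 p' v u w f z2 z1) (lfun k N T p' z1 z2)
    & forall z1 z2 : C, 0 < nm (z1 - z2) < nm z2 ->
        abs_summable (fam_iter p' u v w f z1 z2) /\
        (`|carg z1 - carg z2| < pi / 2 ->
         has_sum (fam_iter p' u v w f z1 z2) (lfun k N T p' z1 z2))].

Definition dual_at u v w f := exists N T, (0 < N)%N /\ dual_with N T u v w f.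

Lemma ltr_normC (x y : C) : (`|x| < `|y|) = (nm x < nm y).
Proof. by rewrite !normCE ltcR. Qed.

Lemma normC_gt0 (x : C) : (0 < `|x|) = (0 < nm x).
Proof. by rewrite normCE ltcR. Qed.

Lemma duality_dual_at : duality k gW Yg <->
  forall u v w f, in_graded_dual gW f -> dual_at u v w f.
Proof.
split=> H u v w f hf.
  have [N1 [N2 [N [a [N0 h]]]]] := H u v w f hf.
  have [T hT] := fbranch_lfun k0 N1 N2 N a; exists N, T; split => // p p'.
  have [h1 h2 h3] := h p; split=> z1 z2 hz.
  - by have := h1 z1 z2; rewrite normC_gt0 ltr_normC hT => /(_ hz).
  - by have := h2 z1 z2; rewrite normC_gt0 ltr_normC hT => /(_ hz).
  by have := h3 z1 z2; rewrite normC_gt0 ltr_normC hT => /(_ hz).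
have [N [T [N0 h]]] := H u v w f hf.
have [N1 [N2 [a hT]]] := lfun_fbranch k0 N T; exists N1, N2, N, a; split => // p p'.
have [h1 h2 h3] := h p; split=> z1 z2; rewrite normC_gt0 ltr_normC hT => hz c.
- exact: h1.
- exact: h2.
exact: h3.
Qed.

Lemma dual_with_raise N T n u v w f : dual_with N T u v w f ->
  exists T', dual_with (N + n) T' u v w f.
Proof.
move=> h; have [T' hT] := lfun_raise k0 N T n; exists T' => p p'.
have [h1 h2 h3] := h p; split=> z1 z2 hz; have /andP[n1 n2] := hz.
- have z20 : z2 != 0 by rewrite -nm_gt0.
  have z10 : z1 != 0 by rewrite -nm_gt0 (lt_trans n1).
  by rewrite hT; [apply: h1| | |apply: contraTneq n2 => ->; rewrite ltxx].
- have z10 : z1 != 0 by rewrite -nm_gt0.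
  have z20 : z2 != 0 by rewrite -nm_gt0 (lt_trans n1).
  by rewrite hT; [apply: h2| | |apply: contraTneq n2 => ->; rewrite ltxx].
have z20 : z2 != 0 by rewrite -nm_gt0 (lt_trans n1).
have z10 : z1 != 0 by apply: contraTneq n2 => ->; rewrite sub0r nmN ltxx.
by rewrite hT; [apply: h3| | |rewrite -subr_eq0 -nm_gt0].
Qed.

Lemma dual_at_add u v w f u1 v1 w1 f1 u2 v2 w2 f2 :
  (forall p z1 z2, fam12 p u v w f z1 z2 =1
     (fun n => fam12 p u1 v1 w1 f1 z1 z2 n + fam12 p u2 v2 w2 f2 z1 z2 n)) ->
  (forall p z1 z2, fam12 p v u w f z1 z2 =1
     (fun n => fam12 p v1 u1 w1 f1 z1 z2 n + fam12 p v2 u2 w2 f2 z1 z2 n)) ->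
  (forall p z1 z2, fam_iter p u v w f z1 z2 =1
     (fun n => fam_iter p u1 v1 w1 f1 z1 z2 n + fam_iter p u2 v2 w2 f2 z1 z2 n)) ->
  dual_at u1 v1 w1 f1 -> dual_at u2 v2 w2 f2 -> dual_at u v w f.
Proof.
move=> e1 e2 e3 [N1 [T1 [N10 d1]]] [N2 [T2 [N20 d2]]].
have [T1' h1] := dual_with_raise N2 d1.
have [T2' h2] := dual_with_raise N1 d2.
exists (N1 + N2)%N, (T1' ++ T2'); split; first by rewrite addn_gt0 N10.
rewrite addnC in h2.
move=> p p'; have [a1 a2 a3] := h1 p; have [b1 b2 b3] := h2 p.
split=> z1 z2 hz; rewrite lfun_cat.
- by rewrite (funext (e1 _ _ _)); apply: sumsD; [apply: a1|apply: b1].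
- by rewrite (funext (e2 _ _ _)); apply: sumsD; [apply: a2|apply: b2].
rewrite (funext (e3 _ _ _)).
have [a31 a32] := a3 _ _ hz; have [b31 b32] := b3 _ _ hz.
split=> [|harg]; first exact: abs_summableD.
by apply: has_sumD; [apply: a32|apply: b32].
Qed.

Lemma dual_at_zero u v w f : (forall p z1 z2 n, fam12 p u v w f z1 z2 n = 0) ->
  (forall p z1 z2 n, fam12 p v u w f z1 z2 n = 0) ->
  (forall p z1 z2 n, fam_iter p u v w f z1 z2 n = 0) -> dual_at u v w f.
Proof.
move=> e1 e2 e3; exists 1%N, [::]; split => // p p'.
have l0 z1 z2 : lfun k 1 [::] p' z1 z2 = 0 by rewrite /lfun /lnum big_nil mul0r.
split=> z1 z2 _; rewrite l0.
- by rewrite (funext (e1 _ _ _)); apply: sums0.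
- by rewrite (funext (e2 _ _ _)); apply: sums0.
by rewrite (funext (e3 _ _ _)); have [h1 h2] := @sums0 R int.
Qed.

Lemma finite_nz (I : choiceType) (M : zmodType) (F : I -> M) (D : set I) :
  finite_set D -> (forall i, ~ D i -> F i = 0) -> finite_set [set i | F i != 0].
Proof.
move=> fD h; apply: sub_finite_set fD => i /= ne.
by apply: contrapT => /h /eqP; apply/negP.
Qed.

Lemma Yg_fin v w n : finite_set [set l | gproj gW n (Yg l v w) != 0].
Proof.
have U (x y : int -> W) : finite_set [set l | gproj gW n (x l) != 0] ->
    finite_set [set l | gproj gW n (y l) != 0] ->
    finite_set [set l | gproj gW n (x l + y l) != 0].
  move=> hx hy; apply: (finite_nz (D := [set l | gproj gW n (x l) != 0] `|`
     [set l | gproj gW n (y l) != 0])); first by rewrite finite_setU.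
  by move=> l /not_orP[/negP/negPn/eqP hx' /negP/negPn/eqP hy']; rewrite linearD hx' hy' addr0.
move: v; apply: (grading_ind (G := GV)).
- apply: (finite_nz (D := set0)) => [|l _]; first exact: finite_set0.
  by rewrite linear0l linear0.
- move=> x y hx hy; under eq_set do rewrite linearDl; exact: U.
move=> m v hv; move: w; apply: (grading_ind (G := gW)).
- apply: (finite_nz (D := set0)) => [|l _]; first exact: finite_set0.
  by rewrite linear0r linear0.
- move=> x y hx hy; under eq_set do rewrite linearDr; exact: U.
move=> h w hw.
have E l : gproj gW n (Yg l v w) = if n == h + m%:~R - l%:~R / k%:R - 1 then Yg l v w else 0.
  exact: gproj_homog (grading_pres l hv hw).
have [[l0 e0]|ne] := pselect (exists l : int, n = h + m%:~R - l%:~R / k%:R - 1).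
  apply: (finite_nz (D := [set l0])) => [|l nl]; first exact: finite_set1.
  rewrite E; case: eqP => // e; case: nl.
  apply: (wt_inj ordg (h := h + m%:~R)).
  by apply: (addIr (- 1)); rewrite -e -e0.
apply: (finite_nz (D := set0)) => [|l _]; first exact: finite_set0.
by rewrite E; case: eqP => // e; case: ne; exists l.
Qed.

Lemma YV_fin u v n : finite_set [set m | gproj GV n (YV m u v) != 0].
Proof.
have U (x y : int -> V) : finite_set [set l | gproj GV n (x l) != 0] ->
    finite_set [set l | gproj GV n (y l) != 0] ->
    finite_set [set l | gproj GV n (x l + y l) != 0].
  move=> hx hy; apply: (finite_nz (D := [set l | gproj GV n (x l) != 0] `|`
     [set l | gproj GV n (y l) != 0])); first by rewrite finite_setU.
  by move=> l /not_orP[/negP/negPn/eqP hx' /negP/negPn/eqP hy']; rewrite linearD hx' hy' addr0.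
move: u; apply: (grading_ind (G := GV)).
- apply: (finite_nz (D := set0)) => [|l _]; first exact: finite_set0.
  by rewrite linear0l linear0.
- move=> x y hx hy; under eq_set do rewrite linearDl; exact: U.
move=> m u hu; move: v; apply: (grading_ind (G := GV)).
- apply: (finite_nz (D := set0)) => [|l _]; first exact: finite_set0.
  by rewrite linear0r linear0.
- move=> x y hx hy; under eq_set do rewrite linearDr; exact: U.
move=> h v hv; apply: (finite_nz (D := [set m + h - n - 1])) => [|l nl].
  exact: finite_set1.
rewrite (gproj_homog _ (Y_homog _ hu hv)); case: eqP => // e.
by case: nl => /=; lia.
Qed.

Lemma finite_nz_scale (I : choiceType) (M : lmodType C) (c : I -> C) (F : I -> M) :
  finite_set [set i | F i != 0] -> finite_set [set i | c i *: F i != 0].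
Proof.
move=> h; apply: (finite_nz h) => i /negP/negPn/eqP->; exact: scaler0.
Qed.

Lemma YgpDl p v v' z w n : Ygp p (v + v') z w n = Ygp p v z w n + Ygp p v' z w n.
Proof.
rewrite -fsumD; try exact/finite_nz_scale/Yg_fin.
by apply: eq_fsbigr => l _; rewrite [Yg _ _ _]linearDl [gproj _ n _]linearD scalerDr.
Qed.

Lemma YgpDr p v z w w' n : Ygp p v z (w + w') n = Ygp p v z w n + Ygp p v z w' n.
Proof.
rewrite -fsumD; try exact/finite_nz_scale/Yg_fin.
by apply: eq_fsbigr => l _; rewrite [Yg _ _ _]linearDr [gproj _ n _]linearD scalerDr.
Qed.

Lemma Ygp0l p z w n : Ygp p 0 z w n = 0.
Proof. by apply: fsbig1 => l _; rewrite linear0l linear0 scaler0. Qed.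

Lemma Ygp0r p v z n : Ygp p v z 0 n = 0.
Proof. by apply: fsbig1 => l _; rewrite linear0r linear0 scaler0. Qed.

Lemma YcompDl (u u' v : V) (z : C) n : Ycomp (u + u') z v n = Ycomp u z v n + Ycomp u' z v n.
Proof.
rewrite -fsumD; try exact/finite_nz_scale/YV_fin.
by apply: eq_fsbigr => l _; rewrite linearDl [gproj _ n _]linearD scalerDr.
Qed.

Lemma YcompDr (u v v' : V) (z : C) n : Ycomp u z (v + v') n = Ycomp u z v n + Ycomp u z v' n.
Proof.
rewrite -fsumD; try exact/finite_nz_scale/YV_fin.
by apply: eq_fsbigr => l _; rewrite linearDr [gproj _ n _]linearD scalerDr.
Qed.

Lemma Ycomp0l z v n : @Ycomp R V 0 z v n = 0.
Proof. by apply: fsbig1 => l _; rewrite linear0l linear0 scaler0. Qed.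

Lemma Ycomp0r u z n : @Ycomp R V u z 0 n = 0.
Proof. by apply: fsbig1 => l _; rewrite linear0r linear0 scaler0. Qed.

Lemma pairing_fin (f : {scalar W}) (F : C -> W) : in_graded_dual gW f ->
  (forall n, homog gW n (F n)) -> finite_set [set n | f (F n) != 0].
Proof.
move=> [s hs] hF; apply: (finite_nz (D := [set` s])) => [|n ns].
  exact: finite_seq.
by apply: (hs n) => //; apply/negP.
Qed.

Lemma pairingD (f : {scalar W}) (F G : C -> W) : in_graded_dual gW f ->
  (forall n, homog gW n (F n)) -> (forall n, homog gW n (G n)) ->
  pairing f (fun n => F n + G n) = pairing f F + pairing f G.
Proof.
move=> hf hF hG; rewrite -fsumD; try exact: pairing_fin.
by apply: eq_fsbigr => n _; rewrite linearD.
Qed.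

Lemma pairing0 (f : {scalar W}) (F : C -> W) : (forall n, F n = 0) -> pairing f F = 0.
Proof. by move=> h; apply: fsbig1 => n _; rewrite h linear0. Qed.

Lemma pairingDf (f f1 f2 : {scalar W}) (F : C -> W) : in_graded_dual gW f1 ->
  in_graded_dual gW f2 -> (forall x, f x = f1 x + f2 x) ->
  (forall n, homog gW n (F n)) -> pairing f F = pairing f1 F + pairing f2 F.
Proof.
move=> h1 h2 h hF; rewrite -fsumD; try exact: pairing_fin.
by apply: eq_fsbigr => n _; rewrite h.
Qed.

Section FixedFunctional.
Variable f : {scalar W}.
Hypothesis hf : in_graded_dual gW f.

Lemma fam12Dl p x x' y w z1 z2 n :
  fam12 p (x + x') y w f z1 z2 n = fam12 p x y w f z1 z2 n + fam12 p x' y w f z1 z2 n.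
Proof.
rewrite -pairingD //; try by move=> ?; apply: homog_Ygp.
by congr pairing; apply/funext => m; rewrite YgpDl.
Qed.

Lemma fam12Dm p x y y' w z1 z2 n :
  fam12 p x (y + y') w f z1 z2 n = fam12 p x y w f z1 z2 n + fam12 p x y' w f z1 z2 n.
Proof.
rewrite -pairingD //; try by move=> ?; apply: homog_Ygp.
by congr pairing; apply/funext => m; rewrite YgpDl YgpDr.
Qed.

Lemma fam12Dr p x y w w' z1 z2 n :
  fam12 p x y (w + w') f z1 z2 n = fam12 p x y w f z1 z2 n + fam12 p x y w' f z1 z2 n.
Proof.
rewrite -pairingD //; try by move=> ?; apply: homog_Ygp.
by congr pairing; apply/funext => m; rewrite !YgpDr.
Qed.

Lemma fam_iterDl p x x' y w z1 z2 n :
  fam_iter p (x + x') y w f z1 z2 n = fam_iter p x y w f z1 z2 n + fam_iter p x' y w f z1 z2 n.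
Proof.
rewrite -pairingD //; try by move=> ?; apply: homog_Ygp.
by congr pairing; apply/funext => m; rewrite YcompDl YgpDl.
Qed.

Lemma fam_iterDm p x y y' w z1 z2 n :
  fam_iter p x (y + y') w f z1 z2 n = fam_iter p x y w f z1 z2 n + fam_iter p x y' w f z1 z2 n.
Proof.
rewrite -pairingD //; try by move=> ?; apply: homog_Ygp.
by congr pairing; apply/funext => m; rewrite YcompDr YgpDl.
Qed.

Lemma fam_iterDr p x y w w' z1 z2 n :
  fam_iter p x y (w + w') f z1 z2 n = fam_iter p x y w f z1 z2 n + fam_iter p x y w' f z1 z2 n.
Proof.
rewrite -pairingD //; try by move=> ?; apply: homog_Ygp.
by congr pairing; apply/funext => m; rewrite YgpDr.
Qed.

Lemma dual_atDu u u' v w : dual_at u v w f -> dual_at u' v w f -> dual_at (u + u') v w f.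
Proof.
apply: dual_at_add => p z1 z2 n; [exact: fam12Dl|exact: fam12Dm|exact: fam_iterDl].
Qed.

Lemma dual_atDv u v v' w : dual_at u v w f -> dual_at u v' w f -> dual_at u (v + v') w f.
Proof.
apply: dual_at_add => p z1 z2 n; [exact: fam12Dm|exact: fam12Dl|exact: fam_iterDm].
Qed.

Lemma dual_atDw u v w w' : dual_at u v w f -> dual_at u v w' f -> dual_at u v (w + w') f.
Proof.
apply: dual_at_add => p z1 z2 n; [exact: fam12Dr|exact: fam12Dr|exact: fam_iterDr].
Qed.

Lemma dual_at0u v w : dual_at 0 v w f.
Proof.
apply: dual_at_zero => p z1 z2 n; apply: pairing0 => m; rewrite ?Ycomp0l ?Ygp0l //.
exact: Ygp0r.
Qed.

Lemma dual_at0v u w : dual_at u 0 w f.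
Proof.
apply: dual_at_zero => p z1 z2 n; apply: pairing0 => m; rewrite ?Ycomp0r ?Ygp0l //.
exact: Ygp0r.
Qed.

Lemma dual_at0w u v : dual_at u v 0 f.
Proof. by apply: dual_at_zero => p z1 z2 n; apply: pairing0 => m; rewrite ?Ygp0r. Qed.

End FixedFunctional.

Lemma proj_in_dual (f : {scalar W}) i : (forall y, f (gproj gW i y) = f y) ->
  in_graded_dual gW f.
Proof.
move=> hf; exists [:: i] => j x; rewrite inE => ji hx.
by rewrite -hf (gproj_homog _ hx) eq_sym (negbTE ji) linear0.
Qed.

Lemma dual_at_functional u v w :
  (forall i (f : {scalar W}), (forall y, f (gproj gW i y) = f y) -> dual_at u v w f) ->
  forall f, in_graded_dual gW f -> dual_at u v w f.
Proof.
move=> H f [s hs]; elim: s f hs => [|i s IH] f hs.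
  have f0 : forall x, f x = 0.
    apply: (grading_ind (G := gW)) => [|x y hx hy|i x hx]; first exact: linear0.
      by rewrite linearD hx hy addr0.
    exact: hs hx.
  by apply: dual_at_zero => p z1 z2 n; apply: fsbig1 => m _; rewrite f0.
pose f1 : {scalar W} := f \o gproj gW i.
pose f2 : {scalar W} := f \- f1.
have h1 y : f1 (gproj gW i y) = f1 y by rewrite /f1 /= gproj_orth eqxx.
have h2 j x : j \notin s -> homog gW j x -> f2 x = 0.
  move=> js hx; rewrite /f2 /f1 /= (gproj_homog _ hx) eq_sym.
  case: eqP => [_|/eqP ne]; first by rewrite subrr.
  by rewrite linear0 subr0 (hs j) // inE negb_or ne.
have d1 := H i f1 h1; have d2 := IH f2 h2.
have k1 := proj_in_dual h1; have k2 : in_graded_dual gW f2 by exists s.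
apply: dual_at_add d1 d2 => p z1 z2 n; apply: pairingDf => // m;
  try exact: homog_Ygp; by rewrite /f2 /= addrC subrK.
Qed.

Section Expansion.
Variables (a L : int) (N : nat) (s0 : int) (K : nat) (b : int -> C).
Local Notation al := (a%:~R / k%:R : C).
Local Notation be := ((L - a)%:~R / k%:R : C).

Definition expand_list : seq (int * int * C) :=
  [seq (- a + k%:Z * (N%:Z - 2 - (s0 + j%:Z)), - (L - a) + k%:Z * (s0 + j%:Z),
        b (s0 + j%:Z)) | j <- iota 0 K].

Lemma expand_expo (s : int) :
  - al + N%:R - 2 - s%:~R = (- a + k%:Z * (N%:Z - 2 - s))%:~R / k%:R.
Proof.
rewrite !(intrB, intrD, intrM, intrN) -!pmulrn; field; exact: kC ordg.
Qed.

Lemma lfun_expand p z1 z2 : lfun k N expand_list p z1 z2 =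
  \sum_(j < K) b (s0 + j%:Z) * valf p z1 z2 al be N (s0 + j%:Z).
Proof.
rewrite /lfun /lnum big_map mulr_suml -[in RHS](big_mkord xpredT (fun j : nat =>
  b (s0 + j%:Z) * valf p z1 z2 al be N (s0 + j%:Z))) /index_iota subn0.
apply: eq_bigr => j _; rewrite /valf expand_expo /=.
have -> : (- (L - a) + k%:Z * (s0 + j%:Z))%:~R / k%:R = - be + (s0 + j%:Z)%:~R :> C.
  by rewrite !(intrB, intrD, intrM, intrN) -!pmulrn; field; exact: kC ordg.
by ring.
Qed.

Lemma expandP_sums p z1 z2 : 0 < nm z2 < nm z1 ->
  sums (fun i : int => expansion (monoP R N) s0 K b i *
    (bpow p z1 (- al + i%:~R - 1) * bpow p z2 (- be - i%:~R - 1)))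
    (lfun k N expand_list p z1 z2).
Proof.
move=> hz; rewrite lfun_expand; apply: eq_sums (sums_sum (fun j : 'I_K =>
  sumsZ (b (s0 + j%:Z)) (sums_monoP p al be N (s0 + j%:Z) hz))) => // i.
by rewrite /expansion mulr_suml; apply: eq_bigr => j _; rewrite mulrA.
Qed.

Lemma expandQ_sums p z1 z2 : 0 < nm z1 < nm z2 ->
  sums (fun i : int => expansion (monoQ R N) s0 K b i *
    (bpow p z1 (- al - i%:~R - 1) * bpow p z2 (- be + i%:~R - 1)))
    (lfun k N expand_list p z1 z2).
Proof.
move=> hz; rewrite lfun_expand; apply: eq_sums (sums_sum (fun j : 'I_K =>
  sumsZ (b (s0 + j%:Z)) (sums_monoQ p al be N (s0 + j%:Z) hz))) => // i.
by rewrite /expansion mulr_suml; apply: eq_bigr => j _; rewrite mulrA.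
Qed.

Lemma expandR_sums p z1 z2 : 0 < nm (z1 - z2) < nm z2 ->
  let F := fun m : int => expansion (monoR al N) s0 K b m *
    ((z1 - z2) ^ (- m - 1) * bpow p z2 (- (L%:~R / k%:R) + m%:~R - 1)) in
  abs_summable F /\ (`|carg z1 - carg z2| < pi / 2 ->
    has_sum F (lfun k N expand_list p z1 z2)).
Proof.
move=> hz F.
have eL : al + be = L%:~R / k%:R by rewrite -mulrDl -intrD addrC subrK.
have FE : F = fun i => \sum_(j < K) b (s0 + j%:Z) * (monoR al N (s0 + j%:Z) i *
    ((z1 - z2) ^ (- i - 1) * bpow p z2 (- (al + be) + i%:~R - 1))).
  apply/funext => i; rewrite /F /expansion mulr_suml eL; apply: eq_bigr => j _.
  by rewrite mulrA.
have h (j : 'I_K) := @sums_monoR R p z1 z2 al be N _ k _ k0 (expand_expo (s0 + j%:Z)) hz.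
rewrite FE lfun_expand; split=> [|harg].
  by apply: abs_summable_sum => j; apply: abs_summableZ; have [] := h j.
by apply: has_sum_sum => j; apply: has_sumZ; have [_] := h j; apply.
Qed.

End Expansion.

Lemma dual_at_homog (mu mv a : int) (h i : C) u v w (f : {scalar W}) :
  twisted_jacobi g k Yg -> homog GV mu u -> g u = eta R k ^ a *: u ->
  homog GV mv v -> homog gW h w -> (forall y, f (gproj gW i y) = f y) ->
  dual_at u v w f.
Proof.
move=> J hu ga hv hw hf.
have [[L eL]|noL] := pselect (exists L : int, i = wt k mu mv h L); last first.
  have nL L : i <> wt k mu mv h L by move=> e; apply: noL; exists L.
  apply: dual_at_zero => p z1 z2 n.
  - exact: (fam12_noL ordg grading_pres hu hv hw hf).
  - apply: (fam12_noL ordg grading_pres hv hu hw hf) => L.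
    by rewrite wtC; apply: nL.
  - exact: (fam_iter_noL ordg grading_pres hu hv hw hf).
subst i.
have B := jacobi_borcherds ordg monodromy truncation f L v w J ga.
have [Mp hp] := vanish_pP ordg truncation f L a u v w.
have [Mq hq] := vanish_pQ ordg truncation f L a u v w.
have [Mr hr] := vanish_pR k Yg f L u v w.
pose M := Num.max Mp (Num.max Mq Mr).
have leP : Mp <= M by rewrite /M; lia.
have leQ : Mq <= M by rewrite /M; lia.
have leR : Mr <= M by rewrite /M; lia.
have vM M' (x : int -> C) : M' <= M -> vanish_from M' x -> vanish_from M x.
  by move=> le hx i hi; apply: hx; apply: le_trans hi.
have [N [s0 [K [b [N0 pE qE rE]]]]] := borcherds_expand
  (vM _ _ leP hp) (vM _ _ leQ hq) (vM _ _ leR hr) B.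
exists N, (expand_list a L N s0 K b); split => // p p'; split=> z1 z2 hz.
- apply/(fam12_P ordg grading_pres monodromy hu ga hv hw hf).
  by rewrite (funext pE); apply: expandP_sums.
- apply/(fam12_Q ordg grading_pres monodromy hu ga hv hw hf).
  by rewrite (funext qE); apply: expandQ_sums.
have [e1 e2] := fam_iter_sums ordg grading_pres hu hv hw hf p' z1 z2 erefl.
rewrite e1; have [k1 k2] := expandR_sums a L N s0 K b p' hz.
by rewrite (funext rE); split=> // harg; apply/e2; rewrite (funext rE); apply: k2.
Qed.

Lemma jacobi_duality : twisted_jacobi g k Yg -> duality k gW Yg.
Proof.
move=> J; apply/duality_dual_at => u v w.
apply: dual_at_functional => i f hf; have hd := proj_in_dual hf.
move: u; apply: (voa_ind autg ordg); first exact: dual_at0u.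
  by move=> x y; apply: dual_atDu.
move=> mu a u hu ga; move: v; apply: (grading_ind (G := GV)); first exact: dual_at0v.
  by move=> x y; apply: dual_atDv.
move=> mv v hv; move: w; apply: (grading_ind (G := gW)); first exact: dual_at0w.
  by move=> x y; apply: dual_atDw.
by move=> h w hw; apply: (dual_at_homog J hu ga hv hw hf).
Qed.

End Duality.

(** * From duality to the Jacobi identity *)

Section Uniqueness.
Variable R : realType.
Local Notation C := R[i].

Lemma real_neq0 (y : R) : 0 < y -> y%:C != 0.
Proof. by move=> y0; rewrite -nm_gt0 nm_real normr_gt0 gt_eqF. Qed.

Lemma power_series_head (e : nat -> C) :
  (forall y : R, 0 < y < 1 -> sums (fun t => e t * y%:C ^+ t) 0) -> e 0%N = 0.
Proof.
move=> H; have [|[B hB] _] := (sums_natP _ _).1 (H (1 / 2) _); first by lra.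
have B0 : 0 <= B by have := hB 0%N; rewrite /psum big_ord0.
have half_ge0 t : 0 <= (1 / 2 : R) ^+ t by rewrite exprn_ge0 // ltW.
have term t : nm (e t) <= B * 2 ^+ t.
  have := hB t.+1; rewrite psumS => h.
  have {h} : nm (e t * (1 / 2 : R)%:C ^+ t) <= B.
    by apply: le_trans h; rewrite lerDr sumr_ge0 // => i _; apply: nm_ge0.
  have h2 : nm (1 / 2 : R)%:C = 1 / 2 by rewrite nm_real ger0_norm // divr_ge0.
  by rewrite nmM nmX h2 div1r exprVn ler_pdivrMr // exprn_gt0.
apply/eqP; rewrite -nm_eq0; apply/eqP/le_anti; rewrite nm_ge0 andbT leNgt.
apply/negP; set c := nm (e 0%N) => c0.
pose y := Num.min (1 / 4) (c / (16 * (B + 1))).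
have B1 : 0 < 16 * (B + 1) by lra.
have y0 : 0 < y by rewrite lt_min; apply/andP; split; [lra|rewrite divr_gt0].
have y4 : y <= 1 / 4 by rewrite ge_min lexx.
have yB : y * (16 * (B + 1)) <= c by rewrite -ler_pdivlMr // ge_min lexx orbT.
have [|_ cv] := (sums_natP _ _).1 (H y _); first by lra.
have [|n hn] := cv (c / 2); first by lra.
have := hn n.+1 (leqnSn n); rewrite subr0 /psum big_ord_recl expr0 mulr1.
set T := \sum_(i < n) _ => hT.
have : nm T <= 4 * B * y.
  apply: (@le_trans _ _ (\sum_(i < n) (2 * B * y) * (2 * y) ^+ i)).
    apply: le_trans (nm_sum _ _) _; apply: ler_sum => i _.
    rewrite lift0 nmM nmX nm_real (ger0_norm (ltW y0)).
    apply: (@le_trans _ _ (B * 2 ^+ i.+1 * y ^+ i.+1)).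
      by rewrite ler_wpM2r // exprn_ge0 // ltW.
    by rewrite !exprS exprMn; lra.
  rewrite -mulr_sumr; have y2 : 2 * y < 1 by lra.
  have := sum_geom_le n (_ : 0 <= 2 * y) y2; rewrite /psum => /(_ (ltac:(lra))) h.
  apply: (@le_trans _ _ (2 * B * y * 2)); last by lra.
  rewrite ler_wpM2l //; first by rewrite !mulr_ge0 // ltW.
  apply: le_trans h _; rewrite -[leRHS]invrK lef_pV2 ?posrE; lra.
have := nm_dist (e 0%N) (- T); rewrite opprK nmN -/c.
have : 4 * B * y <= c / 4.
  by move: yB y0; lra.
lra.
Qed.

Lemma laurent_unique (d : int -> C) (M : int) : (forall i, i < M -> d i = 0) ->
  (forall y : R, 0 < y < 1 -> sums (fun i => d i * y%:C ^ i) 0) ->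
  forall i, d i = 0.
Proof.
move=> dM H.
suff key (n : nat) : forall i, i < M + n%:Z -> d i = 0.
  by move=> i; apply: (key `|i - M|.+1); lia.
elim: n => [|n IH] i hi; first by apply: dM; lia.
have [/IH//|ge] := ltP i (M + n%:Z).
rewrite -(addr0 i); apply: (@power_series_head (fun t => d (i + t%:Z))) => y hy.
have y0 : y%:C != 0 by apply: real_neq0; case/andP: hy.
pose phi (t : nat) : int := i + t%:Z.
have phi_inj : injective phi by move=> t t'; rewrite /phi; lia.
have out j : (forall t, phi t != j) -> d j * y%:C ^ j = 0.
  move=> hj; rewrite IH ?mul0r //.
  rewrite ltNge; apply/negP => h; have /eqP := hj (absz (j - i)); rewrite /phi; lia.
have := (sums_inj phi_inj out 0).2 (H y hy) => /(sumsZ (y%:C ^ (- i))).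
rewrite mulr0; apply: eq_sums => // t /=; rewrite /phi expfzDr // -exprnP mulrCA.
by congr (_ * _); rewrite mulrA -expfzDr // addNr expr0z mul1r.
Qed.

Lemma list_lower_bound (T : Type) (l : seq T) (e : T -> int) :
  exists M, forall i c, i < M -> \sum_(t <- l | e t == i) (c t : C) = 0.
Proof.
elim: l => [|t l [M hM]]; first by exists 0 => i c _; rewrite big_nil.
exists (Num.min M (e t)) => i c hi; rewrite big_cons hM; last by lia.
by case: eqP => // h; move: hi; rewrite h; lia.
Qed.

Lemma sums_single (e : int) (c : C) (x : C) :
  sums (fun i : int => (if e == i then c else 0) * x ^ i) (c * x ^ e).
Proof.
pose phi (t : nat) : int := e + t%:Z.
have phi_inj : injective phi by move=> t t'; rewrite /phi; lia.
apply/(sums_inj phi_inj) => [j hj|].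
  case: eqP => [ej|]; last by rewrite mul0r.
  by have := hj 0%N; rewrite /phi addr0 ej eqxx.
have := @sums_fin R (fun t => if t == 0%N then c * x ^ e else 0) 1.
rewrite big_ord1 /=; move=> h; apply: eq_sums (h _) => //.
  move=> t; rewrite /= /phi; have [->|t0] := eqVneq t 0%N; first by rewrite addr0 eqxx.
  by case: eqP => [ej|]; [lia|rewrite mul0r].
by case.
Qed.

Lemma sums_list (T : Type) (l : seq T) (e : T -> int) (c : T -> C) (x : C) :
  sums (fun i : int => (\sum_(t <- l | e t == i) c t) * x ^ i)
       (\sum_(t <- l) c t * x ^ e t).
Proof.
elim: l => [|t l IH].
  rewrite big_nil; under eq_fun do rewrite big_nil mul0r; exact: sums0.
rewrite big_cons; apply: eq_sums (sumsD (sums_single (e t) (c t) x) IH) => // i.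
by rewrite -mulrDl big_cons; case: ifP; rewrite ?add0r.
Qed.

Lemma laurent_coef (k : nat) (c0 M : int) (A : int -> C) (T : Type) (l : seq T)
    (e : T -> int) (c : T -> C) : (0 < k)%N -> vanish_from M A ->
  (forall y : R, 0 < y < 1 -> sums (fun n : int => A n * y%:C ^ (c0 - k%:Z * n))
     (\sum_(t <- l) c t * y%:C ^ e t)) ->
  forall i, \sum_(t <- l | e t == i) c t =
    if (k%:Z %| c0 - i)%Z then A ((c0 - i) %/ k%:Z)%Z else 0.
Proof.
move=> k0 hA H i; have kz : k%:Z != 0 by lia.
pose A' i : C := if (k%:Z %| c0 - i)%Z then A ((c0 - i) %/ k%:Z)%Z else 0.
have [M' hM'] := list_lower_bound l e.
pose d i := \sum_(t <- l | e t == i) c t - A' i.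
suff : d i = 0 by move/eqP; rewrite subr_eq0 => /eqP.
apply: (@laurent_unique d (Num.min M' (c0 - k%:Z * `|M|%N%:Z))) => [j hj|y hy].
  rewrite /d hM'; last by lia.
  rewrite /A'; case: ifP => [/dvdzP[q hq]|_]; last by rewrite subr0.
  rewrite hq mulzK // hA ?subr0 //; nia.
have y0 : y%:C != 0 by apply: real_neq0; case/andP: hy.
pose phi (n : int) : int := c0 - k%:Z * n.
have phi_inj : injective phi.
  by move=> m n; rewrite /phi => /addrI/oppr_inj/(mulfI kz).
have sA : sums (fun i => A' i * y%:C ^ i) (\sum_(t <- l) c t * y%:C ^ e t).
  apply/(sums_inj phi_inj) => [j hj|].
    rewrite /A'; case: ifP => [/dvdzP[q hq]|_]; last by rewrite mul0r.
    by have /eqP := hj q; rewrite /phi; lia.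
  apply: eq_sums (H y hy) => // n; rewrite /= /A' /phi.
  rewrite (_ : c0 - (c0 - k%:Z * n) = k%:Z * n); last by ring.
  by rewrite dvdz_mulr ?dvdzz // mulKz.
apply: eq_sums (sumsD (sums_list l e c y%:C) (sumsZ (- 1) sA)) => [j|].
  by rewrite /d mulrBl mulN1r.
by rewrite mulN1r subrr.
Qed.

Lemma sums_shift_mul (N : nat) (p : int -> C) M (Y : R) S : 0 < Y -> vanish_from M p ->
  sums (fun i : int => p i * Y%:C ^ (- i)) S ->
  sums (fun n : int => tsum (sbinc N%:R) p n * Y%:C ^ (- n)) ((1 - Y%:C) ^+ N * S).
Proof.
move=> Y0 hp hS; have y0 := real_neq0 Y0.
have z t : (N < t)%N -> sbinc (N%:R : C) t = 0.
  by move=> h; rewrite /sbinc binc_nat bin_small ?mulr0.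
have E : (1 - Y%:C) ^+ N = \sum_(t < N.+1) sbinc N%:R t * Y%:C ^+ t.
  rewrite exprBn; apply: eq_bigr => t _.
  by rewrite /sbinc binc_nat expr1n mulr1 -mulr_natr; ring.
have tE n : tsum (sbinc N%:R) p n = \sum_(t < N.+1) sbinc N%:R t * p (n + t%:Z).
  by apply: fsum_nat => t h; rewrite z ?mul0r.
rewrite E mulr_suml.
have one (t : nat) : sums (fun n : int => p (n + t%:Z) * Y%:C ^ (- (n + t%:Z))) S.
  apply: ((sums_bij (phi := fun n : int => n + t%:Z)
    (fun i => p i * Y%:C ^ (- i)) S) _).2 hS.
  by exists (fun n => n - t%:Z) => n; rewrite ?addrK ?subrK.
apply: eq_sums (sums_sum (fun t : 'I_N.+1 => sumsZ (sbinc N%:R t * Y%:C ^+ t) (one t))) => // n.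
rewrite tE mulr_suml; apply: eq_bigr => t _.
by rewrite opprD expfzDr // -exprnN; field; rewrite expf_neq0.
Qed.

End Uniqueness.

Lemma scale_monomial (F : fieldType) (c x y t : F) (i j : int) :
  x != 0 -> y != 0 -> t != 0 ->
  c * ((t * x) ^ i * (t * y) ^ j) = t ^ (i + j) * (c * (x ^ i * y ^ j)).
Proof.
move=> x0 y0 t0; rewrite !exprzMl ?unitfE // expfzDr //.
by rewrite [RHS]mulrCA; congr (_ * _); rewrite mulrACA.
Qed.

Lemma mulr_exp1z (F : unitRingType) (c : F) (i : int) : c * 1 ^ i = c.
Proof. by rewrite exp1rz mulr1. Qed.

Section RealPoints.
Variable R : realType.
Local Notation C := R[i].
Variable k : nat.
Hypothesis k0 : (0 < k)%N.
Implicit Types (T : seq (int * int * C)).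

Lemma bpow_real (x : R) (r : int) : 0 < x ->
  bpow 0 (x ^+ k)%:C (r%:~R / k%:R) = x%:C ^ r.
Proof.
move=> x0; rewrite /bpow lbranch0_real ?exprn_gt0 // lnXn //.
have kC : k%:R != 0 :> C by rewrite pnatr_eq0 -lt0n.
have -> : r%:~R / k%:R * (ln x *+ k)%:C = r%:~R * (ln x)%:C :> C.
  by rewrite rmorphMn /= -mulr_natr; field.
by rewrite cexpMz cexp_real lnK.
Qed.

(* The numerator of the function encoded by [T] at [z1 = x^k], [z2 = y^k], on
   the branch [p = 0]. *)
Definition lreal T (x y : C) : C := \sum_(t <- T) t.2 * x ^ t.1.1 * y ^ t.1.2.

Lemma lnum_real T (x y : R) : 0 < x -> 0 < y ->
  lnum k T 0 (x ^+ k)%:C (y ^+ k)%:C = lreal T x%:C y%:C.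
Proof. by move=> x0 y0; apply: eq_bigr => t _; rewrite !bpow_real. Qed.

Lemma lreal_homog T (D : int) (x y : R) : 0 < x -> 0 < y ->
  (forall t : R, 0 < t < 1 ->
    lreal T (t * x)%:C (t * y)%:C = t%:C ^ D * lreal T x%:C y%:C) ->
  lreal T x%:C y%:C = lreal [seq t <- T | t.1.1 + t.1.2 == D] x%:C y%:C.
Proof.
move=> x0 y0 H; have x0' := real_neq0 x0; have y0' := real_neq0 y0.
pose l : seq (int * int * C) := (D, 0, - lreal T x%:C y%:C) ::
  [seq (t.1.1 + t.1.2, 0, t.2 * x%:C ^ t.1.1 * y%:C ^ t.1.2) | t <- T].
have := @laurent_coef R 1 0 0 (fun=> 0) _ l (fun t => t.1.1) (fun t => t.2) isT
  (fun _ _ => erefl) _ D.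
rewrite if_same /l big_cons eqxx big_map /= => h.
rewrite /lreal big_filter; apply/eqP; rewrite -subr_eq0 -opprB oppr_eq0 addrC.
apply/eqP/h => t ht; rewrite big_cons big_map /=.
have t0 : t%:C != 0 by apply: real_neq0; case/andP: ht.
apply: eq_sums (sums0 _ _) => [n|]; first by rewrite mul0r.
rewrite mulNr mulrC -H // /lreal addrC; apply/esym/eqP; rewrite subr_eq0; apply/eqP.
have hx : (t * x)%:C = t%:C * x%:C by rewrite rmorphM.
have hy : (t * y)%:C = t%:C * y%:C by rewrite rmorphM.
rewrite hx hy; apply: eq_bigr => s _; rewrite [LHS]mulrC -[in LHS]mulrA -[RHS]mulrA.
by apply/esym/scale_monomial.
Qed.

End RealPoints.

Section Backward.
Variables (R : realType) (V : voa R) (g : {linear V -> V}) (k : nat).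
Local Notation C := R[i].
Variables (W : lmodType C) (gW : grading C W).
Variable Yg : int -> {bilinear V -> W -> W}.
Local Notation YV := (voa_Y V).
Local Notation GV := (voa_gr V).
Hypothesis autg : voa_automorphism g.
Hypothesis ordg : has_finite_order g k.
Hypothesis grading_pres : grading_preserving k gW Yg.
Hypothesis grading_restr : grading_restriction k gW.
Hypothesis monodromy : formal_monodromy g k Yg.
Hypothesis truncation : lower_truncation Yg.

Let k0 : (0 < k)%N := k_gt0 ordg.
Let kz : k%:Z != 0. Proof. by have := k0; lia. Qed.

Section Fixed.
Variables (mu mv : int) (h : C) (a L : int) (u v : V) (w : W) (f : {scalar W}).
Hypothesis hu : homog GV mu u.
Hypothesis ga : g u = eta R k ^ a *: u.
Hypothesis hv : homog GV mv v.
Hypothesis hw : homog gW h w.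
Hypothesis hf : forall y, f (gproj gW (wt k mu mv h L) y) = f y.
Variables (N : nat) (T : seq (int * int * C)).
Hypothesis dual : dual_with k gW Yg N T u v w f.

Local Notation p := (pP k Yg f L a u v w).
Local Notation q := (pQ k Yg f L a u v w).
Local Notation r := (pR k Yg f L u v w).
Local Notation be := (L - a).
(* The degree of the numerator in [(x, y)] that is forced by the scaling
   [(x, y) -> (t x, t y)]. *)
Let D : int := k%:Z * N%:Z - L - 2 * k%:Z.
Let TD := [seq t <- T | t.1.1 + t.1.2 == D].
Let bb (s : int) : C := \sum_(t <- TD | t.1.2 == s) t.2.
Let b (s : int) : C := bb (k%:Z * s - be).

Let nm_expr (x y : R) : 0 < x < y -> 0 < nm (x ^+ k)%:C < nm (y ^+ k)%:C.
Proof.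
move=> /andP[x0 xy]; have y0 := lt_trans x0 xy.
by rewrite !nm_real !gtr0_norm ?exprn_gt0 //= ltrXn2r // ?gtn_eqF // ltW.
Qed.

Lemma real_P (x y : R) : 0 < y < x ->
  sums (fun i : int => p i * (x%:C ^ (- a + k%:Z * i - k%:Z) *
                              y%:C ^ (- be - k%:Z * i - k%:Z)))
    (lreal T x%:C y%:C * (x%:C ^+ k - y%:C ^+ k) ^- N).
Proof.
move=> hxy; have /andP[y0 yx] := hxy; have x0 := lt_trans y0 yx.
have [h1 _ _] := dual (Ordinal k0); have := h1 _ _ (nm_expr hxy).
move/(fam12_P ordg grading_pres monodromy hu ga hv hw hf).
rewrite -[Posz (Ordinal k0)]/(0 : int); apply: eq_sums => [i|]; last first.
  by rewrite /lfun lnum_real // !rmorphXn.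
congr (_ * (_ * _)).
  have -> : - (a%:~R / k%:R) + i%:~R - 1 = (- a + k%:Z * i - k%:Z)%:~R / k%:R :> C.
    by rewrite !(intrB, intrD, intrM, intrN) -!pmulrn; field; exact: kC ordg.
  exact: bpow_real.
have -> : - (be%:~R / k%:R) - i%:~R - 1 = (- be - k%:Z * i - k%:Z)%:~R / k%:R :> C.
  by rewrite !(intrB, intrD, intrM, intrN) -!pmulrn; field; exact: kC ordg.
exact: bpow_real.
Qed.

Lemma real_Q (x y : R) : 0 < x < y ->
  sums (fun i : int => q i * (x%:C ^ (- a - k%:Z * i - k%:Z) *
                              y%:C ^ (- be + k%:Z * i - k%:Z)))
    (lreal T x%:C y%:C * (x%:C ^+ k - y%:C ^+ k) ^- N).
Proof.
move=> hxy; have /andP[x0 xy] := hxy; have y0 := lt_trans x0 xy.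
have [_ h2 _] := dual (Ordinal k0); have := h2 _ _ (nm_expr hxy).
move/(fam12_Q ordg grading_pres monodromy hu ga hv hw hf).
rewrite -[Posz (Ordinal k0)]/(0 : int); apply: eq_sums => [i|]; last first.
  by rewrite /lfun lnum_real // !rmorphXn.
congr (_ * (_ * _)).
  have -> : - (a%:~R / k%:R) - i%:~R - 1 = (- a - k%:Z * i - k%:Z)%:~R / k%:R :> C.
    by rewrite !(intrB, intrD, intrM, intrN) -!pmulrn; field; exact: kC ordg.
  exact: bpow_real.
have -> : - (be%:~R / k%:R) + i%:~R - 1 = (- be + k%:Z * i - k%:Z)%:~R / k%:R :> C.
  by rewrite !(intrB, intrD, intrM, intrN) -!pmulrn; field; exact: kC ordg.
exact: bpow_real.
Qed.

Lemma powk_neq (x y : R) : 0 < x -> 0 < y -> x != y -> x%:C ^+ k - y%:C ^+ k != 0.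
Proof.
move=> x0 y0 xy; rewrite subr_eq0 -!rmorphXn; apply: contraNneq xy => e.
have /complexI/eqP := e; rewrite eqrXn2 ?ltW //.
Qed.

Lemma homog_scale (F : int -> C) (E1 E2 : int -> int) (x y t : R) :
  0 < x -> 0 < y -> x != y -> 0 < t ->
  (forall i, E1 i + E2 i = - L - 2 * k%:Z) ->
  sums (fun i : int => F i * (x%:C ^ E1 i * y%:C ^ E2 i))
    (lreal T x%:C y%:C * (x%:C ^+ k - y%:C ^+ k) ^- N) ->
  sums (fun i : int => F i * ((t * x)%:C ^ E1 i * (t * y)%:C ^ E2 i))
    (lreal T (t * x)%:C (t * y)%:C * ((t * x)%:C ^+ k - (t * y)%:C ^+ k) ^- N) ->
  lreal T (t * x)%:C (t * y)%:C = t%:C ^ D * lreal T x%:C y%:C.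
Proof.
move=> x0 y0 xy t0 hE h1 h2.
have t0' := real_neq0 t0.
have d := powk_neq x0 y0 xy.
have tk : t%:C ^+ k != 0 by rewrite expf_neq0.
have h3 := sumsZ (t%:C ^ (- L - 2 * k%:Z)) h1.
have e : lreal T (t * x)%:C (t * y)%:C * ((t * x)%:C ^+ k - (t * y)%:C ^+ k) ^- N =
    t%:C ^ (- L - 2 * k%:Z) * (lreal T x%:C y%:C * (x%:C ^+ k - y%:C ^+ k) ^- N).
  apply: has_sum_unique (proj2 h2) _.
  rewrite (_ : (fun i => _) = fun i => t%:C ^ (- L - 2 * k%:Z) *
    (F i * (x%:C ^ E1 i * y%:C ^ E2 i))); first exact: (proj2 h3).
  have hx : (t * x)%:C = t%:C * x%:C by rewrite rmorphM.
  have hy : (t * y)%:C = t%:C * y%:C by rewrite rmorphM.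
  rewrite hx hy; apply/funext => i; rewrite -(hE i).
  by apply: scale_monomial; rewrite // real_neq0.
have dd : (t * x)%:C ^+ k - (t * y)%:C ^+ k = t%:C ^+ k * (x%:C ^+ k - y%:C ^+ k).
  by rewrite !rmorphM /= !exprMn mulrBr.
have nz : ((t * x)%:C ^+ k - (t * y)%:C ^+ k) ^+ N != 0.
  by rewrite dd expf_neq0 // mulf_neq0.
apply: (mulIf (invr_neq0 nz)); rewrite e dd exprMn invfM.
have -> : t%:C ^ D = t%:C ^ (- L - 2 * k%:Z) * (t%:C ^+ k) ^+ N.
  rewrite -exprM (exprnP _ (k * N)) -expfzDr //; congr (_ ^ _).
  by rewrite /D PoszM; ring.
by field; rewrite !expf_neq0.
Qed.

Lemma lreal_P (x y : R) : 0 < y < x -> lreal T x%:C y%:C = lreal TD x%:C y%:C.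
Proof.
move=> hxy; have /andP[y0 yx] := hxy; have x0 := lt_trans y0 yx.
have ne : x != y by rewrite gt_eqF.
apply: (lreal_homog x0 y0) => t /andP[t0 t1].
have ht : 0 < t * y < t * x by rewrite mulr_gt0 // ltr_pM2l.
apply: (homog_scale x0 y0 ne t0 _ (real_P hxy) (real_P ht)) => i; lia.
Qed.

Lemma lreal_Q (x y : R) : 0 < x < y -> lreal T x%:C y%:C = lreal TD x%:C y%:C.
Proof.
move=> hxy; have /andP[x0 xy] := hxy; have y0 := lt_trans x0 xy.
have ne : x != y by rewrite lt_eqF.
apply: (lreal_homog x0 y0) => t /andP[t0 t1].
have ht : 0 < t * x < t * y by rewrite mulr_gt0 // ltr_pM2l.
apply: (homog_scale x0 y0 ne t0 _ (real_Q hxy) (real_Q ht)) => i; lia.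
Qed.

Lemma vanish_tsum c (x : int -> C) M : vanish_from M x -> vanish_from M (tsum c x).
Proof. by move=> hx n hn; rewrite (tsumE (K := 0) _ hx) ?big_ord0 // addr0. Qed.

Lemma bb_P (e : int) : bb e = if (k%:Z %| - be - k%:Z - e)%Z
  then tsum (sbinc N%:R) p ((- be - k%:Z - e) %/ k%:Z)%Z else 0.
Proof.
have [M hM] := vanish_pP ordg truncation f L a u v w.
apply: (laurent_coef (l := TD) (e := fun t => t.1.2) (c := fun t => t.2) k0
  (vanish_tsum (sbinc N%:R) hM)) => y hy; have /andP[y0 y1] := hy.
have y0' := real_neq0 y0.
have hy1 : 0 < y < 1 by [].
have := real_P hy1; rewrite (lreal_P hy1) => hs.
pose Y := y ^+ k; have Y0 : 0 < Y by rewrite exprn_gt0.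
have YE : Y%:C = y%:C ^+ k by rewrite rmorphXn.
have h1 : sums (fun i : int => p i * Y%:C ^ (- i))
    (y%:C ^ (be + k%:Z) * (lreal TD 1 y%:C * (1 - Y%:C) ^- N)).
  apply: eq_sums (sumsZ (y%:C ^ (be + k%:Z)) hs) => [i|].
    rewrite rmorph1 exp1rz mul1r mulrCA -expfzDr //; congr (_ * _).
    by rewrite YE exprnP exprz_exp; congr (_ ^ _); ring.
  by rewrite rmorph1 expr1n YE.
have := sumsZ (y%:C ^ (- be - k%:Z)) (sums_shift_mul N Y0 hM h1).
have nz : (1 - Y%:C) ^+ N != 0.
  have := @powk_neq 1 y ltr01 y0; rewrite gt_eqF // => /(_ isT).
  by rewrite rmorph1 expr1n -YE => ?; rewrite expf_neq0.
apply: eq_sums => [n|].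
  rewrite mulrCA YE exprnP exprz_exp -expfzDr //; congr (_ * _ ^ _); ring.
rewrite /lreal; under eq_bigr => t _ do rewrite exp1rz mulr1.
set S := \sum_(t <- TD) _.
have -> : - be - k%:Z = - (be + k%:Z) by ring.
rewrite -invr_expz; field; rewrite nz /=; exact: expfz_neq0.
Qed.

Lemma bb_Q (n : int) :
  (-1) ^+ N * tsum (sbinc N%:R) q n = bb (k%:Z * (N%:Z - 1 + n) - be).
Proof.
have [M hM] := vanish_pQ ordg truncation f L a u v w.
pose A n := (-1) ^+ N * tsum (sbinc N%:R) q n.
have vA : vanish_from M A by move=> i hi; rewrite /A (vanish_tsum _ hM) ?mulr0.
have H : forall i, \sum_(t <- TD | t.1.1 == i) t.2 =
    if (k%:Z %| (- a - k%:Z) - i)%Z then A (((- a - k%:Z) - i) %/ k%:Z)%Z else 0.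
  apply: (laurent_coef (l := TD) (e := fun t => t.1.1) (c := fun t => t.2) k0 vA) => y hy.
  have /andP[y0 y1] := hy.
  have y0' := real_neq0 y0.
  have hy1 : 0 < y < 1 by [].
  have := real_Q hy1; rewrite (lreal_Q hy1) => hs.
  pose Y := y ^+ k; have Y0 : 0 < Y by rewrite exprn_gt0.
  have YE : Y%:C = y%:C ^+ k by rewrite rmorphXn.
  have h1 : sums (fun i : int => q i * Y%:C ^ (- i))
      (y%:C ^ (a + k%:Z) * (lreal TD y%:C 1 * (Y%:C - 1) ^- N)).
    apply: eq_sums (sumsZ (y%:C ^ (a + k%:Z)) hs) => [i|].
      rewrite rmorph1 exp1rz mulr1 mulrCA -expfzDr //; congr (_ * _).
      by rewrite YE exprnP exprz_exp; congr (_ ^ _); ring.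
    by rewrite rmorph1 expr1n YE.
  have := sumsZ ((-1) ^+ N * y%:C ^ (- a - k%:Z)) (sums_shift_mul N Y0 hM h1).
  have nz : (Y%:C - 1) ^+ N != 0.
    have := @powk_neq y 1 y0 ltr01; rewrite lt_eqF // => /(_ isT).
    by rewrite rmorph1 expr1n -YE => ?; rewrite expf_neq0.
  apply: eq_sums => [m|].
    rewrite /A mulrACA; congr (_ * _).
    by rewrite YE exprnP exprz_exp -expfzDr //; congr (_ ^ _); ring.
  have -> : lreal TD y%:C 1 = \sum_(t <- TD) t.2 * y%:C ^ t.1.1.
    by apply: eq_bigr => t _; exact: mulr_exp1z.
  set S := \sum_(t <- TD) _.
  have -> : - a - k%:Z = - (a + k%:Z) by ring.
  have -> : (1 - Y%:C) ^+ N = (-1) ^+ N * (Y%:C - 1) ^+ N.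
    by rewrite -exprNn opprB.
  have e : (-1) ^+ N * (-1) ^+ N = 1 :> C by rewrite -expr2 sqrr_sign.
  rewrite -invr_expz -[RHS]mul1r -[X in _ = X * _]e; move: ((-1) ^+ N) => m1.
  by field; rewrite nz /=; exact: expfz_neq0.
have := H (- a - k%:Z - k%:Z * n).
rewrite (_ : - a - k%:Z - (- a - k%:Z - k%:Z * n) = k%:Z * n); last by ring.
rewrite dvdz_mulr ?dvdzz // mulKz // -/(A n) => <-.
rewrite /bb /TD !big_filter_cond; apply: eq_bigl => t.
apply: andb_id2l => /eqP e; rewrite /D in e; apply/eqP/eqP => e'; lia.
Qed.

Lemma bb_off (e : int) : ~~ (k%:Z %| e + be)%Z -> bb e = 0.
Proof.
move=> ne; rewrite bb_P; case: ifP => // /dvdzP[x hx].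
by case/negP: ne; apply/dvdzP; exists (- x - 1); lia.
Qed.

Lemma b_supported : exists B : nat, supported (- B%:Z) (B + B).+1 b.
Proof.
have [B hB] : exists B : nat, forall t, t \in T -> (`|(t.1.2 + be)%R| <= B)%N.
  elim: (T) => [|t T' [B hB]]; first by exists 0%N.
  exists (maxn B `|(t.1.2 + be)%R|) => t'; rewrite inE => /orP[/eqP->|/hB e].
    by rewrite leq_max leqnn orbT.
  by rewrite leq_max e.
exists B => s hs; rewrite /b /bb big_seq_cond big1 // => t /andP[].
rewrite mem_filter => /andP[_ /hB le] /eqP e; exfalso.
by move: le; rewrite e subrK; have := k0; nia.
Qed.

Lemma regroup s0 K (phi : int -> C) : supported s0 K b ->
  \sum_(t <- TD) t.2 * phi t.1.2 =
  \sum_(j < K) b (s0 + j%:Z) * phi (k%:Z * (s0 + j%:Z) - be).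
Proof.
move=> hb; have E : \sum_(t <- TD) t.2 * phi t.1.2 =
    \sum_(s \in [set: int]) bb s * phi s.
  have ur := undup_uniq [seq t.1.2 | t <- TD].
  rewrite (fsum_seq ur); last first.
    move=> s; rewrite mem_undup => hs; rewrite /bb big_seq_cond big1 ?mul0r //.
    move=> t /andP[tD /eqP e]; case/negP: hs; rewrite -e; exact: map_f.
  under [RHS]eq_bigr => s _ do rewrite mulr_suml.
  rewrite (exchange_big_dep xpredT) //= big_seq [RHS]big_seq.
  apply: eq_bigr => t tD; rewrite big_mkcond (bigD1_seq t.1.2) /=; first last.
  - by [].
  - by rewrite mem_undup; apply/mapP; exists t.
  by rewrite eqxx big1 ?addr0 // => s /negPf; rewrite eq_sym => ->.
rewrite E (fsum_seq (r := [seq k%:Z * (s0 + j%:Z) - be | j <- iota 0 K])).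
- rewrite big_map -[in RHS](big_mkord xpredT (fun j : nat =>
    b (s0 + j%:Z) * phi (k%:Z * (s0 + j%:Z) - be))) /index_iota subn0.
  by apply: eq_bigr.
- rewrite map_inj_uniq ?iota_uniq // => i j /addIr/(mulfI kz)/addrI; lia.
move=> s hs; have [/dvdzP[x hx]|nd] := boolP (k%:Z %| s + be)%Z; last first.
  by rewrite bb_off ?mul0r.
have -> : s = k%:Z * x - be by lia.
rewrite -/(b x) hb ?mul0r //; apply: contra hs => hx'.
apply/mapP; exists (absz (x - s0)); first by rewrite mem_iota; lia.
have -> : s0 + `|(x - s0)%R|%N%:Z = x by lia.
by lia.
Qed.

Lemma r_expansion s0 K : supported s0 K b ->
  forall m, r m = expansion (monoR (a%:~R / k%:R : C) N) s0 K b m.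
Proof.
move=> hb; pose d m := r m - expansion (monoR (a%:~R / k%:R : C) N) s0 K b m.
suff H e : d (- 1 - e) = 0.
  by move=> m; apply/eqP; rewrite -subr_eq0; have := H (- 1 - m); rewrite subKr /d => ->.
have [Mr hMr] := vanish_pR k Yg f L u v w.
have := @laurent_coef R 1 (-1) (Num.max Mr N%:Z) d unit [::] (fun=> 0) (fun=> 0) isT _ _ e.
rewrite big_nil dvd1z divz1 => <- //.
  move=> i hi; rewrite /d hMr ?vanish_expandR ?subrr //; lia.
move=> y hy; have /andP[y0 y1] := hy; rewrite big_nil.
have y0' := real_neq0 y0.
pose x := expR (ln (1 + y) / k%:R).
have y1' : 0 < 1 + y by rewrite addr_gt0.
have xk : x ^+ k = 1 + y.
  by rewrite /x -expRM_natr divfK ?lnK // pnatr_eq0 -lt0n.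
have x1 : 1 < x.
  rewrite /x expR_gt1; apply: divr_gt0; first by apply: ln_gt0; lra.
  by rewrite ltr0n.
have zE : (x ^+ k)%:C - (1 ^+ k)%:C = y%:C.
  rewrite -[LHS](rmorphB _ (x ^+ k) (1 ^+ k)); congr (_%:C).
  by rewrite xk expr1n addrAC subrr add0r.
have hz : 0 < nm ((x ^+ k)%:C - (1 ^+ k)%:C) < nm (1 ^+ k)%:C.
  by rewrite zE expr1n !nm_real normr1 gtr0_norm // y0.
have carg0 (z : R) : 0 < z -> carg z%:C = 0.
  move=> z0; have := congr1 (@complex.Im R) (lbranch0_real z0).
  by rewrite /lbranch /clog /= mulr0 mul0r addr0.
have harg : `|carg (x ^+ k)%:C - carg (1 ^+ k)%:C| < pi / 2.
  rewrite !carg0 ?exprn_gt0 // ?(lt_trans ltr01) // subrr normr0.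
  by rewrite divr_gt0 // pi_gt0.
have x0 : 0 < x by apply: lt_trans x1.
have b1 e' : bpow 0 (1 ^+ k)%:C e' = 1.
  by rewrite /bpow lbranch0_real ?exprn_gt0 // expr1n ln1 mulr0 cexp0.
have [_ _ h3] := dual (Ordinal k0).
have [s1 s2] := h3 _ _ hz.
have [e1 e2] := fam_iter_sums ordg grading_pres hu hv hw hf 0 (x ^+ k)%:C (1 ^+ k)%:C erefl.
have [t1 t2] := expandR_sums ordg a L N s0 K b 0 hz.
have S1 : sums (fun m : int => r m * y%:C ^ (- m - 1)) (lfun k N T 0 (x ^+ k)%:C (1 ^+ k)%:C).
  have := conj (e1.1 s1) ((e2 _).1 (s2 harg)); apply: eq_sums => // m.
  by rewrite zE b1 mulr1.
have S2 : sums (fun m : int => expansion (monoR (a%:~R / k%:R : C) N) s0 K b m * y%:C ^ (- m - 1))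
    (lfun k N (expand_list k a L N s0 K b) 0 (x ^+ k)%:C (1 ^+ k)%:C).
  have := conj t1 (t2 harg); apply: eq_sums => // m.
  by rewrite zE b1 mulr1.
have lE : lfun k N T 0 (x ^+ k)%:C (1 ^+ k)%:C =
    lfun k N (expand_list k a L N s0 K b) 0 (x ^+ k)%:C (1 ^+ k)%:C.
  rewrite /lfun; congr (_ * _); rewrite !lnum_real // lreal_P ?x1 ?ltr01 //.
  rewrite /lreal rmorph1.
  rewrite big_seq; under eq_bigr => t ht.
    rewrite exp1rz mulr1 (_ : t.1.1 = D - t.1.2); last first.
      by move: ht; rewrite mem_filter => /andP[/eqP <- _]; rewrite addrK.
    over.
  rewrite -big_seq (regroup (fun s => x%:C ^ (D - s)) hb) /expand_list big_map.
  rewrite -[in LHS](big_mkord xpredT (fun j : nat =>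
    b (s0 + j%:Z) * x%:C ^ (D - (k%:Z * (s0 + j%:Z) - be)))) /index_iota subn0.
  apply: eq_bigr => j _; rewrite exp1rz mulr1; congr (_ * _ ^ _).
  by rewrite /D /=; ring.
rewrite lE in S1; apply: eq_sums (sumsD S1 (sumsZ (- 1) S2)) => [m|].
  rewrite /d mulN1r -mulrBl; congr (_ * _ ^ _); ring.
by rewrite mulN1r subrr.
Qed.

Lemma dual_borcherds : borcherds (a%:~R / k%:R) p q r.
Proof.
have [B hB] := b_supported.
have [Mp hp] := vanish_pP ordg truncation f L a u v w.
have [Mq hq] := vanish_pQ ordg truncation f L a u v w.
have pE := expandP_unique (N := N) hp hB.
have qE := expandQ_unique (N := N) hq hB.
have {}pE : p = expansion (monoP R N) (- B%:Z) (B + B).+1 b.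
  apply/funext/pE => s; rewrite /b bb_P.
  rewrite (_ : - be - k%:Z - (k%:Z * s - be) = k%:Z * (- 1 - s)); last by ring.
  by rewrite dvdz_mulr ?dvdzz // mulKz.
have {}qE : q = expansion (monoQ R N) (- B%:Z) (B + B).+1 b.
  apply/funext/qE => s; rewrite bb_Q /b; congr bb; ring.
rewrite pE qE (funext (r_expansion hB)); exact: expand_borcherds.
Qed.

End Fixed.

Lemma duality_jacobi : duality k gW Yg -> twisted_jacobi g k Yg.
Proof.
move=> /(duality_dual_at gW Yg ordg) H.
apply: (borcherds_jacobi autg ordg grading_pres grading_restr monodromy truncation).
move=> a mu mv h u v w hu ga hv hw L f hf.
have [N [T [_ d]]] := H u v w f (proj_in_dual hf).
exact: (dual_borcherds hu ga hv hw hf d).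
Qed.

End Backward.

Theorem theorem2p4 (R : realType) (V : voa R) (g : {linear V -> V}) (k : nat)
    (W : lmodType R[i]%C) (gW : grading R[i]%C W)
    (Yg : int -> {bilinear V -> W -> W}) :
  voa_automorphism g ->
  has_finite_order g k ->
  grading_preserving k gW Yg ->
  grading_restriction k gW ->
  formal_monodromy g k Yg ->
  lower_truncation Yg ->
  identity_property k Yg ->
  L0_grading k gW Yg ->
  Lm1_derivative k Yg ->
  twisted_jacobi g k Yg <-> duality k gW Yg.
Proof.
move=> autg ordg gp gr mono trunc _ _ _; split; first exact: jacobi_duality.
exact: duality_jacobi.
Qed.
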